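(* For all positive integers $\Delta$ and $k$ there exists a constant $C_{\Delta,k}$ such that the following holds. For any tree $T$ with maximum degree at most $\Delta$ and any positive integers $m_1\leq m_2\leq\dots\leq m_k$ with $|T|\geq C_{\Delta,k}\, m_k\log^4 m_k$, the tree $T$ is $K_{m_1,m_2,\dots,m_k}$-good, i.e. $R(T,K_{m_1,\dots,m_k})=(|T|-1)(k-1)+m_1$.
   Context: $K_{m_1,\dots,m_k}$ denotes the complete $k$-partite graph with parts of sizes $m_1,\dots,m_k$. For graphs $G,H$, the Ramsey number $R(G,H)$ is the smallest $N$ such that every red-blue coloring of the edges of $K_N$ contains a red copy of $G$ or a blue copy of $H$. A connected graph $G$ is $H$-good if $R(G,H)=(|G|-1)(\chi(H)-1)+\sigma(H)$, where $\chi(H)$ is the chromatic number and $\sigma(H)$ is the smallest possible size of a color class in a proper $\chi(H)$-coloring of $H$. *)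

(* Defs.v *)
From HB Require Import structures.
From mathcomp Require Import all_boot all_order all_algebra.
From mathcomp Require Import reals exp.

Set Implicit Arguments.
Unset Strict Implicit.
Unset Printing Implicit Defensive.

Record sgraph := SGraph {
  vertex :> finType;
  adj : rel vertex;
  adj_sym : symmetric adj;
  adj_irrefl : irreflexive adj }.

Definition max_degree (G : sgraph) : nat :=
  \max_(v : G) #|[set w : G | adj v w]|.

Definition connected_graph (G : sgraph) : Prop :=
  0 < #|G| /\ forall x y : G, connect (@adj G) x y.

(* [ucycle] asks the vertices to be distinct; the bound on the size excludes
   [:: x; y], which is a [ucycle] for every edge xy. *)
Definition acyclic_graph (G : sgraph) : Prop :=
  forall c : seq G, ucycle (@adj G) c -> size c < 3.

Definition is_tree (G : sgraph) : Prop :=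
  connected_graph G /\ acyclic_graph G.

Definition proper_colouring (G : sgraph) n (f : {ffun G -> 'I_n}) : bool :=
  [forall x : G, forall y : G, adj x y ==> (f x != f y)].

Definition colourable (G : sgraph) (n : nat) : bool :=
  [exists f : {ffun G -> 'I_n}, proper_colouring f].

Lemma colourable_card (G : sgraph) : exists n, colourable G n.
Proof.
exists #|G|; apply/existsP; exists [ffun x => enum_rank x].
apply/forallP => x; apply/forallP => y; apply/implyP => xy; rewrite !ffunE.
by apply: contraTneq xy => /enum_rank_inj ->; rewrite adj_irrefl.
Qed.

Definition chromatic_number (G : sgraph) : nat := ex_minn (colourable_card G).

(* The default value #|G| of the minima is never smaller than a colour class. *)
Definition sigma (G : sgraph) : nat :=
  \big[minn/#|G|]_(f : {ffun G -> 'I_(chromatic_number G)} | proper_colouring f)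
    \big[minn/#|G|]_(c < chromatic_number G) #|[set x : G | f x == c]|.

Section CompleteMultipartite.
Variables (k : nat) (m : k.-tuple nat).

Definition multipartite_vertex : finType := {i : 'I_k & 'I_(tnth m i)}.

Definition multipartite_adj : rel multipartite_vertex :=
  fun x y => tag x != tag y.

Lemma multipartite_adj_sym : symmetric multipartite_adj.
Proof. by move=> x y; rewrite /multipartite_adj eq_sym. Qed.

Lemma multipartite_adj_irrefl : irreflexive multipartite_adj.
Proof. by move=> x; rewrite /multipartite_adj eqxx. Qed.

Definition complete_multipartite : sgraph :=
  SGraph multipartite_adj_sym multipartite_adj_irrefl.

End CompleteMultipartite.

(* A red-blue colouring of the edges of K_N is given by c : {set 'I_N} -> bool,
   where c [set x; y] is the colour of the edge xy (true is red, false is blue);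
   the values of c on other sets are irrelevant. *)
Definition mono_copy (N : nat) (c : {set 'I_N} -> bool) (col : bool)
    (G : sgraph) : Prop :=
  exists2 f : G -> 'I_N, injective f &
    forall x y : G, adj x y -> c [set f x; f y] = col.

Definition ramsey_arrow (N : nat) (G H : sgraph) : Prop :=
  forall c : {set 'I_N} -> bool, mono_copy c true G \/ mono_copy c false H.

(* R(G, H) = N *)
Definition is_ramsey_number (G H : sgraph) (N : nat) : Prop :=
  ramsey_arrow N G H /\ forall n, ramsey_arrow n G H -> N <= n.

(* G is H-good *)
Definition good (G H : sgraph) : Prop :=
  connected_graph G /\
  is_ramsey_number G H ((#|G| - 1) * (chromatic_number H - 1) + sigma H).

(* Main.v *)
(** Write n = |T|, M = m_k, and call a set joined if it contains no two large
    sets without a red edge between them.  Colouring red the edges inside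
    disjoint blocks of n-1 vertices gives the lower bound.  For the upper bound,
    suppose that there is no red copy of T.

    - T, cut at one of its edges, would embed in two disjoint red expanders
      joined by a red edge.  So, if there is no blue K_(M,...,M) either, the
      vertices split into k-1 joined sets of about n vertices each, and each of
      them contains most of the vertices of an expander without red edges to the
      other sets.
    - In a joined set with n-1+a vertices T embeds, leaving a-1 vertices unused.
      If T has many leaves, embed T without them and attach them by Hall's
      theorem.  Otherwise T has many long disjoint bare paths; these are routed
      through a Benes network of red paths, which realizes every permutation of
      its terminals on the same set of vertices, so that the remaining vertices
      can be matched into its ends first.  There are O(M) routes, through O(log M)
      switches each, and a route through a switch has length O(log^2 M).
    - The k-1 sets have (n-1)(k-1)+m_1 vertices in all, so that their excesses
      over n-1 sum to at least m_1.  A set with excess b contains b vertices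
      that are blue to many others of the same set; together these vertices are
      the part of size m_1, and what they are blue to gives the other parts.

    Embedding is by extension (Friedman-Pippenger, Haxell), with the roll-back
    trick: vertices that turn out not to be needed can be given back.  If M = 1,
    Chvatal's greedy argument works for every n. *)
Require Import Defs.
From mathcomp Require Import all_boot all_order all_algebra.
From mathcomp Require Import reals sequences exp.
From mathcomp Require Import zify.

Set Implicit Arguments.
Unset Strict Implicit.
Unset Printing Implicit Defensive.

(** * Extending partial embeddings in expanding graphs *)

Section Expansion.
Variables (V : finType) (e : rel V).
Implicit Types (S X Y Z K : {set V}) (r : V -> nat).

(** The obstacle is that the tree has to occupy all but [a - 1] vertices of its host, while
    embedding by extension needs about [2 * M * D] free vertices: with fewer, joinedness no longer
    gives sets of [M] vertices enough free neighbours. So what is embedded last must accept whatever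
    vertices are left. Leaves do, by Hall's condition. An inner vertex of a path has prescribed
    neighbours on both sides, and two matchings pair these sides in an order that cannot be chosen;
    a network is needed to undo it, and it has to be built before the order is known.

    The cubed logarithm has three sources: a path between two given vertices climbs two binary trees
    with about [M] leaves, a switch is a ladder whose rungs are such paths and which has about as
    many levels as a rung has vertices, and the number of stages is logarithmic in the number of
    wires.

    All other losses are multiples of [M] with factors depending on [Delta] and [k] only. They must
    not enter the count of excesses over [n - 1], so vertices discarded while cores are built are
    put back before counting. *)

Definition nb S := [set y | [exists x in S, e x y]].

Lemma nbP S y : reflect (exists2 x, x \in S & e x y) (y \in nb S).
Proof. by rewrite inE; apply: exists_inP. Qed.

Lemma nbS S1 S2 : S1 \subset S2 -> nb S1 \subset nb S2.
Proof.
move=> s12; apply/subsetP => y /nbP[x xS exy]; apply/nbP.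
by exists x; first exact: subsetP s12 _ _.
Qed.

Lemma nbU S1 S2 : nb (S1 :|: S2) = nb S1 :|: nb S2.
Proof.
apply/setP => y; rewrite in_setU; apply/nbP/orP.
  by case=> x; rewrite inE => /orP[] xS exy; [left|right]; apply/nbP; exists x.
by case=> /nbP[x xS exy]; exists x => //; rewrite inE xS ?orbT.
Qed.

Lemma nb0 : nb set0 = set0.
Proof. by apply/setP => y; rewrite in_set0; apply/nbP => -[x]; rewrite in_set0. Qed.

Section Extension.
Variables M D : nat.

(* [r x] is the number of neighbours in [Y] still to be given to [x]. Sets of up
   to [2M] vertices are considered so that the union of two tight sets is tight. *)
Definition extendable X Y r := forall S, S \subset X -> #|S| <= M.*2 ->
  \sum_(x in S) r x <= #|nb S :&: Y|.

(* [k] is the number of vertices that may still be taken out of [Y]. *)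
Definition roomy X Y k := forall S, S \subset X -> M <= #|S| ->
  (M * D).*2 + k <= #|nb S :&: Y|.

Lemma sum_bound S r : (forall x, r x <= D) -> \sum_(x in S) r x <= #|S| * D.
Proof. by move=> rD; rewrite -sum_nat_const; apply: leq_sum. Qed.

Lemma roomy_sub X Y Y' k k' : roomy X Y k -> Y' \subset Y ->
  k' + #|Y :\: Y'| <= k -> roomy X Y' k'.
Proof.
move=> rY sY le_k S SX MS; have := rY S SX MS.
suff: #|nb S :&: Y| <= #|nb S :&: Y'| + #|Y :\: Y'| by lia.
rewrite -cardsUI (leq_trans _ (leq_addr _ _)) // subset_leq_card //.
apply/subsetP => y; rewrite !inE => /andP[-> ->].
by case: (y \in Y').
Qed.

Lemma sum_decr S r v : 0 < r v ->
  \sum_(x in S) (r x - (x == v)) + (v \in S) = \sum_(x in S) r x.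
Proof.
move=> rv; case: (boolP (v \in S)) => vS.
  rewrite (bigD1 v) //= [in RHS](bigD1 v) //= eqxx addnAC subn1 addn1 prednK //.
  by congr (_ + _); apply: eq_bigr => x /andP[_ /negbTE->]; rewrite subn0.
rewrite addn0; apply: eq_bigr => x xS.
by rewrite (_ : x == v = false) ?subn0 //; apply: contraNF vS => /eqP<-.
Qed.

(** The inequality of [extendable] is an equality for these sets, so that none of their neighbours
    in [Y] can be given to a vertex outside of them. *)
Definition tight X Y r S :=
  [&& S \subset X, #|S| <= M & #|nb S :&: Y| == \sum_(x in S) r x].

(** A set with at least [M] elements has more than [(M * D).*2] neighbours in [Y], which exceeds any
    sum of at most [M.*2] values of [r]. *)
Lemma tight_small X Y r k S : (forall x, r x <= D) -> roomy X Y k.+1 ->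
  S \subset X -> #|S| <= M.*2 -> #|nb S :&: Y| = \sum_(x in S) r x -> #|S| < M.
Proof.
move=> rD rY SX S2 tS; rewrite ltnNge; apply/negP => MS.
have := rY _ SX MS; rewrite tS; have := sum_bound S rD.
suff: #|S| * D <= (M * D).*2 by lia.
by rewrite doubleMl leq_mul2r S2 orbT.
Qed.

(** The number of neighbours in [Y] is submodular and the sum of [r] is modular, so [extendable] for
    the union and for the intersection forces equality in both. *)
Lemma tightU X Y r k S1 S2 : extendable X Y r -> (forall x, r x <= D) ->
  roomy X Y k.+1 -> tight X Y r S1 -> tight X Y r S2 -> tight X Y r (S1 :|: S2).
Proof.
move=> gY rD rY /and3P[s1 c1 /eqP t1] /and3P[s2 c2 /eqP t2].
have sU : S1 :|: S2 \subset X by rewrite subUset s1.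
have cU : #|S1 :|: S2| <= M.*2.
  by rewrite (leq_trans (leq_card_setU _ _)) // -addnn leq_add.
have cI : #|S1 :&: S2| <= M.*2.
  rewrite (leq_trans (subset_leq_card (subsetIl _ _))) //; lia.
have sI : S1 :&: S2 \subset X by rewrite (subset_trans (subsetIl _ _)).
have gU := gY _ sU cU; have gI := gY _ sI cI.
have sumUI : \sum_(x in S1 :|: S2) r x + \sum_(x in S1 :&: S2) r x =
             \sum_(x in S1) r x + \sum_(x in S2) r x.
  rewrite (big_setID S1) /=.
  have /setIidPr-> : S1 \subset S1 :|: S2 by rewrite subsetUl.
  have -> : (S1 :|: S2) :\: S1 = S2 :\: S1 by rewrite setDUl setDv set0U.
  by rewrite [in RHS](big_setID S1 (A := S2)) /= setIC; lia.
have cNU : #|nb (S1 :|: S2) :&: Y| + #|nb (S1 :&: S2) :&: Y| <=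
           #|nb S1 :&: Y| + #|nb S2 :&: Y|.
  rewrite nbU setIUl -[leqRHS]cardsUI leq_add2l subset_leq_card // -setIIl setSI //.
  by rewrite subsetI !nbS ?subsetIl ?subsetIr.
have tU : #|nb (S1 :|: S2) :&: Y| = \sum_(x in S1 :|: S2) r x by lia.
by rewrite /tight sU tU eqxx andbT ltnW // (tight_small rD rY sU cU tU).
Qed.

(** All sets that could obstruct the removal of a vertex lie in a single tight set, so that it is
    enough to avoid the neighbourhood of that one. *)
Lemma tight_max X Y r k (P : pred {set V}) : extendable X Y r ->
  (forall x, r x <= D) -> roomy X Y k.+1 ->
  P set0 -> (forall S1 S2, P S1 -> P S2 -> P (S1 :|: S2)) ->
  exists S, [/\ tight X Y r S, P S &
    forall S', tight X Y r S' -> P S' -> S' \subset S].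
Proof.
move=> gY rD rY P0 PU.
have t0 : tight X Y r set0.
  by rewrite /tight sub0set cards0 /= nb0 set0I cards0 big_set0.
have [|S /andP[tS PS] maxS] := @arg_maxnP _ set0
  (fun S => tight X Y r S && P S) (fun S => #|S|); first by rewrite t0 P0.
exists S; split => // S' tS' PS'.
have /maxS : tight X Y r (S :|: S') && P (S :|: S').
  by rewrite PU // (tightU gY rD rY tS tS').
move=> le; have /eqP-> : S == S :|: S' by rewrite eqEcard subsetUl.
exact: subsetUr.
Qed.

Lemma extendable_remove X Y r k y v : extendable X Y r -> (forall x, r x <= D) ->
  roomy X Y k.+1 -> y \in Y -> (v \in X -> e v y) -> (v \in X -> 0 < r v) ->
  (forall S, tight X Y r S -> v \notin S -> y \notin nb S) ->
  extendable X (Y :\ y) (fun x => r x - (x == v)).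
Proof.
move=> gY rD rY yY evy rv nt S SX S2; rewrite leqNgt; apply/negP => lt.
have le := gY S SX S2.
have leS : \sum_(x in S) (r x - (x == v)) <= \sum_(x in S) r x.
  by apply: leq_sum => x _; rewrite leq_subr.
have cD : #|nb S :&: (Y :\ y)| + (y \in nb S) = #|nb S :&: Y|.
  rewrite setIDA [RHS](cardsD1 y) in_setI yY andbT addnC; congr (_ + _).
have cY : y \in nb S.
  by apply: contraLR lt => /negbTE yn; move: cD; rewrite yn -leqNgt; lia.
have vS : v \notin S.
  apply/negP => vS; have vX := subsetP SX _ vS.
  have := sum_decr S (rv vX); rewrite vS; lia.
have tS : #|nb S :&: Y| = \sum_(x in S) r x by lia.
suff tt : tight X Y r S by have := nt S tt vS; rewrite cY.
by rewrite /tight SX tS eqxx andbT ltnW // (tight_small rD rY SX S2 tS).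
Qed.

(** Let [S] be the largest tight set without [v]. If all neighbours of [v] in [Y] were neighbours of
    [S], adding [v] to [S] would raise the sum of [r] but not the neighbourhood. A neighbour of [v]
    outside of [nb S] is a neighbour of no tight set that avoids [v]. *)
Lemma extendable_step X Y r k v : extendable X Y r -> (forall x, r x <= D) ->
  roomy X Y k.+1 -> v \in X -> 0 < r v ->
  exists y, [/\ y \in Y, e v y & extendable X (Y :\ y) (fun x => r x - (x == v))].
Proof.
move=> gY rD rY vX rv.
have [|S1 S2|S [tS vS maxS]] := @tight_max X Y r k (fun S => v \notin S) gY rD rY.
- by rewrite inE.
- by rewrite inE negb_or => -> ->.
case: (boolP (nb [set v] :&: Y \subset nb S)) => [sub|/subsetPn[y]].
  case/and3P: tS => SX SM /eqP tS.
  have cS := tight_small rD rY SX (leq_trans SM _) tS.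
  have vSX : v |: S \subset X by rewrite subUset sub1set vX.
  have := gY _ vSX; rewrite cardsU1 vS /=.
  have -> : nb (v |: S) :&: Y = nb S :&: Y.
    by rewrite nbU setIUl; apply/setUidPr; rewrite subsetI sub subsetIr.
  rewrite big_setU1 //= tS -addnn => /(_ _) lt.
  by have := lt ltac:(lia); lia.
rewrite inE => /andP[/nbP[v' /set1P-> evy] yY] yS.
exists y; split => //; apply: (extendable_remove gY rD rY yY) => // S' tS' vS'.
by apply: contra yS; apply/subsetP/nbS/maxS.
Qed.

(** This serves vertices that are set aside or embedded without a parent. The largest tight set has
    at most [M * D] neighbours in [Y], fewer than there are vertices in [Y]; any vertex that is not
    one of them can go. *)
Lemma extendable_pick X Y r k : extendable X Y r -> (forall x, r x <= D) ->
  roomy X Y k.+1 -> M <= #|X| -> exists2 y, y \in Y & extendable X (Y :\ y) r.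
Proof.
move=> gY rD rY MX.
have [//|//|S [/and3P[SX SM /eqP tS] _ maxS]] :=
  @tight_max X Y r k predT gY rD rY.
have cY : (M * D).*2 + k.+1 <= #|Y|.
  by apply: leq_trans (rY X _ _) _ => //; rewrite subset_leq_card ?subsetIr.
case: (boolP (Y \subset nb S)) => [/setIidPr eY|/subsetPn[y yY yS]].
  move: tS; rewrite eY => tS; have := sum_bound S rD.
  by have : #|S| * D <= M * D by [rewrite leq_mul2r SM orbT]; lia.
exists y => // S' S'X S'2; rewrite leqNgt; apply/negP => lt.
have le := gY S' S'X S'2.
have cD : #|nb S' :&: (Y :\ y)| + (y \in nb S') = #|nb S' :&: Y|.
  by rewrite setIDA [RHS](cardsD1 y) in_setI yY andbT addnC; congr (_ + _).
have yS' : y \in nb S'.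
  by apply: contraLR lt => /negbTE yn; move: cD; rewrite yn -leqNgt; lia.
have tS' : #|nb S' :&: Y| = \sum_(x in S') r x by lia.
suff /nbS/subsetP/(_ _ yS') : S' \subset S by rewrite (negbTE yS).
apply: maxS => //; rewrite /tight S'X tS' eqxx andbT ltnW //.
exact: (tight_small rD rY S'X S'2 tS').
Qed.

(** A vertex given back is again a free neighbour of every set that contains its parent, and this
    pays for the unit of demand returned to the parent. *)
Lemma extendable_rollback X Y r K (par : V -> V) : extendable X Y r ->
  [disjoint K & Y] -> (forall y, y \in K -> e (par y) y) ->
  extendable X (Y :|: K) (fun x => r x + #|[set y in K | par y == x]|).
Proof.
move=> gY dKY pK S SX S2; rewrite big_split /=.
set K' := [set y in K | par y \in S].
have -> : \sum_(x in S) #|[set y in K | par y == x]| = #|K'|.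
  rewrite -[RHS]sum1_card [RHS](partition_big par (mem S)) /=; last first.
    by move=> y; rewrite inE => /andP[].
  apply: eq_bigr => x xS; rewrite -sum1_card; apply: eq_bigl => y.
  by rewrite !inE -andbA; case: eqP => [->|]; rewrite ?xS ?andbF.
have dis : [disjoint nb S :&: Y & K'].
  apply: (disjointWl (subsetIr _ _)); rewrite disjoint_sym.
  by apply: disjointWl dKY; apply/subsetP => y; rewrite inE => /andP[].
apply: leq_trans (leq_add (gY S SX S2) (leqnn _)) _.
move: dis; rewrite -leq_card_setU => /eqP <-; apply/subset_leq_card.
rewrite subUset setIS ?subsetUl //=; apply/subsetP => y; rewrite inE.
case/andP=> yK pS; rewrite !inE yK orbT andbT; apply/exists_inP.
by exists (par y) => //; apply: pK.
Qed.

Lemma extendable_le X Y Y' r r' : extendable X Y r -> Y \subset Y' ->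
  (forall x, r' x <= r x) -> extendable X Y' r'.
Proof.
move=> gY sY le S SX S2; apply: leq_trans (leq_trans _ (gY S SX S2)) _.
  by apply: leq_sum.
by rewrite subset_leq_card // setIS.
Qed.

End Extension.
End Expansion.

(** * Stars and forests by repeated extension *)

Section Embedding.
Variables (V : finType) (e : rel V) (M D : nat).
Implicit Types (S X Y Z K : {set V}) (r : V -> nat).

Notation extendable := (extendable e M).
Notation roomy := (roomy e M D).

(** A vertex may occur several times in [vs]; it then receives as many distinct neighbours. *)
Lemma extendable_stars X Y r vs : extendable X Y r -> (forall x, r x <= D) ->
  roomy X Y (size vs) -> {subset vs <= X} -> (forall x, count_mem x vs <= r x) ->
  exists ys, [/\ size ys = size vs, uniq ys, {subset ys <= Y}, all2 e vs ys &
    extendable X (Y :\: [set y in ys]) (fun x => r x - count_mem x vs)].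
Proof.
elim: vs Y r => [|v vs IH] Y r gY rD rY vX cr.
  exists [::]; split => //; apply: (extendable_le gY) => [|x].
    by apply/subsetP => y yY; rewrite !inE.
  by rewrite subn0.
have rv : 0 < r v by have := cr v; rewrite /= eqxx; lia.
have [|y [yY evy gy]] := extendable_step gY rD rY (v := v) _ rv.
  by rewrite vX ?mem_head.
have [||||x|ys [sz uys sub al gys]] := IH (Y :\ y) (fun x => r x - (x == v)).
- exact: gy.
- by move=> x; apply: leq_trans (rD x); rewrite leq_subr.
- apply: (roomy_sub rY (subD1set _ _)); rewrite setDDr setDv set0U.
  by rewrite (leq_trans (leq_add (leqnn _) (subset_leq_card (subsetIr _ _)))) // cards1 addn1.
- by move=> x xvs; apply: vX; rewrite inE xvs orbT.
- by have := cr x; rewrite /= (eq_sym v x); lia.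
have yys : y \notin ys by apply/negP => /sub; rewrite !inE eqxx.
exists (y :: ys); split.
- by rewrite /= sz.
- by rewrite /= yys.
- move=> z; rewrite inE => /orP[/eqP-> //|/sub].
  by rewrite !inE => /andP[].
- by rewrite /= evy.
apply: (extendable_le gys) => [|x].
  by apply/subsetP => z; rewrite !inE negb_or; case: (z \in ys);
    rewrite ?andbF //= => /andP[-> ->].
by rewrite /= (eq_sym v x); lia.
Qed.

Lemma extendable_picks X Y r k : extendable X Y r -> (forall x, r x <= D) ->
  roomy X Y k -> M <= #|X| ->
  exists P : {set V}, [/\ P \subset Y, #|P| = k & extendable X (Y :\: P) r].
Proof.
elim: k Y => [|k IH] Y gY rD rY MX.
  by exists set0; rewrite sub0set cards0 setD0.
have [y yY gy] := extendable_pick gY rD rY MX.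
have [|P [PY cP gP]] := IH (Y :\ y) gy rD _ MX.
  apply: (roomy_sub rY (subD1set _ _)); rewrite setDDr setDv set0U.
  by rewrite (leq_trans (leq_add (leqnn _) (subset_leq_card (subsetIr _ _)))) // cards1 addn1.
exists (y |: P); rewrite subUset sub1set yY (subset_trans PY (subD1set _ _)).
rewrite cardsU1 cP; split => //; last by rewrite setDUr setIDA (setIidPl _) // subD1set.
by rewrite (_ : y \notin P) //; apply/negP => /(subsetP PY); rewrite !inE eqxx.
Qed.

Section Sequential.
Variables (p : nat -> nat) (K : pred nat) (u : V) (X Y : {set V}) (r : V -> nat).
Variable c : nat.

Definition nchild n i := \sum_(1 <= j < n) (K j && (p j == i)).
Definition nkept n := \sum_(1 <= j < n) K j.
Definition placed n := [pred i | (i < n) && ((i == 0) || K i)].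

(* Vertices outside [K] are left for a later stage, and a vertex of [K]
   whose parent is one of them starts a new component of the embedded forest. *)
Lemma embed n : extendable X Y r -> (forall x, r x <= D) -> roomy X Y (nkept n) ->
  Y \subset X -> M <= #|X| -> u \in X -> u \notin Y -> 0 < n ->
  (forall i, 0 < i < n -> p i < i) ->
  (forall y, y \in Y -> c <= r y) -> (forall i, nchild n i <= c) ->
  nchild n 0 <= r u ->
  exists (f : nat -> V) Y' r', [/\
    [/\ f 0 = u, {in placed n &, injective f},
      forall i, i \in placed n -> 0 < i -> f i \in Y :\: Y' &
      forall i, i \in placed n -> 0 < i -> p i \in placed n -> e (f (p i)) (f i)],
    [/\ Y' \subset Y, #|Y'| + nkept n = #|Y|, extendable X Y' r' & forall x, r' x <= r x],
    forall x, (forall i, i \in placed n -> x <> f i) -> r' x = r x &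
    forall i, i \in placed n -> r (f i) <= r' (f i) + nchild n i].
Proof.
move=> gY rD rY YX MX uX uY; case: n rY => // n + _.
elim: n => [|n IH] rY ltp cY chc chu.
  have pl0 i : i \in placed 1 -> i = 0 by rewrite inE ltnS leqn0 => /andP[/eqP].
  exists (fun=> u), Y, r; split.
  - split=> // [i j /pl0-> /pl0-> //|i /pl0-> //|i /pl0-> //].
  - by split=> //; rewrite /nkept big_geq ?addn0.
  - by [].
  - by move=> i _; rewrite leq_addr.
have nchS i : nchild n.+2 i = nchild n.+1 i + (K n.+1 && (p n.+1 == i)).
  by rewrite /nchild big_nat_recr.
have nkS : nkept n.+2 = nkept n.+1 + K n.+1 by rewrite /nkept big_nat_recr.
have [|i /andP[i0 lti]||||f [Y' [r' [[f0 fI fY fe] [Y'Y cY' gY' r'r] r'n r'c]]]] := IH.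
- by apply: (roomy_sub rY (subxx _)); rewrite setDv cards0 addn0 nkS leq_addr.
- by apply: ltp; rewrite i0 ltnW.
- exact: cY.
- by move=> i; apply: leq_trans (chc i); rewrite nchS leq_addr.
- by apply: leq_trans chu; rewrite nchS leq_addr.
have plS i : i \in placed n.+2 = (i \in placed n.+1) || (i == n.+1) && K n.+1.
  rewrite !inE ltnS leq_eqVlt; case: eqP => [->|]; last by rewrite orbF.
  by rewrite ltnn /=.
have pl_lt i : i \in placed n.+1 -> i != n.+1.
  by rewrite inE => /andP[+ _]; apply: contraTneq => ->; rewrite ltnn.
case: (boolP (K n.+1)) => Kn; last first.
  have eqp i : i \in placed n.+2 = (i \in placed n.+1) by rewrite plS (negbTE Kn) andbF orbF.
  exists f, Y', r'; rewrite (negbTE Kn) in nkS nchS; split.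
  - split=> // [i j|i|i]; rewrite ?eqp.
    + exact: fI.
    + exact: fY.
    + exact: fe.
  - by split=> //; rewrite nkS addn0.
  - by move=> x xf; apply: r'n => i; rewrite -eqp; apply: xf.
  - by move=> i; rewrite eqp nchS addn0; apply: r'c.
have r'D x : r' x <= D by apply: leq_trans (r'r x) (rD x).
have rY' : roomy X Y' 1.
  apply: (roomy_sub rY Y'Y); rewrite nkS Kn cardsDS //; lia.
have fX i : i \in placed n.+1 -> f i \in X.
  case: (posnP i) => [-> _|i0 ip]; first by rewrite f0.
  by have := fY i ip i0; rewrite inE => /andP[_ /(subsetP YX)].
have fY' i : i \in placed n.+1 -> f i \notin Y'.
  case: (posnP i) => [-> _|i0 ip].
    by rewrite f0; apply: contra uY; apply: subsetP.
  by have := fY i ip i0; rewrite inE => /andP[].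
have [y [yY' ey [r'' [gy r''r' r''n r''p]]]] : exists y, [/\ y \in Y',
   p n.+1 \in placed n.+1 -> e (f (p n.+1)) y & exists r'', [/\ extendable X (Y' :\ y) r'',
     forall x, r'' x <= r' x, forall x, (x = f (p n.+1) -> p n.+1 \notin placed n.+1) -> r'' x =
       r' x &
     p n.+1 \in placed n.+1 -> r' (f (p n.+1)) <= r'' (f (p n.+1)) + 1]].
  case: (boolP (p n.+1 \in placed n.+1)) => pp; last first.
    have [y yY' gy] := extendable_pick gY' r'D rY' MX.
    by exists y; split=> //; exists r'; split.
  (* The parent has lost at most one unit for each child placed so far, and its initial demand also
     covers the child that is about to be placed. *)
  have r'0 : 0 < r' (f (p n.+1)).
    have := r'c _ pp; have := nchS (p n.+1); rewrite Kn eqxx /=.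
    have : nchild n.+2 (p n.+1) <= r (f (p n.+1)).
      case: (posnP (p n.+1)) => [->|p0]; first by rewrite f0.
      apply: leq_trans (chc _) (cY _ _).
      by have := fY _ pp p0; rewrite inE => /andP[].
    lia.
  have [y [yY' ey gy]] := extendable_step gY' r'D rY' (fX _ pp) r'0.
  exists y; split=> //; exists (fun x => r' x - (x == f (p n.+1))); split=> //.
  - by move=> x; rewrite leq_subr.
  - by move=> x; case: eqP => [xf /(_ xf)|]; rewrite ?subn0 // pp.
  - by rewrite eqxx; clear; lia.
pose f' i := if i == n.+1 then y else f i.
have f'E i : i \in placed n.+1 -> f' i = f i.
  by move=> /pl_lt/negbTE ne; rewrite /f' ne.
have f'n : f' n.+1 = y by rewrite /f' eqxx.
have yf i : i \in placed n.+1 -> f i != y.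
  by move=> /fY'; apply: contraNneq => ->.
exists f', (Y' :\ y), r''; split.
- split.
  + by rewrite f'E // inE.
  + move=> i j; rewrite !plS Kn !andbT => /orP[ip|/eqP->] /orP[jp|/eqP->] //.
    * by rewrite !f'E //; apply: fI.
    * by rewrite f'E // f'n => /eqP; rewrite (negbTE (yf _ ip)).
    * by rewrite (f'E j) // f'n => /esym/eqP; rewrite (negbTE (yf _ jp)).
  + move=> i; rewrite plS Kn andbT => /orP[ip|/eqP->] i0.
      rewrite f'E // in_setD in_setD1 negb_and (fY' _ ip) orbT.
      by have := fY i ip i0; rewrite inE => /andP[].
    by rewrite f'n !inE eqxx /= (subsetP Y'Y).
  + move=> i; rewrite plS Kn andbT => /orP[ip|/eqP->] i0.
      rewrite plS Kn andbT (f'E i) // => /orP[pp|/eqP pn].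
        by rewrite f'E //; apply: fe.
      have lt := ltp i; rewrite pn i0 in lt.
      move: ip; rewrite inE => /andP[lti _].
      by have := lt (ltnW lti); rewrite ltnNge ltnW.
    rewrite plS => /orP[pp|/andP[/eqP pn _]]; last first.
      by have := ltp n.+1; rewrite pn ltnn ltnSn => /(_ isT).
    by rewrite f'E // f'n; apply: ey.
- split=> //.
  + exact: subset_trans (subD1set _ _) Y'Y.
  + by rewrite nkS Kn -cY' (cardsD1 y Y') yY'; clear; lia.
  + by move=> x; apply: leq_trans (r''r' x) (r'r x).
- move=> x xf; rewrite r''n.
    by apply: r'n => i ip; rewrite -f'E //; apply: xf; rewrite plS ip.
  move=> xE; apply/negP => pp; apply: (xf (p n.+1)); rewrite ?f'E //.
  by rewrite plS pp.
- move=> i; rewrite plS Kn andbT nchS Kn /= => /orP[ip|/eqP->]; last first.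
    rewrite f'n r''n ?r'n ?leq_addr //.
    + by move=> j jp yE; have := yf j jp; rewrite yE eqxx.
    + by move=> yE; apply/negP => pp; have := yf _ pp; rewrite yE eqxx.
  rewrite f'E //; have le := r'c i ip.
  case: (eqVneq (f i) (f (p n.+1))) => [E|/eqP ne]; last first.
    by rewrite r''n //; move: le; clear; lia.
  case: (boolP (p n.+1 \in placed n.+1)) => pp; last first.
    by rewrite r''n ?pp //; move: le; clear; lia.
  have ei : i = p n.+1 by apply: fI.
  by have := r''p pp; rewrite ei in le *; rewrite eqxx; move: le; clear; lia.
Qed.

End Sequential.
End Embedding.

(** * Paths of prescribed length *)

Lemma sum_pred_le (P : pred nat) n s :
  (forall j, 0 < j < n -> P j -> j \in s) -> \sum_(1 <= j < n) P j <= size s.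
Proof.
move=> Ps; rewrite -(big_mkcond (fun=> true)) /= -big_mkcond sum1_count.
rewrite -size_filter uniq_leq_size ?filter_uniq ?iota_uniq //.
by move=> j; rewrite mem_filter mem_index_iota => /andP[Pj lt]; apply: Ps.
Qed.

(* The parent function of a path with q edges whose end is the root of an
   infinite binary heap. *)
Definition broom q i := if i <= q then i.-1 else q + (i - q).-1./2.

Lemma broom_lt q i : 0 < i -> broom q i < i.
Proof. by rewrite /broom => i0; case: ifP => le; lia. Qed.

Lemma broom_nchild q n i : nchild (broom q) predT n i <= 2.
Proof.
rewrite /nchild; case: (ltnP i q) => iq.
  apply: (@sum_pred_le _ n [:: i.+1; 0]) => j /andP[j0 _] /=.
  by rewrite /broom !inE; case: (leqP j q) => ? /eqP; lia.
apply: (@sum_pred_le _ n [:: q + (i - q).*2.+1; q + (i - q).*2.+2]) => j.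
by rewrite /broom !inE => /andP[j0 _] /=; case: (leqP j q) => ? /eqP; lia.
Qed.

Lemma broom_nchild0 q n : 0 < q -> nchild (broom q) predT n 0 <= 1.
Proof.
move=> q0; apply: (@sum_pred_le _ n [:: 1]) => j /andP[j0 _] /=.
by rewrite /broom inE; case: (leqP j q) => ? /eqP; lia.
Qed.

(** The vertex [q + j] is node [j.+1] of a binary heap numbered from 1, where each step up halves
    the number. *)
Lemma broom_iter q j k : 2 ^ k <= j.+1 ->
  iter k (broom q) (q + j) = q + (j.+1 %/ 2 ^ k).-1.
Proof.
elim: k => [|k IH] le; first by rewrite expn0 divn1.
rewrite iterS IH; last by rewrite (leq_trans _ le) // leq_exp2l.
have : 2 <= j.+1 %/ 2 ^ k.
  by rewrite leq_divRL ?expn_gt0 // -expnS.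
rewrite expnSr divnMA; move: (_ %/ 2 ^ k) => J J2; rewrite /broom.
by case: ifP; lia.
Qed.

Lemma broom_iter0 q k : k <= q -> iter k (broom q) q = q - k.
Proof.
elim: k => [|k IH] le; first by rewrite subn0.
by rewrite iterS IH ?(ltnW le) // /broom; case: ifP; lia.
Qed.

Lemma parent_chain (p : nat -> nat) m i : (forall j, 0 < j -> p j < j) ->
  iter m p i = 0 -> (forall m', m' < m -> 0 < iter m' p i) ->
  exists s, [/\ size s = m, last 0 s = i,
    path (fun a b => (p b == a) && (a < b)) 0 s & forall j, j \in s -> 0 < j <= i].
Proof.
move=> lt; elim: m i => [|m IH] i; first by move=> /= -> _; exists [::].
rewrite iterSr => pm pos; have i0 := pos 0 isT; rewrite /= in i0.
have [m' lt'|s [sz ls ps sl]] := IH (p i) pm.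
  by have := pos m'.+1; rewrite iterSr => ->.
exists (rcons s i); split.
- by rewrite size_rcons sz.
- by rewrite last_rcons.
- by rewrite rcons_path ps ls eqxx lt.
- move=> j; rewrite mem_rcons inE => /orP[/eqP->|/sl]; first by rewrite i0 leqnn.
  by case/andP=> -> /leq_trans->//; rewrite ltnW ?lt.
Qed.

Section Connecting.
Variables (V : finType) (e : rel V) (M D : nat).
Hypothesis e_sym : symmetric e.
Implicit Types (A B S X Y Z K : {set V}) (r : V -> nat).

Notation extendable := (extendable e M).
Notation roomy := (roomy e M D).

(** The [2 ^ h] leaves of the binary tree at the end of the path are all at distance [q + h] from
    [u], and there are enough of them to use joinedness. [par] records the tree so that any part of
    it can be rolled back later. *)
Lemma grow X Y r u q h : extendable X Y r -> (forall x, r x <= D) ->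
  roomy X Y (q + 2 ^ h.+1) -> Y \subset X -> M <= #|X| -> u \in X ->
  u \notin Y -> 0 < q -> 0 < r u -> (forall y, y \in Y -> 2 <= r y) ->
  exists K (par : V -> V) r' (L : {set V}),
  [/\ [/\ K \subset Y, #|K| <= q + 2 ^ h.+1, extendable X (Y :\: K) r',
          forall x, r' x <= r x & forall x, x \notin K -> x != u -> r' x = r x],
      forall y, y \in K -> e (par y) y,
      forall x, r x <= r' x + #|[set y in K | par y == x]|,
      #|L| = 2 ^ h &
      forall w, w \in L -> exists s, [/\ size s = q + h, uniq (u :: s),
        last u s = w, {subset s <= K} & path (fun x y => par y == x) u s]].
Proof.
move=> gY rD rY YX MX uX uY q0 ru r2.
(* The heap has [(2 ^ h.+1).-1] nodes, the first of which is the end [q] of the path. *)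
pose n := q + (2 ^ h.+1).-1.
have p2 : 2 ^ h < 2 ^ h.+1 by rewrite ltn_exp2l.
have n0 : 0 < n by rewrite /n; lia.
have nk : nkept predT n = n.-1 by rewrite /nkept big_const_nat iter_addn_0 mul1n subn1.
have [|||||f [Y' [r' [[f0 fI fY fe] [Y'Y cY' gY' r'r] r'n r'c]]]] :=
  @embed _ e M D (broom q) predT u X Y r 2 n gY rD _ YX MX uX uY n0.
- apply: (roomy_sub rY (subxx _)); rewrite setDv cards0 addn0 nk /n; lia.
- by move=> i /andP[i0 _]; apply: broom_lt.
- exact: r2.
- by move=> i; apply: broom_nchild.
- by apply: leq_trans ru; apply: broom_nchild0.
have pl i : i < n -> i \in placed predT n by rewrite inE orbT andbT.
pose K := [set y | y \in map f (iota 1 n.-1)].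
have mapU : uniq (map f (iota 0 n)).
  rewrite map_inj_in_uniq ?iota_uniq // => i j.
  by rewrite !mem_iota !add0n => /pl ip /pl jp; apply: fI.
have io : iota 0 n = 0 :: iota 1 n.-1 by rewrite -[in LHS](prednK n0).
have cK : #|K| = n.-1.
  move: mapU; rewrite io /= => /andP[_ /card_uniqP].
  by rewrite size_map size_iota cardsE.
have KY : K \subset Y :\: Y'.
  apply/subsetP => y; rewrite inE => /mapP[i]; rewrite mem_iota => /andP[i0 lt] ->.
  by apply: fY => //; apply: pl; lia.
have KE : K = Y :\: Y'.
  apply/eqP; rewrite eqEcard KY cardsDS // -cY' nk cK; lia.
have Y'E : Y' = Y :\: K by rewrite KE setDDr setDv set0U; apply/esym/setIidPr.
pose idx y := index y (map f (iota 0 n)).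
have nthE i : i < n -> nth u (map f (iota 0 n)) i = f i.
  by move=> lt; rewrite (nth_map 0) ?size_iota ?nth_iota.
have idxf i : i < n -> idx (f i) = i.
  by move=> lt; rewrite /idx -{1}(nthE i lt) index_uniq ?size_map ?size_iota.
pose par y := f (broom q (idx y)).
have parf i : i < n -> par (f i) = f (broom q i) by move=> lt; rewrite /par idxf.
pose L := [set y | y \in map f (iota (q + (2 ^ h).-1) (2 ^ h))].
exists K, par, r', L; split.
- split=> //; rewrite -?Y'E // ?KE ?subsetDl //; last move=> x xK xu.
    by rewrite -KE cK /n; clear; lia.
  apply: r'n => i; rewrite inE => /andP[lt _] xE.
  have i0 : 0 < i by case: (posnP i) xu => // i0; rewrite xE i0 f0 eqxx.
  by case/negP: xK; rewrite -KE xE inE map_f // mem_iota; clear -i0 lt; lia.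
- move=> y; rewrite inE => /mapP[i]; rewrite mem_iota => /andP[i0 lt] ->.
  have li : i < n by lia.
  rewrite parf //; apply: fe => //; first exact: pl.
  by apply: pl; apply: ltn_trans li; apply: broom_lt.
- move=> x; case: (boolP (x \in map f (iota 0 n))) => [/mapP[i]|xn]; last first.
    rewrite r'n ?leq_addr // => i; rewrite inE => /andP[lt _] xE.
    by case/negP: xn; rewrite xE map_f // mem_iota.
  rewrite mem_iota add0n => /andP[_ lt] ->.
  apply: leq_trans (r'c i (pl _ lt)) _; rewrite leq_add2l.
  rewrite /nchild /= -big_mkcond /= sum1_count -size_filter.
  rewrite -(size_map f) -(card_uniqP _); last first.
    rewrite map_inj_in_uniq ?filter_uniq ?iota_uniq // => a b.
    rewrite !mem_filter !mem_index_iota => /andP[_ /andP[_ la]] /andP[_ /andP[_ lb]].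
    by apply: fI; apply: pl.
  apply/subset_leq_card/subsetP => y /mapP[j].
  rewrite mem_filter mem_index_iota => /andP[/eqP pj /andP[j0 lj]] ->.
  rewrite !inE parf // pj eqxx andbT map_f // mem_iota; lia.
- have pw : 0 < 2 ^ h by rewrite expn_gt0.
  rewrite cardsE; have /card_uniqP-> : uniq (map f (iota (q + (2 ^ h).-1) (2 ^ h))).
    rewrite map_inj_in_uniq ?iota_uniq // => a b.
    rewrite !mem_iota => /andP[_ la] /andP[_ lb].
    by apply: fI; apply: pl; rewrite /n; move: la lb; rewrite expnS; clear -pw; lia.
  by rewrite size_map size_iota.
- move=> w; rewrite inE => /mapP[i0]; rewrite mem_iota => /andP[l1 l2] ->.
  have pw : 0 < 2 ^ h by rewrite expn_gt0.
  have [j iE] : exists j, i0 = q + j by exists (i0 - q); clear -l1; lia.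
  have jl : 2 ^ h <= j.+1 by clear -l1 iE pw; lia.
  have ju : j.+1 < 2 ^ h.+1 by rewrite expnS; clear -l2 iE pw; lia.
  have il : i0 < n by clear -ju iE; rewrite /n; lia.
  have ith : iter h (broom q) i0 = q.
    rewrite iE broom_iter // (_ : _ %/ _ = 1) ?addn0 //.
    by apply/eqP; rewrite eqn_leq -ltnS ltn_divLR ?leq_divRL ?expn_gt0 // mul1n -expnS ju.
  have [||m' lm|s [sz ls ps sl]] := @parent_chain (broom q) (q + h) i0.
  + exact: broom_lt.
  + by rewrite iterD ith broom_iter0 ?subnn.
  + case: (leqP m' h) => lh.
      rewrite iE broom_iter; first by rewrite addn_gt0 q0.
      by apply: leq_trans jl; rewrite leq_exp2l.
    rewrite -(subnK (ltnW lh)) iterD ith broom_iter0; clear -lh lm; lia.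
  have sn x : x \in s -> 0 < x < n.
    by move=> /sl /andP[-> le] /=; apply: leq_ltn_trans le il.
  exists (map f s); split.
  + by rewrite size_map.
  + rewrite -f0 -[_ :: _]/(map f (0 :: s)) map_inj_in_uniq.
      have : path ltn 0 s by apply: sub_path ps => a b /andP[].
      by move/(sorted_uniq (leT := ltn) ltn_trans ltnn (s := 0 :: s)).
    move=> a b; rewrite !inE => /orP[/eqP->|/sn/andP[_ la]] /orP[/eqP->|/sn/andP[_ lb]] //;
      by apply: fI; apply: pl.
  + by rewrite -f0 last_map ls.
  + move=> x /mapP[a /sn/andP[a0 la] ->]; rewrite inE map_f // mem_iota.
    clear -a0 la; lia.
  + rewrite -f0 path_map; apply: (sub_in_path (P := [pred i | i < n])) ps.
      move=> a b _; rewrite inE => lb /andP[/eqP<- _].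
      by rewrite /= parf.
    rewrite /= n0 /=; apply/allP => x /sn/andP[_ lt]; exact: lt.
Qed.


Lemma chain_mem (par : V -> V) u s y :
  path (fun x y => par y == x) u s -> y \in s -> par y \in u :: s.
Proof.
elim: s u => // z s IH u /= /andP[/eqP pz ps]; rewrite inE => /orP[/eqP->|/(IH _ ps)].
  by rewrite pz mem_head.
by move=> h; rewrite inE h orbT.
Qed.

Lemma chain_card (par : V -> V) u s x : uniq (u :: s) ->
  path (fun x y => par y == x) u s -> #|[set y in s | par y == x]| <= (x \in u :: s).
Proof.
elim: s u => [|z s IH] u.
  by move=> _ _; rewrite (_ : [set _ in _ | _] = set0) ?cards0 //; apply/setP => y; rewrite !inE.
rewrite cons_uniq => /andP[uz us] /= /andP[/eqP pz ps].
rewrite inE; case: (eqVneq x u) => [->|xu] /=; last first.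
  apply: leq_trans (IH _ us ps); apply/subset_leq_card/subsetP => y.
  by rewrite !inE; case: eqP => [->|] //=; rewrite pz => /eqP ux; rewrite ux eqxx in xu.
rewrite -(cards1 z); apply/subset_leq_card/subsetP => y.
rewrite !inE => /andP[/orP[//|ys] /eqP py]; case/negP: uz.
by rewrite -py; apply: chain_mem ps ys.
Qed.

(** The condition [x != y] makes the two sets disjoint, so that they can be two parts of a blue
    multipartite graph. *)
Definition blue (A B : {set V}) :=
  [forall x in A, forall y in B, (x != y) && ~~ e x y].

Lemma blueP A B :
  reflect (forall x y, x \in A -> y \in B -> x != y /\ ~~ e x y) (blue A B).
Proof.
apply: (iffP forall_inP) => [bl x y xA yB|bl x xA].
  by have /forall_inP/(_ _ yB)/andP := bl x xA.
by apply/forall_inP => y yB; apply/andP; apply: bl.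
Qed.

Lemma blue_sym A B : blue A B -> blue B A.
Proof. by move/blueP => bl; apply/blueP => x y xB yA; rewrite eq_sym e_sym; apply: bl. Qed.

Lemma blueS A A' B B' : blue A B -> A' \subset A -> B' \subset B -> blue A' B'.
Proof.
move/blueP => bl sA sB; apply/blueP => x y xA yB.
by apply: bl; [apply: subsetP xA | apply: subsetP yB].
Qed.

Definition joined a b X := forall A B, A \subset X -> B \subset X ->
  a <= #|A| -> b <= #|B| -> ~~ blue A B.

Lemma joined_edge a b X A B : joined a b X -> A \subset X -> B \subset X ->
  [disjoint A & B] -> a <= #|A| -> b <= #|B| ->
  exists x y, [/\ x \in A, y \in B & e x y].
Proof.
move=> jX AX BX dAB cA cB; have := jX A B AX BX cA cB.
rewrite negb_forall_in => /exists_inP[x xA]; rewrite negb_forall_in.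
case/exists_inP => y yB; rewrite negb_and !negbK => /orP[/eqP xy|exy].
  by move: dAB => /pred0P/(_ x); rewrite /= xA xy yB.
by exists x, y.
Qed.

(** Trees grown from [u] and from [v] have at least [M] leaves each, so some red edge joins a leaf
    of one to a leaf of the other. All vertices off the resulting path are rolled back and the cost
    is the path alone; an inner vertex loses at most one unit, for its child on the path. *)
Lemma link_path X Y r u v q1 q2 h : extendable X Y r -> (forall x, r x <= D) ->
  roomy X Y (q1 + q2 + 2 ^ h.+2) -> Y \subset X -> M <= #|X| ->
  joined M M X -> M <= 2 ^ h -> u \in X -> v \in X -> u \notin Y -> v \notin Y ->
  u != v -> 0 < q1 -> 0 < q2 -> 0 < r u -> 0 < r v ->
  (forall y, y \in Y -> 2 <= r y) ->
  exists s r', [/\ [/\ size s = q1 + q2 + h.*2, uniq s, {subset s <= Y} &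
      path e u (rcons s v)],
    extendable X (Y :\: [set y in s]) r', forall x, r' x <= r x &
    forall x, r x <= r' x + (x == u) + (x == v) + (x \in s)].
Proof.
move=> gY rD rY YX MX jX Mh uX vX uY vY uv q10 q20 ru rv r2.
have p2 : 2 ^ h.+2 = 2 ^ h.+1 + 2 ^ h.+1 by rewrite expnS mul2n addnn.
have [||K1 [par1 [r1 [L1 [[K1Y cK1 g1 r1r r1n] pK1 r1c cL1 chL1]]]]] :=
  @grow X Y r u q1 h gY rD _ YX MX uX uY q10 ru.
- by apply: (roomy_sub rY (subxx _)); rewrite setDv cards0 p2; clear; lia.
- exact: r2.
have dK1 v' : v' \notin Y -> v' \notin K1 by apply: contra; apply: subsetP.
have r1v : 0 < r1 v by rewrite r1n ?dK1 // eq_sym.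
have [|||||K2 [par2 [r2' [L2 [[K2Y cK2 g2 r2r r2n] pK2 r2c cL2 chL2]]]]] :=
  @grow X (Y :\: K1) r1 v q2 h g1 _ _ _ MX vX _ q20 r1v.
- by move=> x; apply: leq_trans (r1r x) (rD x).
- apply: (roomy_sub rY (subsetDl _ _)); rewrite setDDr setDv set0U (setIidPr K1Y) p2.
  by move: cK1; clear; lia.
- exact: subset_trans (subsetDl _ _) YX.
- by rewrite inE (negbTE vY) andbF.
- move=> y; rewrite inE => /andP[yK yY]; rewrite r1n ?r2 //.
  by apply: contraNneq uY => <-.
have LK (w u' : V) s n (K' : {set V}) : 0 < n -> size s = n + h -> last u' s = w -> {subset s <=
  K'} -> w \in K'.
  case: s => [|x s] n0 /= sz <- sK; first by move: sz n0; clear; lia.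
  by apply: sK; apply: mem_last.
have L1K : L1 \subset K1.
  by apply/subsetP => w /chL1[s [sz _ ls sK _]]; apply: LK sz ls sK.
have L2K : L2 \subset K2.
  by apply/subsetP => w /chL2[s [sz _ ls sK _]]; apply: LK sz ls sK.
have K2Y' : K2 \subset Y by apply: subset_trans K2Y (subsetDl _ _).
have dK : [disjoint K1 & K2].
  rewrite disjoint_sym disjoint_subset; apply/subsetP => x /(subsetP K2Y).
  by rewrite !inE => /andP[].
have [|||||w1 [w2 [w1L w2L ew]]] := @joined_edge M M X L1 L2 jX.
- by rewrite (subset_trans L1K) // (subset_trans K1Y).
- by rewrite (subset_trans L2K) // (subset_trans K2Y').
- by apply: disjointWl L1K _; apply: disjointWr L2K _.
- by rewrite cL1.
- by rewrite cL2.
have [s1 [sz1 us1 ls1 sK1 ps1]] := chL1 _ w1L.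
have [s2 [sz2 us2 ls2 sK2 ps2]] := chL2 _ w2L.
pose par y := if y \in K1 then par1 y else par2 y.
pose K := (K1 :|: K2) :\: [set y in s1 ++ s2].
have nK1 x : x \in K2 -> x \in K1 = false.
  by move=> xK2; apply: (disjointFl dK).
have dKY : [disjoint K & Y :\: K1 :\: K2].
  rewrite disjoint_subset; apply/subsetP => x; rewrite !inE.
  by case: (x \in K1); case: (x \in K2); rewrite ?andbF.
have parE y : y \in K -> e (par y) y.
  rewrite !inE => /andP[_]; rewrite /par; case: (boolP (y \in K1)) => [yK1 _|_ /= yK2].
    exact: pK1.
  exact: pK2.
have := extendable_rollback g2 dKY parE.
set r3 := (fun x => _) => g3.
(* The losses in [r1] and [r2'] are only bounded from above, so after the rollback [r3] may exceed
   [r]; taking the minimum restores [r' <= r]. *)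
exists (s1 ++ rev s2), (fun x => minn (r x) (r3 x)); split.
- split.
  + by rewrite size_cat size_rev sz1 sz2; clear; lia.
  + move: us1 us2; rewrite !cons_uniq => /andP[_ us1] /andP[_ us2].
    rewrite cat_uniq rev_uniq us1 us2 andbT /=.
    apply/hasPn => x; rewrite mem_rev => /sK2 xK2; apply/negP => /sK1.
    by rewrite (nK1 _ xK2).
  + move=> x; rewrite mem_cat mem_rev => /orP[/sK1|/sK2]; exact: subsetP.
  + rewrite rcons_cat cat_path ls1; apply/andP; split.
      elim: (s1) (u) ps1 sK1 => // x s IH u' /= /andP[/eqP<- ps] sK.
      rewrite pK1 ?IH ?sK ?mem_head // => z zs; apply: sK.
      by rewrite inE zs orbT.
    rewrite -rev_cons; case: (lastP s2) sz2 ls2 us2 sK2 ps2 => [|s x].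
      by move=> /= sz; move: sz q20; clear; lia.
    rewrite last_rcons => _ -> _ sK2 ps2; rewrite -rcons_cons rev_rcons /= ew /=.
    have := rev_path e v (rcons s w2); rewrite last_rcons belast_rcons => ->.
    elim: (rcons s w2) (v) ps2 sK2 => // y s' IH v' /= /andP[/eqP<- ps] sK.
    rewrite e_sym pK2 ?IH ?sK ?mem_head // => z zs; apply: sK.
    by rewrite inE zs orbT.
- apply: (extendable_le g3) => [|x]; last exact: geq_minr.
  apply/subsetP => x; rewrite !(inE, mem_cat, mem_rev).
  have := (sK1 x, sK2 x, subsetP K1Y x, subsetP K2Y' x).
  case: (x \in s1); case: (x \in s2); case: (x \in K1); case: (x \in K2);
    by case: (x \in Y) => //= -[[[h1 h2] h3] h4] //; move: (h1 isT) (h2 isT) (h3 isT) (h4 isT).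
- by move=> x; apply: geq_minl.
- move=> x; rewrite mem_cat mem_rev.
  have l1 := r1c x; have l2 := r2c x.
  have h1 := chain_card x us1 ps1; have h2 := chain_card x us2 ps2.
  have ds : ~~ ((x \in s1) && (x \in s2)).
    by apply/negP => /andP[/sK1 xs /sK2/nK1]; rewrite xs.
  have c1 : #|[set y in K1 | par1 y == x]| + #|[set y in K2 | par2 y == x]| <=
    #|[set y in K | par y == x]| + #|[set y in s1 | par1 y == x]| + #|[set y in s2 | par2 y ==
      x]|.
    have -> : #|[set y in K1 | par1 y == x]| + #|[set y in K2 | par2 y == x]| =
      #|[set y in K1 | par1 y == x] :|: [set y in K2 | par2 y == x]|.
      apply/esym/eqP; rewrite leq_card_setU disjoint_subset.
      apply/subsetP => y; rewrite !inE => /andP[yK _].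
      by rewrite (disjointFr dK yK).
    apply: leq_trans (leq_trans (leq_card_setU (_ :|: _) _) (leq_add (leq_card_setU _ _) (leqnn
      _))).
    apply/subset_leq_card/subsetP => y; rewrite !inE mem_cat /par.
    case: (boolP (y \in K1)) => yK1 /=; last first.
      have -> : (y \in s1) = false by apply: contraNF yK1; apply: sK1.
      by case: (y \in s2); case: (y \in K2); case: (_ == x).
    case/orP => [|/andP[/nK1]]; last by rewrite yK1.
    move=> ->; have -> : (y \in s2) = false.
      by apply: contraTF yK1 => /sK2/nK1->.
    by case: (y \in s1) => //=; rewrite ?orbT.
  rewrite !inE in h1 h2; rewrite /r3.
  set a1 := #|_| in l1 c1; set a2 := #|_| in l2 c1.
  set a3 := #|[set y in K | _]| in c1 *.
  set a4 := #|_| in h1 c1; set a5 := #|_| in h2 c1.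
  move: l1 l2 c1 h1 h2 ds; move: (_ == u) (_ == v) (x \in s1) (x \in s2) => b1 b2 b3 b4.
  clear; rewrite minnE.
  by case: b1; case: b2; case: b3; case: b4; rewrite /=; lia.
Qed.

End Connecting.

Lemma count_inj (J V : eqType) (f : J -> V) js x : uniq js ->
  {in js &, injective f} -> count (fun j => f j == x) js = (x \in map f js).
Proof.
move=> ujs fI; rewrite -count_uniq_mem ?map_inj_in_uniq //.
by rewrite count_map; apply: eq_count.
Qed.

Section Linking.
Variables (V : finType) (e : rel V) (M D : nat).
Hypothesis e_sym : symmetric e.
Implicit Types (A B S X Y Z K I U : {set V}) (r : V -> nat).

Notation extendable := (extendable e M).
Notation roomy := (roomy e M D).

(** The trees of one linking are rolled back before the next one, so that the [q1 + q2 + 2 ^ h.+2]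
    extra vertices serve all pairs in turn. A vertex may be an end of several paths; [cnt] tells of
    how many. *)
Lemma link_many (J : eqType) (js : seq J) (u v : J -> V) X Y r q1 q2 h :
  let l := q1 + q2 + h.*2 in
  let cnt x := count (fun j => u j == x) js + count (fun j => v j == x) js in
  extendable X Y r -> (forall x, r x <= D) ->
  roomy X Y (size js * l + (q1 + q2 + 2 ^ h.+2)) -> Y \subset X -> M <= #|X| ->
  joined e M M X -> M <= 2 ^ h -> uniq js ->
  (forall j, j \in js -> [/\ u j \in X :\: Y, v j \in X :\: Y & u j != v j]) ->
  0 < q1 -> 0 < q2 -> (forall x, x \notin Y -> cnt x <= r x) ->
  (forall y, y \in Y -> 2 <= r y) ->
  exists (s : J -> seq V) U r', [/\
   [/\ forall j, j \in js -> size (s j) = l,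
       forall j, j \in js -> path e (u j) (rcons (s j) (v j)),
       forall j, j \in js -> uniq (s j) &
       forall j j' x, j \in js -> j' \in js -> x \in s j -> x \in s j' -> j = j'],
   forall x, (x \in U) = has (fun j => x \in s j) js,
   [/\ U \subset Y, #|U| = size js * l, extendable X (Y :\: U) r' & forall x, r' x <= r x] &
   forall x, r x <= r' x + cnt x + (x \in U)].
Proof.
move=> l /=; elim: js Y r => [|j js IH] Y r gY rD rY YX MX jX Mh ujs uv q10 q20 cnt r2.
  exists (fun=> [::]), set0, r; split=> //.
  - by move=> x; rewrite inE.
  - by rewrite sub0set cards0 setD0.
  - by move=> x; rewrite inE !addn0.
have [uj vj ujv] := uv j (mem_head _ _).
case/setDP: uj => uX uY; case/setDP: vj => vX vY.
move: ujs; rewrite cons_uniq => /andP[jjs ujs].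
have [||||s0 [r1 [[sz0 us0 s0Y p0] g1 r1r r1c]]] :=
  @link_path _ e M D e_sym X Y r (u j) (v j) q1 q2 h gY rD _ YX MX jX Mh uX vX uY vY ujv q10 q20.
- by apply: (roomy_sub rY (subxx _)); rewrite setDv cards0 addn0 leq_addl.
- by have := cnt _ uY; rewrite /= eqxx; apply: leq_trans; clear; lia.
- by have := cnt _ vY; rewrite /= eqxx; apply: leq_trans; clear; lia.
- exact: r2.
pose U0 := [set y in s0].
have cU0 : #|U0| = l by rewrite cardsE (card_uniqP us0).
have U0Y : U0 \subset Y by apply/subsetP => x; rewrite inE; apply: s0Y.
have uvY j' : j' \in js -> [/\ u j' \in X :\: Y, v j' \in X :\: Y & u j' != v j'].
  by move=> jj; apply: uv; rewrite inE jj orbT.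
have [|||j' jj|x||s [U [r' [[sz ps us dis] UE [UY cU gU r'r] r'c]]]] :=
  IH (Y :\: U0) r1 g1 _ _ _ MX jX Mh ujs _ q10 q20.
- by move=> x; apply: leq_trans (r1r x) (rD x).
- apply: (roomy_sub rY (subsetDl _ _)); rewrite setDDr setDv set0U (setIidPr U0Y) cU0.
  by rewrite /= mulSn; clear; lia.
- exact: subset_trans (subsetDl _ _) YX.
- have [/setDP[uX' uY'] /setDP[vX' vY'] ne] := uvY _ jj.
  by rewrite !in_setD uX' vX' (negbTE uY') (negbTE vY') !andbF.
- move=> xY; case: (boolP (x \in Y)) => [xY'|xnY]; last first.
    have := cnt _ xnY; have := r1c x.
    have -> : x \in s0 = false by apply: contraNF xnY; apply: s0Y.
    rewrite /= (eq_sym (u j)) (eq_sym (v j)); clear; lia.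
  have z (f : J -> V) : (forall j, j \in js -> f j \notin Y) -> count (fun j => f j == x) js = 0.
    move=> fn; apply/eqP; rewrite -leqn0 leqNgt -has_count; apply/hasPn => j' /fn.
    by apply: contra => /eqP->.
  by rewrite !z // => j' /uvY[/setDP[]// _ ? /setDP[]].
- move=> y /setDP[yY yU]; have := r2 y yY; have := r1c y.
  rewrite inE in yU; rewrite (negbTE yU).
  have -> : y == u j = false by apply: contraNF uY => /eqP<-.
  have -> : y == v j = false by apply: contraNF vY => /eqP<-.
  by clear; lia.
have UP x : reflect (exists2 j, j \in js & x \in s j) (x \in U).
  by rewrite UE; apply: hasP.
have jne j' : j' \in js -> j' == j = false.
  by move=> jj; apply: contraNF jjs => /eqP<-.
have sY j' x : j' \in js -> x \in s j' -> x \notin s0.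
  move=> jj xs; have : x \in U by apply/UP; exists j'.
  by move/(subsetP UY); rewrite !inE => /andP[].
exists (fun j' => if j' == j then s0 else s j'), (U0 :|: U), r'; split.
- split.
  + by move=> j'; rewrite inE; case: eqP => //= _; apply: sz.
  + by move=> j'; rewrite inE; case: eqP => [->|] //= _; apply: ps.
  + by move=> j'; rewrite inE; case: eqP => //= _; apply: us.
  + move=> j1 j2 x; rewrite !inE; case: eqP => [->|_] /=; case: eqP => [->|_] //=.
    * by move=> _ j2j x0 /(sY _ _ j2j); rewrite x0.
    * by move=> j1j _ /(sY _ _ j1j)/negbTE->.
    * exact: dis.
- move=> x; apply/setUP/hasP => [[xU|/UP[j' jj xs]]|[j']].
  + by exists j; rewrite ?mem_head // eqxx; rewrite inE in xU.
  + by exists j'; rewrite ?inE ?jj ?orbT // jne.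
  + rewrite inE; case: eqP => [->|_] /= jj xs; first by left; rewrite inE.
    by right; apply/UP; exists j'.
- have dU : [disjoint U0 & U].
    rewrite disjoint_sym disjoint_subset; apply/subsetP => x /(subsetP UY).
    by rewrite !inE => /andP[].
  split.
  + by rewrite subUset U0Y (subset_trans UY) // subsetDl.
  + by rewrite /= mulSn -cU -cU0; apply/eqP; rewrite leq_card_setU.
  + by rewrite -setDDl.
  + by move=> x; apply: leq_trans (r'r x) (r1r x).
- move=> x; have := r1c x; have := r'c x; rewrite !inE.
  have : ~~ ((x \in s0) && (x \in U)).
    apply/negP => /andP[xs /UP[j' jj xs']]; by have := sY _ _ jj xs'; rewrite xs.
  rewrite /= (eq_sym (u j)) (eq_sym (v j)).
  by case: (x \in s0); case: (x \in U) => //= _; clear; lia.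
Qed.

(** * Ladders and routings *)

Section Zigzag.
Variables (p : bool -> nat -> V) (R : bool -> nat -> seq V) (l : nat).
Variables (x0 : V) (b : bool).

(** [p false] and [p true] are the sides of a ladder with rungs [R]. The route crosses every rung
    and then takes one step along the side it has reached, so it visits all vertices of the first
    [n] levels and changes sides [n] times. *)
Lemma zigzag n : (forall c i, i < n -> size (R c i) = l) ->
  (forall i, i < n -> R true i =i R false i) ->
  e x0 (p b 0) ->
  (forall c i, i < n -> path e (p c i) (rcons (R c i) (p (~~ c) i))) ->
  (forall c i, i < n -> e (p c i) (p c i.+1)) ->
  exists s, [/\ size s = n * (l + 2) + 1, path e x0 s,
    last x0 s = p (b (+) odd n) n &
    forall i, i < n -> (forall c, p c i \in s) /\ {subset R false i <= s}].
Proof.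
move=> + + ex; elim: n => [|n IH] sR eR pR pp.
  by exists [:: p b 0]; rewrite /= ex addbF.
have [||||s [sz ps ls cs]] := IH.
- by move=> c i lt; apply: sR; apply: ltnW.
- by move=> i lt; apply: eR; apply: ltnW.
- by move=> c i lt; apply: pR; apply: ltnW.
- by move=> c i lt; apply: pp; apply: ltnW.
set c := b (+) odd n in ls.
exists (s ++ rcons (R c n) (p (~~ c) n) ++ [:: p (~~ c) n.+1]); split.
- by rewrite !size_cat size_rcons sz sR // /=; clear; lia.
- by rewrite !cat_path ps ls pR //= last_rcons pp.
- by rewrite !last_cat last_rcons /= /c -addbN.
- move=> i; rewrite ltnS leq_eqVlt => /orP[/eqP->|/cs[ps' Rs]]; last first.
    by split=> [c'|x /Rs]; rewrite mem_cat ?ps' // => ->.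
  have pc : p c n \in s.
    rewrite -ls; case: (s) sz => [|y s'] sz; last by rewrite last_cons mem_last.
    by move: sz; clear; rewrite /=; lia.

  split=> [c'|x xR]; rewrite !(mem_cat, mem_rcons, inE).
    case: (eqVneq c' c) => [->|ne]; first by rewrite pc.
    have -> : c' = ~~ c by case: c' ne; case: (c).
    by rewrite eqxx ?orbT.
  suff -> : x \in R c n by rewrite !orbT.
  by case: (c); rewrite ?eR.
Qed.

End Zigzag.

(* Since the paths cover [I], they are disjoint as soon as |I| is d|W|. *)
Definition routable (W : finType) (a o : W -> V) I d (f : W -> W) :=
  exists s : W -> seq V, (forall w, [/\ size (s w) = d, path e (a w) (s w) &
    last (a w) (s w) = o (f w)]) /\ (forall x, x \in I -> exists w, x \in s w).

(** An injection of a finite type is onto, so every route of the second part continues a route of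
    the first and [I2] stays covered. *)
Lemma routable_comp (W : finType) (a b o : W -> V) I1 I2 d1 d2 f1 f2 :
  injective f1 -> routable a b I1 d1 f1 -> routable b o I2 d2 f2 ->
  routable a o (I1 :|: I2) (d1 + d2) (f2 \o f1).
Proof.
move=> f1I [s1 [h1 c1]] [s2 [h2 c2]].
exists (fun w => s1 w ++ s2 (f1 w)); split=> [w|x].
  have [sz1 p1 l1] := h1 w; have [sz2 p2 l2] := h2 (f1 w).
  by rewrite size_cat sz1 sz2 cat_path p1 last_cat l1 p2 l2.
rewrite inE => /orP[/c1[w xw]|/c2[w xw]].
  by exists w; rewrite mem_cat xw.
have /codomP[w' E] := injF_onto f1I w.
by exists w'; rewrite mem_cat -E xw orbT.
Qed.

Lemma eq_routable (W : finType) (a o : W -> V) I d f g : f =1 g ->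
  routable a o I d f -> routable a o I d g.
Proof.
move=> fg [s [h c]]; exists s; split=> // w.
by have [? ? l] := h w; rewrite -fg.
Qed.

End Linking.

(** * Switches and Benes networks *)

Section Network.
Variables (V : finType) (e : rel V) (M D : nat).
Hypothesis e_sym : symmetric e.
Implicit Types (A B S X Y Z K I U : {set V}) (r : V -> nat).

Notation extendable := (extendable e M).
Notation roomy := (roomy e M D).

Lemma path_rev_sym u s v : path e u (rcons s v) -> path e v (rcons (rev s) u).
Proof.
move=> ps; rewrite -rev_cons -(belast_rcons u s v).
rewrite -[X in path e X](last_rcons u s v) rev_path.
by rewrite (eq_path (e' := e)) // => x y; rewrite e_sym.
Qed.

Variables (q1 q2 h m : nat).
Hypotheses (q1_gt0 : 0 < q1) (q2_gt0 : 0 < q2) (m_even : ~~ odd m).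
Hypotheses (lm : q1 + q2 + h.*2 = m.*2.+1) (M_le : M <= 2 ^ h).

Let l := m.*2.+1.
(** A route crosses [m] levels, each with two side vertices and a rung of [m.*2.+1] inner vertices,
    and ends at a middle vertex. *)
Definition switch_len := m * (m.*2.+1 + 2) + 1.
(** An upper bound on the vertices that the two trees of one linking hold until they are rolled
    back. *)
Definition slack := q1 + q2 + 2 ^ h.+2.

(* The inputs [a (false, w)] and [a (true, w)] are joined by two paths, and all
   pairs of corresponding inner vertices, except the middle ones, by chords. The
   edges of the two paths form an even cycle with two perfect matchings; either
   one, together with the chords, gives two paths of the same length from the
   inputs to the middle vertices, and the two matchings give opposite pairings. *)
Lemma switch_stage (W : finType) (w0 : W) (a : bool * W -> V) X Y r :
  extendable X Y r -> (forall x, r x <= D) ->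
  roomy X Y (#|W| * (l * l + l) + slack) -> Y \subset X -> M <= #|X| ->
  joined e M M X -> injective a -> (forall w, a w \in X :\: Y) ->
  (forall w, 2 <= r (a w)) -> (forall y, y \in Y -> 3 <= r y) ->
  exists (o : bool * W -> V) I r', [/\
    [/\ I \subset Y, #|I| = #|{: bool * W}| * switch_len, extendable X (Y :\: I) r' &
        forall x, r' x <= r x],
    injective o, forall w, o w \in I,
    (forall w, r (o w) <= r' (o w) + 1) /\
    (forall x, x \notin I -> r x <= r' x + 2 * (x \in codom a)) &
    forall sw : W -> bool,
      routable e a o I switch_len (fun w => (w.1 (+) sw w.2, w.2))].
Proof.
move=> gY rD rY YX MX jX aI aXY ra rY3.
pose x0 := a (false, w0).
have l0 : 0 < l by [].
have aY w : a w \notin Y by have /setDP[] := aXY w.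
have aX w : a w \in X by have /setDP[] := aXY w.
pose cnt x := count (fun w => a (false, w) == x) (enum W) +
              count (fun w => a (true, w) == x) (enum W).
have cntE x : cnt x <= (x \in codom a).
  rewrite /cnt !count_inj ?enum_uniq //; try by move=> w w' _ _ /aI[].
  case: (boolP (x \in map _ _)) => [/mapP[w _ ->]|_].
    rewrite codom_f; case: (boolP (_ \in map _ _)) => [/mapP[w' _ /aI[]]|] //.
  by case: (boolP (x \in map _ _)) => [/mapP[w _ ->]|_] //; rewrite codom_f.
have nca x : x \in Y -> x \in codom a = false.
  by apply: contraTF => /codomP[w ->].
have aw0 w : a (false, w) != a (true, w) by apply/eqP => /aI.
have rYb k Y' U k' : roomy X Y k -> Y' = Y :\: U -> U \subset Y -> k' + #|U| <= k -> roomy X Y'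
  k'.
  move=> rk -> UY le; apply: (roomy_sub rk (subsetDl _ _)).
  by rewrite setDDr setDv set0U (setIidPr UY).
rewrite /slack in rY; set tmp := q1 + q2 + 2 ^ h.+2 in rY.
have [|w _|x xY|y yY|P [U1 [r1 [[szP pP uP dP] U1E [U1Y cU1 g1 r1r] r1c]]]] :=
  @link_many _ e M D e_sym W (enum W) (fun w => a (false, w)) (fun w => a (true, w))
    X Y r q1 q2 h gY rD _ YX MX jX M_le (enum_uniq _) _ q1_gt0 q2_gt0.
- apply: (roomy_sub rY (subxx _)); rewrite setDv cards0 addn0 -cardE lm -/l.
  by rewrite leq_add2r leq_mul2l leq_addl orbT.
- by rewrite !aXY aw0.
- apply: leq_trans (cntE x) _; case: (boolP (x \in codom a)) => // /codomP[w ->].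
  by apply: leq_trans (ra w).
- exact: ltnW (rY3 y yY).
rewrite lm -/l -cardE in szP cU1.
have r1c' x : r x <= r1 x + (x \in codom a) + (x \in U1).
  by apply: leq_trans (r1c x) _; rewrite leq_add2r leq_add2l; apply: cntE.
have aU1 w : a w \in U1 = false by apply: contraNF (aY w); apply: subsetP.
have [|||w _|x xY|y|Q [U2 [r2 [[szQ pQ uQ dQ] U2E [U2Y cU2 g2 r2r] r2c]]]] :=
  @link_many _ e M D e_sym W (enum W) (fun w => a (false, w)) (fun w => a (true, w))
    X (Y :\: U1) r1 q1 q2 h g1 _ _ _ MX jX M_le (enum_uniq _) _ q1_gt0 q2_gt0.
- by move=> x; apply: leq_trans (r1r x) (rD x).
- apply: (rYb _ _ U1 _ rY) => //; rewrite -cardE lm -/l cU1 -/tmp.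
  by move: l0; move: (#|W|) (l) (tmp); clear; nia.
- exact: subset_trans (subsetDl _ _) YX.
- by rewrite !in_setD !aX (negbTE (aY _)) (negbTE (aY _)) !andbF aw0.
- apply: leq_trans (cntE x) _; case: (boolP (x \in codom a)) => // /codomP[w ->].
  by have := r1c' (a w); rewrite aU1 codom_f; move: (ra w); clear; lia.
- rewrite inE => /andP[yU yY]; have := r1c' y; rewrite nca // (negbTE yU).
  by move: (rY3 _ yY); clear; lia.
rewrite lm -/l -cardE in szQ cU2.
have r2c' x : r1 x <= r2 x + (x \in codom a) + (x \in U2).
  by apply: leq_trans (r2c x) _; rewrite leq_add2r leq_add2l; apply: cntE.
have U2Y' : U2 \subset Y by apply: subset_trans U2Y (subsetDl _ _).
have dU12 x : x \in U1 -> x \in U2 = false.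
  by move=> xU; apply: contraTF xU => /(subsetP U2Y); rewrite inE => /andP[].
pose p c w i := nth x0 (if c then Q w else P w) i.
have mW w : w \in enum W by rewrite mem_enum.
have pU1 w i : i < l -> p false w i \in U1.
  by move=> lt; rewrite U1E; apply/hasP; exists w => //; rewrite mem_nth ?szP.
have pU2 w i : i < l -> p true w i \in U2.
  by move=> lt; rewrite U2E; apply/hasP; exists w => //; rewrite mem_nth ?szQ.
have pI c c' w w' i i' : i < l -> i' < l -> p c w i = p c' w' i' -> [/\ c = c', w = w' & i = i'].
  move=> li li'; case: c; case: c' => E.
  - have ew : w = w'.
      by apply: (dQ w w' (p true w i)); rewrite ?mW //; [|rewrite E]; rewrite mem_nth ?szQ.
    move: E; rewrite -ew => /eqP; rewrite nth_uniq ?szQ ?uQ // => /eqP->.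
    by split.
  - by have := dU12 _ (pU1 w' _ li'); rewrite -E pU2.
  - by have := dU12 _ (pU1 w _ li); rewrite E pU2.
  - have ew : w = w'.
      by apply: (dP w w' (p false w i)); rewrite ?mW //; [|rewrite E]; rewrite mem_nth ?szP.
    move: E; rewrite -ew => /eqP; rewrite nth_uniq ?szP ?uP // => /eqP->.
    by split.
(* There is one rung for each level of each ladder except the middle level [m], whose two vertices
   are the outputs. *)
pose js := [seq (w, i) | w <- enum W, i <- [seq i <- iota 0 l | i != m]].
have jsE w i : ((w, i) \in js) = (i < l) && (i != m).
  apply/allpairsP/andP => [[[w' i'] [_ + E]]|[li im]].
    by rewrite mem_filter mem_iota leq0n add0n; case: E => _ -> /andP[im li]; rewrite im.
  exists (w, i); split; [exact: mW | | by []].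
  by rewrite mem_filter mem_iota im.
have ujs : uniq js.
  by rewrite allpairs_uniq ?enum_uniq ?filter_uniq ?iota_uniq // => -[? ?] [? ?] _ _.
have szjs : size js = #|W| * l.-1.
  rewrite size_allpairs -cardE; congr (_ * _).
  rewrite size_filter; have := count_predC (pred1 m) (iota 0 l).
  rewrite size_iota count_uniq_mem ?iota_uniq // mem_iota leq0n add0n.
  have -> : m < l by rewrite /l -addnn; clear; lia.
  by rewrite add1n => E; apply: succn_inj; rewrite prednK.
pose u (j : W * nat) := p false j.1 j.2; pose v (j : W * nat) := p true j.1 j.2.
have uI : {in js &, injective u}.
  by move=> [w i] [w' i']; rewrite !jsE => /andP[li _] /andP[li' _] E;
  have [_ -> ->] := pI false false w w' i i' li li' E.
have vI : {in js &, injective v}.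
  by move=> [w i] [w' i']; rewrite !jsE => /andP[li _] /andP[li' _] E;
  have [_ -> ->] := pI true true w w' i i' li li' E.
pose cnt3 x := count (fun j => u j == x) js + count (fun j => v j == x) js.
have cnt3E x : cnt3 x = (x \in map u js) + (x \in map v js) by rewrite /cnt3 !count_inj.
have cnt3U x : cnt3 x <= (x \in U1) + (x \in U2).
  rewrite cnt3E; apply: leq_add.
    by case: (boolP (_ \in map _ _)) => // /mapP[[w i]]; rewrite jsE => /andP[li _] ->;
      rewrite pU1.
  by case: (boolP (_ \in map _ _)) => // /mapP[[w i]]; rewrite jsE => /andP[li _] ->; rewrite pU2.
have cnt3m c w : cnt3 (p c w m) = 0.
  have ml : m < l by rewrite /l -addnn; clear; lia.
  rewrite cnt3E; apply/eqP; rewrite addn_eq0 !eqb0; apply/andP; split;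
  apply/negP => /mapP[[w' i]]; rewrite jsE => /andP[li im] E;
  by [have [_ _ mi] := pI _ false _ w' _ _ ml li E; rewrite mi eqxx in im
     |have [_ _ mi] := pI _ true _ w' _ _ ml li E; rewrite mi eqxx in im].
have Y2E : Y :\: U1 :\: U2 = Y :\: (U1 :|: U2) by rewrite setDDl.
have cU12 : #|U1 :|: U2| = #|W| * l + #|W| * l.
  rewrite -{1}cU1 -cU2; apply/eqP; rewrite leq_card_setU disjoint_subset.
  by apply/subsetP => x /dU12 xU; rewrite inE xU.
have U12Y : U1 :|: U2 \subset Y by rewrite subUset U1Y U2Y'.
have [|||[w i]|x|y|R [U3 [r3 [[szR pR uR dR] U3E [U3Y cU3 g3 r3r] r3c]]]] :=
  @link_many _ e M D e_sym _ js u v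
    X (Y :\: U1 :\: U2) r2 q1 q2 h g2 _ _ _ MX jX M_le ujs _ q1_gt0 q2_gt0.
- by move=> x; apply: leq_trans (r2r x) (leq_trans (r1r x) (rD x)).
- apply: (rYb _ _ (U1 :|: U2) _ rY) => //; rewrite szjs lm -/l cU12 -/tmp.
  by rewrite /l /=; clear; nia.
- by rewrite Y2E (subset_trans (subsetDl _ _) YX).
- rewrite jsE => /andP[li _]; rewrite !in_setD pU2 // pU1 //= andbF /=.
  split; first by rewrite (subsetP YX) ?(subsetP U1Y) ?pU1.
    by rewrite (subsetP YX) ?(subsetP U2Y') ?pU2.
  by apply/eqP => E; have [] := pI false true w w i i li li E.
- rewrite Y2E in_setD negb_and negbK => xY; apply: leq_trans (cnt3U x) _.
  have := r1c' x; have := r2c' x.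
  case: (boolP (x \in U1)) => xU1.
    by have xY' := subsetP U1Y _ xU1; rewrite nca // dU12 //; move: (rY3 x xY'); clear; lia.
  case: (boolP (x \in U2)) => xU2 //.
  by have xY' := subsetP U2Y' _ xU2; rewrite nca //; move: (rY3 x xY'); clear; lia.
- rewrite Y2E in_setD inE negb_or => /andP[/andP[yU1 yU2] yY].
  have := r1c' y; have := r2c' y; rewrite nca // (negbTE yU1) (negbTE yU2).
  by move: (rY3 y yY); clear; lia.
rewrite lm -/l szjs in szR cU3.
pose I := U1 :|: U2 :|: U3.
have U3Y' : U3 \subset Y by rewrite (subset_trans U3Y) // Y2E subsetDl.
have dU3 x : x \in U3 -> (x \in U1 = false) * (x \in U2 = false).
  by move/(subsetP U3Y); rewrite Y2E !inE negb_or => /andP[/andP[/negbTE-> /negbTE->]].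
have ml : m < l by rewrite /l -addnn; clear; lia.
exists (fun cw => p cw.1 cw.2 m), I, r3; split.
- split.
  + by rewrite subUset U12Y.
  + have -> : #|I| = #|U1 :|: U2| + #|U3|.
      apply/eqP; rewrite leq_card_setU disjoint_sym disjoint_subset.
      by apply/subsetP => x /dU3[x1 x2]; rewrite !inE x1 x2.
    rewrite cU12 cU3 card_prod card_bool /switch_len /l /=.
    by clear; nia.
  + by rewrite /I -setDDl -Y2E.
  + by move=> x; apply: leq_trans (r3r x) (leq_trans (r2r x) (r1r x)).
- by move=> [c w] [c' w'] /= E; have [-> ->] := pI c c' w w' m m ml ml E.
- by move=> [[] w]; rewrite !inE ?pU1 ?pU2 ?orbT.
- split=> [[c w]|x] /=.
    have pY : p c w m \in U1 :|: U2 by case: c; rewrite !inE ?pU1 ?pU2 ?orbT.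
    have pU3 : p c w m \in U3 = false.
      by apply: contraTF pY => /dU3[x1 x2]; rewrite !inE x1 x2.
    have := r1c' (p c w m); have := r2c' (p c w m); have := r3c (p c w m).
    rewrite -/(cnt3 _) cnt3m pU3 nca ?(subsetP U12Y) //.
    move: pY; rewrite inE; case: (boolP (_ \in U1)) => [/dU12->|_ /=]; first by clear; lia.
    by move=> ->; clear; lia.
  rewrite !inE !negb_or => /andP[/andP[x1 x2] x3].
  have := r1c' x; have := r2c' x; have := r3c x; rewrite -/(cnt3 x); have := cnt3U x.
  rewrite (negbTE x1) (negbTE x2) (negbTE x3).
  by move: (cnt3 x) (x \in codom a) => c b; clear; case: b => /=; lia.
move=> sw.
pose Rc (c : bool) w i := if c then rev (R (w, i)) else R (w, i).
have sP c w : size (if c then Q w else P w) = l by case: c; rewrite ?szP ?szQ.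
have E c w : path e (a (false, w)) (rcons (if c then Q w else P w) (a (true, w))).
  by case: c; rewrite ?pP ?pQ.
have E0 c w : e (a (false, w)) (p c w 0).
  have /(pathP x0)/(_ 0) := E c w.
  by rewrite size_rcons sP /= nth_rcons sP => /(_ isT).
have Em c w i : i.+1 < l -> e (p c w i) (p c w i.+1).
  move=> lt; have /(pathP x0)/(_ i.+1) := E c w.
  by rewrite size_rcons sP /= !nth_rcons !sP lt (ltnW lt) => /(_ (ltnW lt)).
have El c w : e (p c w m.*2) (a (true, w)).
  have /(pathP x0)/(_ l) := E c w.
  rewrite size_rcons sP ltnSn => /(_ isT).
  have -> : nth x0 (rcons (if c then Q w else P w) (a (true, w))) l = a (true, w).
    by rewrite nth_rcons sP ltnn eqxx.
  by rewrite /= nth_rcons sP ltnSn.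
have Rs c w i : i < l -> i != m -> size (Rc c w i) = l.
  by move=> li im; rewrite /Rc fun_if size_rev if_same szR ?jsE ?li.
have Re w i : Rc true w i =i Rc false w i by move=> x; rewrite /Rc mem_rev.
have Rp c w i : i < l -> i != m -> path e (p c w i) (rcons (Rc c w i) (p (~~ c) w i)).
  move=> li im; have pw : path e (p false w i) (rcons (R (w, i)) (p true w i)).
    by apply: (pR (w, i)); rewrite jsE li.
  by case: c => //=; apply: path_rev_sym.
have zig cw : exists s, [/\ [/\ size s = switch_len, path e (a cw) s &
    last (a cw) s = p (cw.1 (+) sw cw.2) cw.2 m] &
    forall i, (if cw.1 then m < i < l else i < m) ->
      (forall c, p c cw.2 i \in s) /\ {subset R (cw.2, i) <= s}].
  case: cw => -[] w /=.
    (* The route from [a (true, w)] comes down from level [m.*2] and starts on the side on which the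
       route from [a (false, w)] does not start. As [m] is even, each route ends on the side of its
       start, so the two ends differ. *)
    have [|||||s [sz ps ls cs]] := @zigzag _ e (fun c k => p c w (m.*2 - k))
       (fun c k => Rc c w (m.*2 - k)) l (a (true, w)) (~~ sw w) m.
    - by move=> c k km; apply: Rs; rewrite /l; move: km; clear; lia.
    - by move=> k km; apply: Re.
    - by rewrite subn0 e_sym El.
    - by move=> c k km; apply: Rp; rewrite /l; move: km; clear; lia.
    - move=> c k km; rewrite e_sym.
      have -> : m.*2 - k = (m.*2 - k.+1).+1 by move: km; clear; lia.
      by apply: Em; rewrite /l; move: km; clear; lia.
    - exists s; split; first split=> //.
        by rewrite ls (negbTE m_even) addbF -addnn addnK.
      move=> i /andP[mi li]; have [|c1 c2] := cs (m.*2 - i).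
        by move: mi li; rewrite /l; clear; lia.
      by rewrite subKn in c1 c2; last by move: li; rewrite /l; clear; lia.
  have [|||||s [sz ps ls cs]] := @zigzag _ e (fun c k => p c w k)
     (fun c k => Rc c w k) l (a (false, w)) (sw w) m.
  - by move=> c k km; apply: Rs; move: km ml; clear; lia.
  - by move=> k km; apply: Re.
  - exact: E0.
  - by move=> c k km; apply: Rp; move: km ml; clear; lia.
  - by move=> c k km; apply: Em; rewrite /l; move: km; clear; lia.
  exists s; split; first split=> //.
    by rewrite ls (negbTE m_even) addbF.
  by move=> i im; apply: cs.
have [s sP'] := fin_all_exists zig.
have lst cw : p (cw.1 (+) sw cw.2) cw.2 m \in s cw.
  have [[sz _ ls] _] := sP' cw; rewrite -ls.
  case: (s cw) sz => [|y s'] sz; last by rewrite last_cons mem_last.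
  by move: sz; rewrite /switch_len addn1.
exists s; split=> [cw|x]; first by have [] := sP' cw.
have cov c w i : i < l -> exists cw, p c w i \in s cw.
  move=> li; case: (ltngtP i m) => im.
  - by have [_ /(_ i im)[/(_ c) ? _]] := sP' (false, w); exists (false, w).
  - have [_ /(_ i)/= h3] := sP' (true, w); exists (true, w).
    by have [|/(_ c)] := h3; rewrite ?im.
  - exists (c (+) sw w, w); have := lst (c (+) sw w, w).
    by rewrite /= -addbA addbb addbF im.
rewrite !inE => /orP[/orP[]|].
- rewrite U1E => /hasP[w _ /(nthP x0)[i li <-]]; rewrite szP // in li.
  exact: (cov false w i li).
- rewrite U2E => /hasP[w _ /(nthP x0)[i li <-]]; rewrite szQ // in li.
  exact: (cov true w i li).
- rewrite U3E => /hasP[[w i]]; rewrite jsE => /andP[li im] xR.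
  case: (ltngtP i m) im => // im _.
    by have [_ /(_ i im)[_ /(_ _ xR) ?]] := sP' (false, w); exists (false, w).
  have [_ /(_ i)/= h3] := sP' (true, w); exists (true, w).
  by have [|_ /(_ _ xR)] := h3; rewrite ?im.
Qed.

End Network.

(* Each fibre of [snd \o f] meets exactly two inputs; Hall's theorem selects one
   input from each pair so that the selected ones have distinct images. *)
Lemma split_switches (W : finType) (f : bool * W -> bool * W) : injective f ->
  exists (s1 s2 : W -> bool) (g : bool -> W -> W), (forall c, injective (g c)) /\
    forall c w, let c1 := c (+) s1 w in f (c, w) = (c1 (+) s2 (g c1 w), g c1 w).
Proof.
move=> fI; pose rho : rel W := fun w w' => [exists c, (f (c, w)).2 == w'].
(* With [M] beyond [#|W|] no set is large, [roomy] holds trivially and [extendable] is Hall's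
   condition. It holds because the [2 * #|S|] inputs over [S] have distinct images, all of them over
   [nb rho S]. *)
have gW : extendable rho #|W|.+1 setT setT (fun=> 1).
  move=> S _ _; rewrite sum1_card setIT -leq_double -!mul2n -card_bool.
  have -> : #|{: bool}| * #|S| = #|[set cw : bool * W | cw.2 \in S]|.
    rewrite -cardsT -cardsX; apply: eq_card => -[c w]; by rewrite !inE.
  have -> : #|{: bool}| * #|nb rho S| = #|[set cw : bool * W | cw.2 \in nb rho S]|.
    by rewrite -cardsT -cardsX; apply: eq_card => -[c w]; rewrite !in_set.
  rewrite -(card_imset _ fI); apply/subset_leq_card/subsetP => y /imsetP[[c w]].
  rewrite inE => wS ->; rewrite inE; apply/nbP; exists w => //.
  by apply/existsP; exists c.
have [|||w|ys [sz uys _ al _]] := @extendable_stars W rho #|W|.+1 1 setT setT (fun=> 1) (enum W)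
  gW.
- by [].
- by move=> S _ cS; have := leq_trans cS (max_card _); rewrite ltnn.
- by move=> w _; rewrite inE.
- by rewrite count_uniq_mem ?enum_uniq // leq_b1.
pose g0 w := nth w ys (index w (enum W)).
have il w : index w (enum W) < size ys by rewrite sz index_mem mem_enum.
have g0I : injective g0.
  move=> w w'; rewrite /g0 (set_nth_default w) // => /eqP.
  rewrite nth_uniq // => /eqP E.
  by rewrite -(nth_index w (mem_enum W w)) E nth_index ?mem_enum.
have rg w : [exists c, (f (c, w)).2 == g0 w].
  move: al; rewrite all2E => /andP[_ /allP alP]; apply: (alP (w, g0 w)).
  apply/(nthP (w, w)); exists (index w (enum W)).
    by rewrite size_zip sz minnn -sz.
  by rewrite nth_zip // nth_index ?mem_enum.
have [c0 c0P] := fin_all_exists (fun w => existsP (rg w)).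
have c0E w : (f (c0 w, w)).2 = g0 w by apply/eqP.
have [g0' g0K K'] := injF_bij g0I.
pose g1 w := (f (~~ c0 w, w)).2.
have f1 z w : (f (~~ c0 w, w)).2 = z -> (f (~~ c0 w, w)).1 = ~~ (f (c0 (g0' z), g0' z)).1.
  move=> fz; have fz' : (f (c0 (g0' z), g0' z)).2 = z by rewrite c0E K'.
  case: (eqVneq (f (~~ c0 w, w)).1 (f (c0 (g0' z), g0' z)).1) => [E|]; last first.
    by case: (f (~~ _, w)).1; case: (f _).1.
  have : f (~~ c0 w, w) = f (c0 (g0' z), g0' z).
    move: fz fz' E; by case: (f _) => x1 x2; case: (f _) => y1 y2 /= -> -> ->.
  by move/fI => [cc ww]; move: cc; rewrite -ww; case: (c0 w).
have g1I : injective g1.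
  move=> w w' E; have e1 := f1 _ _ E; have e2 := f1 _ w' erefl.
  have : f (~~ c0 w, w) = f (~~ c0 w', w').
    rewrite [LHS]surjective_pairing [RHS]surjective_pairing e1 e2.
    by congr (_, _).
  by case/fI.
(* The selected input of each pair is sent through the inner network [false], the other one through
   [true]. The second stage is set by the side on which the selected one has to leave. *)
exists c0, (fun z => (f (c0 (g0' z), g0' z)).1), (fun c => if c then g1 else g0).
split=> [[]//|c w] /=.
case: (eqVneq c (c0 w)) => [->|ne].
  by rewrite addbb /= g0K -c0E -surjective_pairing.
have -> : c = ~~ c0 w by case: c ne; case: (c0 w).
have -> : ~~ c0 w (+) c0 w = true by case: (c0 w).
rewrite [LHS]surjective_pairing; congr (_, _).
by rewrite addTb -(f1 (g1 w) w).
Qed.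

Fixpoint wires n : finType :=
  if n is n'.+1 then (bool * wires n')%type : finType else unit.

Lemma card_wires n : #|wires n| = 2 ^ n.
Proof. by elim: n => [|n IH]; rewrite ?card_unit //= card_prod IH card_bool expnS. Qed.

Lemma wires0 n : wires n.
Proof. by elim: n => [|n w]; [exact: tt | exact: (true, w)]. Qed.

(** * Recursive construction of the network *)

Section Benes.
Variables (V : finType) (e : rel V) (M D : nat).
Hypothesis e_sym : symmetric e.
Implicit Types (A B S X Y Z K I U : {set V}) (r : V -> nat).

Notation extendable := (extendable e M).
Notation roomy := (roomy e M D).

Variables (q1 q2 h m : nat).
Hypotheses (q1_gt0 : 0 < q1) (q2_gt0 : 0 < q2) (m_even : ~~ odd m).
Hypotheses (lm : q1 + q2 + h.*2 = m.*2.+1) (M_le : M <= 2 ^ h).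

Notation switch_len := (switch_len m).
Notation slack := (slack q1 q2 h).

Definition net_len n := n * (2 * switch_len).

Lemma roomy_diff X Y U k k' : roomy X Y k -> U \subset Y -> k' + #|U| <= k ->
  roomy X (Y :\: U) k'.
Proof.
move=> rk UY le; apply: (roomy_sub rk (subsetDl _ _)).
by rewrite setDDr setDv set0U (setIidPr UY).
Qed.

(** Two networks of half the size stand between two stages of switches, and [split_switches] tells
    how to set them for a given permutation. Passing a stage costs an input 2 units and an output 1,
    so the demand 4 in [Y] leaves 3 at the outputs of a stage, enough for them to be the inputs of
    the next. *)
Lemma benes n (a : wires n -> V) X Y r :
  extendable X Y r -> (forall x, r x <= D) ->
  roomy X Y (2 ^ n * net_len n + slack) -> Y \subset X -> M <= #|X| ->
  joined e M M X -> injective a -> (forall w, a w \in X :\: Y) ->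
  (forall w, 3 <= r (a w)) -> (forall y, y \in Y -> 4 <= r y) ->
  exists (o : wires n -> V) I r', [/\
    [/\ I \subset Y, #|I| = 2 ^ n * net_len n, extendable X (Y :\: I) r' &
        forall x, r' x <= r x],
    injective o /\
    forall w, [/\ o w \in I :|: [set x in codom a], o w \in X :\: (Y :\: I) & 3 <= r' (o w)],
    forall x, x \notin I -> r x <= r' x + 2 * (x \in codom a) &
    forall f : wires n -> wires n, injective f -> routable e a o I (net_len n) f].
Proof.
elim: n a Y r => [|n IH] a Y r gY rD rY YX MX jX aI aXY ra rY4.
  (* A network on one wire has no vertices of its own; its output is its input. *)
  exists a, set0, r; split.
  - by split=> //; rewrite ?sub0set ?setD0 // cards0 /net_len mul0n muln0.
  - by split=> // w; split; rewrite ?setD0 // !inE codom_f.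
  - by move=> x _; rewrite leq_addr.
  - move=> f _; exists (fun=> [::]); split=> [w|x]; last by rewrite inE.
    by split=> //=; case: (f w); case: w.
have cI4 : 2 ^ n.+1 * net_len n.+1 =
    2 ^ n.+1 * switch_len + 2 ^ n * net_len n + 2 ^ n * net_len n + 2 ^ n.+1 * switch_len.
  rewrite /net_len expnS; move: (2 ^ n) switch_len => t s; clear; nia.
have W2 : 2 ^ n * ((m.*2.+1 * m.*2.+1) + m.*2.+1) = 2 ^ n.+1 * switch_len.
  rewrite expnS /switch_len; move: (2 ^ n) => t; clear; nia.
have cW : #|{: bool * wires n}| = 2 ^ n.+1 by rewrite -card_wires.
have [|||b [I1 [r1 [[I1Y cI1 g1 r1r] bI bI1 [r1b r1c] rt1]]]] :=
  @switch_stage V e M D e_sym q1 q2 h m q1_gt0 q2_gt0 m_even lm M_le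
    (wires n) (wires0 n) a X Y r gY rD _ YX MX jX aI aXY.
- rewrite card_wires W2; apply: (roomy_sub rY (subxx _)); rewrite setDv cards0.
  by rewrite cI4; clear; lia.
- by move=> w; apply: ltnW.
- by move=> y yY; apply: ltnW (rY4 y yY).
rewrite cW in cI1.
have ca x : x \in Y -> x \in codom a = false.
  by apply: contraTF => /codomP[w ->]; have /setDP[] := aXY w.
have bY w : b w \in Y by apply: (subsetP I1Y).
have r1b3 w : 3 <= r1 (b w) by have := r1b w; have := rY4 _ (bY w); clear; lia.
have r1Y y : y \in Y :\: I1 -> 4 <= r1 y.
  rewrite inE => /andP[yI yY]; have := r1c y yI; have := rY4 y yY.
  by rewrite ca //; clear; lia.
have [|||w w' /bI[]||||o1 [I2 [r2 [[I2Y cI2 g2 r2r] [o1I o1P] r2c rt2]]]] //:=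
  IH (fun w => b (false, w)) (Y :\: I1) r1 g1 _ _ _ MX jX.
- by move=> x; apply: leq_trans (r1r x) (rD x).
- apply: (roomy_diff rY) => //; rewrite cI1 cI4; clear; lia.
- exact: subset_trans (subsetDl _ _) YX.
- by move=> w; rewrite !in_setD bI1 (subsetP YX).
have cb1 x : x \notin I1 -> x \in codom (fun w => b (false, w)) = false.
  by apply: contraNF => /codomP[w ->].
have cb2 x : x \notin I1 -> x \in codom (fun w => b (true, w)) = false.
  by apply: contraNF => /codomP[w ->].
have r2Y y : y \in Y :\: I1 :\: I2 -> 4 <= r2 y.
  rewrite in_setD => /andP[yI yY]; have := r2c y yI; have := r1Y y yY.
  by move: yY; rewrite in_setD => /andP[yI1 _]; rewrite cb1 //; clear; lia.
have bI2 w : b w \notin I2 by apply/negP => /(subsetP I2Y); rewrite !inE bI1.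
have r2b w : 3 <= r2 (b (true, w)).
  have := r2c _ (bI2 (true, w)); have := r1b3 (true, w).
  case: (boolP (_ \in codom _)) => [/codomP[w' /bI[]]|_] //; clear; lia.
have [|||w w' /bI[]||||o2 [I3 [r3 [[I3Y cI3 g3 r3r] [o2I o2P] r3c rt3]]]] //:=
  IH (fun w => b (true, w)) (Y :\: I1 :\: I2) r2 g2 _ _ _ MX jX.
- by move=> x; apply: leq_trans (r2r x) (leq_trans (r1r x) (rD x)).
- rewrite setDDl; apply: (roomy_diff rY).
    by rewrite subUset I1Y (subset_trans I2Y (subsetDl _ _)).
  have : #|I1 :|: I2| <= #|I1| + #|I2| by rewrite leq_card_setU.
  by rewrite cI1 cI2 cI4; clear; lia.
- by rewrite !(subset_trans (subsetDl _ _)).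
- by move=> w; rewrite !in_setD bI1 (subsetP YX) ?andbF.
have I2Y' : I2 \subset Y by apply: subset_trans I2Y (subsetDl _ _).
have I3Y' : I3 \subset Y by rewrite (subset_trans I3Y) // !(subset_trans (subsetDl _ _)).
have nI1 x : (x \in I2) || (x \in I3) -> x \notin I1.
  case/orP => [/(subsetP I2Y)|/(subsetP I3Y)]; rewrite !inE; first by case/andP.
  by case/and3P.
have o1b w w' : o1 w != b (true, w').
  apply/eqP => E; have [+ _ _] := o1P w; rewrite E !inE (negbTE (bI2 _)) /=.
  by case/codomP => w'' /bI[].
have o1I3 w : o1 w \notin I3.
  by apply/negP => /(subsetP I3Y); have [_ /setDP[_ /negP]] := o1P w.
have o12 w w' : o1 w != o2 w'.
  apply/eqP => E; have [+ _ _] := o2P w'; rewrite -E !inE (negbTE (o1I3 _)) /=.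
  by case/codomP => w'' /eqP; rewrite (negbTE (o1b _ _)).
have r3o1 w : 3 <= r3 (o1 w).
  have := r3c _ (o1I3 w); have [_ _] := o1P w.
  case: (boolP (_ \in codom _)) => [/codomP[w' /eqP]|_]; last by clear; lia.
  by rewrite (negbTE (o1b _ _)).
pose a3 cw := if cw.1 then o2 cw.2 else o1 cw.2.
have r3Y y : y \in Y :\: I1 :\: I2 :\: I3 -> 4 <= r3 y.
  rewrite in_setD => /andP[yI yY]; have := r3c y yI; have := r2Y y yY.
  by move: yY; rewrite !in_setD => /and3P[_ yI1 _]; rewrite cb2 //; clear; lia.
have a3P cw : [/\ a3 cw \in I1 :|: I2 :|: I3, a3 cw \in X :\: (Y :\: I1 :\: I2 :\: I3) & 3 <= r3
  (a3 cw)].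
  case: cw => -[] w; rewrite /a3 /=.
    have [+ -> ->] := o2P w; rewrite !inE => /orP[->|/codomP[w' ->]]; rewrite ?orbT //.
    by rewrite bI1.
  have [b0 /setDP[oX oY] _] := o1P w; split; last exact: r3o1.
    by move: b0; rewrite !inE => /orP[->|/codomP[w' ->]]; rewrite ?bI1 ?orbT.
  by rewrite in_setD oX andbT in_setD (negbTE oY) andbF.
have Y3E : Y :\: I1 :\: I2 :\: I3 = Y :\: (I1 :|: I2 :|: I3) by rewrite !setDDl setUA.
have I123 : I1 :|: I2 :|: I3 \subset Y by rewrite !subUset I1Y I2Y'.
have c123 : #|I1 :|: I2 :|: I3| = 2 ^ n.+1 * switch_len + 2 ^ n * net_len n + 2 ^ n * net_len n.
  rewrite -cI1 -{1}cI2 -cI3; transitivity (#|I1 :|: I2| + #|I3|).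
    apply/eqP; rewrite leq_card_setU disjoint_sym disjoint_subset; apply/subsetP => x xI.
    by move/(subsetP I3Y): (xI); rewrite !inE => /and3P[/negbTE-> /negbTE->].
  congr (_ + _); apply/eqP; rewrite leq_card_setU disjoint_sym disjoint_subset.
  by apply/subsetP => x xI; move/(subsetP I2Y): (xI); rewrite !inE => /andP[].
have [|||[[] w] [[] w']|cw|cw|y yY|o [I4 [r4 [[I4Y cI4' g4 r4r] oI oI4 [r4o r4c] rt4]]]] :=
  @switch_stage V e M D e_sym q1 q2 h m q1_gt0 q2_gt0 m_even lm M_le
    (wires n) (wires0 n) a3 X (Y :\: I1 :\: I2 :\: I3) r3 g3 _ _ _ MX jX.
- by move=> x; apply: leq_trans (r3r x) (leq_trans (r2r x) (leq_trans (r1r x) (rD x))).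
- rewrite card_wires W2 Y3E; apply: (roomy_diff rY) => //.
  by rewrite c123 cI4; clear; lia.
- by rewrite Y3E (subset_trans (subsetDl _ _)).
- by rewrite /a3 /= => /o2I->.
- by rewrite /a3 /= => /esym/eqP; rewrite (negbTE (o12 _ _)).
- by rewrite /a3 /= => /eqP; rewrite (negbTE (o12 _ _)).
- by rewrite /a3 /= => /o1I->.
- by have [] := a3P cw.
- by have [_ _ /ltnW] := a3P cw.
- exact: ltnW (r3Y y yY).
rewrite cW in cI4'.
have I4Y' : I4 \subset Y by rewrite (subset_trans I4Y) // Y3E subsetDl.
exists o, (I1 :|: I2 :|: I3 :|: I4), r4; split.
- split.
  + by rewrite subUset I123.
  + rewrite cI4 -c123 -cI4'; apply/eqP; rewrite leq_card_setU disjoint_sym disjoint_subset.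
    apply/subsetP => x /(subsetP I4Y); rewrite Y3E inE => /andP[xI _].
    by rewrite !inE in xI *.
  + by rewrite -setDDl -Y3E.
  + by move=> x; apply: leq_trans (r4r x) (leq_trans (r3r x) (leq_trans (r2r x) (r1r x))).
- split=> // w; split.
  + by rewrite !inE oI4 ?orbT.
  + by rewrite in_setD (subsetP YX) ?(subsetP I4Y') // andbT !inE oI4 ?orbT.
  + by have := r4o w; have := r3Y _ (subsetP I4Y _ (oI4 w)); clear; lia.
- move=> x; rewrite !inE !negb_or => /andP[/andP[/andP[x1 x2] x3] x4].
  have := r1c x x1; have := r2c x x2; have := r3c x x3; have := r4c x x4.
  rewrite cb1 // cb2 //; case: (boolP (x \in codom a3)) => [/codomP[cw xE]|_].
    by have [+ _ _] := a3P cw; rewrite -xE !inE (negbTE x1) (negbTE x2) (negbTE x3).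
  by move: (x \in codom a) => c; clear; case: c; lia.
- move=> f fI; have [s1 [s2 [g [gI fE]]]] := split_switches fI.
  have mid : routable e b a3 (I2 :|: I3) (net_len n) (fun w => (w.1, g w.1 w.2)).
    have [sA [hA cA]] := rt2 _ (gI false); have [sB [hB cB]] := rt3 _ (gI true).
    exists (fun w => if w.1 then sB w.2 else sA w.2); split.
      by case=> -[] w /=; [have := hB w | have := hA w].
    by move=> x; rewrite inE => /orP[/cA|/cB] [w xw]; [exists (false, w)|exists (true, w)].
  have inj1 : injective (fun w : bool * wires n => (w.1 (+) s1 w.2, w.2)).
    move=> [c w] [c' w'] /= [E ww]; rewrite ww in E *.
    by rewrite -[c](addbK (s1 w')) E addbK.
  have inj2 : injective (fun w : bool * wires n => (w.1, g w.1 w.2)).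
    by move=> [c w] [c' w'] /= [->] /gI->.
  have := routable_comp inj1 (rt1 s1) (routable_comp inj2 mid (rt4 s2)).
  have -> : I1 :|: (I2 :|: I3 :|: I4) = I1 :|: I2 :|: I3 :|: I4 by rewrite !setUA.
  have -> : switch_len + (net_len n + switch_len) = net_len n.+1.
    by rewrite /net_len; clear; lia.
  by apply: eq_routable => -[c w] /=; rewrite fE.
Qed.

End Benes.

(** * Reservoirs *)

Lemma subset_of_card (T : finType) (A : {set T}) k :
  k <= #|A| -> exists2 B : {set T}, B \subset A & #|B| = k.
Proof.
move=> le; exists [set x in take k (enum A)].
  by apply/subsetP => x; rewrite inE => /mem_take; rewrite mem_enum.
rewrite cardsE; have /card_uniqP-> : uniq (take k (enum A)) by rewrite take_uniq ?enum_uniq.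
by rewrite size_takel // -cardE.
Qed.

Section Reservoir.
Variables (V : finType) (e : rel V).
Hypothesis e_sym : symmetric e.
Implicit Types (A B E S W X Y Z : {set V}) (r : V -> nat).

Lemma blue_nonnb A B : [disjoint B & A] -> [disjoint B & nb e A] -> blue e B A.
Proof.
move=> dA dN; apply/blueP => x y xB yA; split.
  by apply: contraTneq xB => ->; rewrite (disjointFl dA yA).
apply/negP => exy; have := disjointFr dN xB; move/negP; apply.
by apply/nbP; exists y; rewrite // e_sym.
Qed.

Definition codense M X Y c := forall S, S \subset X -> M <= #|S| -> #|Y :\: nb e S| <= c.

(** Fix [M] elements of [S]: of the vertices that they miss, fewer than [a] lie outside these [M]
    elements. *)
Lemma joined_codense a M X Y : joined e a M X -> Y \subset X ->
  codense M X Y (a + M).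
Proof.
move=> jX YX S SX MS; have [S0 S0S cS0] := subset_of_card MS.
apply: leq_trans (_ : #|Y :\: nb e S0 :\: S0| + M <= _); last first.
  rewrite leq_add2r leqNgt; apply/negP => lt.
  have S0X : S0 \subset X by apply: subset_trans S0S SX.
  have YS0 : Y :\: nb e S0 :\: S0 \subset X by rewrite !(subset_trans (subsetDl _ _)).
  case/negP: (jX _ _ YS0 S0X (ltnW lt) (eq_leq (esym cS0))).
  apply: blue_nonnb; first by rewrite disjoint_sym disjoint_subset; apply/subsetP => x xS;
    rewrite !inE xS.
  by rewrite disjoint_subset; apply/subsetP => x; rewrite !in_setD => /and3P[].
rewrite -cS0; apply: leq_trans (leq_card_setU _ _).
apply/subset_leq_card/subsetP => x; rewrite in_setD => /andP[xS xY].
rewrite in_setU !in_setD xY andbT; case: (x \in S0) => //=; rewrite orbF.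
by apply: contra xS; apply/subsetP/nbS.
Qed.

Lemma codenseS M X Y Y' c : codense M X Y c -> Y' \subset Y -> codense M X Y' c.
Proof.
move=> cY sY S SX MS; apply: leq_trans (cY S SX MS).
by rewrite subset_leq_card // setSD.
Qed.

Lemma codense_roomy M D X Y c k : codense M X Y c ->
  (M * D).*2 + k + c <= #|Y| -> roomy e M D X Y k.
Proof.
move=> cY le S SX MS; have := cY S SX MS; rewrite -(leq_add2l #|nb e S :&: Y|).
by rewrite setIC cardsID; move: le; clear; lia.
Qed.

(** Remove a largest set [Z] of at most [M] vertices that expands at most by the factor [D]. A small
    set that expands too little afterwards could have been added to [Z]. A larger one has a subset
    that forms with [Z] a set of exactly [M] vertices, whose many neighbours cannot come from
    [Z]. *)
Lemma trim W M D k : 0 < M -> 0 < D -> 3 * (D * M) <= k ->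
  (forall A, A \subset W -> #|A| = M -> k + M <= #|nb e A :&: W|) ->
  exists Z, [/\ Z \subset W, #|Z| < M, #|nb e Z :&: (W :\: Z)| <= D * #|Z|,
    extendable e M (W :\: Z) (W :\: Z) (fun=> D) &
    forall S, S \subset W -> M <= #|S| -> k <= #|nb e S :&: (W :\: Z)|].
Proof.
move=> M0 D0 kD big.
pose P Z := [&& Z \subset W, #|Z| <= M & #|nb e Z :&: (W :\: Z)| <= D * #|Z|].
have P0 : P set0 by rewrite /P sub0set cards0 /= nb0 set0I cards0.
have [Z /and3P[ZW ZM Zbad] Zmax] := @arg_maxnP _ set0 P (fun Z => #|Z|) P0.
have DM0 : 0 < D * M by rewrite muln_gt0 D0.
have splitW (S : {set V}) : #|nb e S :&: W| <= #|nb e S :&: (W :\: Z)| + #|Z|.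
  apply: leq_trans (leq_card_setU _ _); apply/subset_leq_card/subsetP => x.
  by rewrite !in_setI in_setU in_setI in_setD => /andP[-> ->]; case: (x \in Z).
have Zlt : #|Z| < M.
  rewrite ltn_neqAle ZM andbT; apply/eqP => cZ; have := splitW Z.
  by have := big Z ZW cZ; move: Zbad; rewrite cZ; move: kD DM0; clear; lia.
have bigS S : S \subset W -> M <= #|S| -> k <= #|nb e S :&: (W :\: Z)|.
  move=> SW MS; have [S0 S0S cS0] := subset_of_card MS.
  have := big _ (subset_trans S0S SW) cS0; have := splitW S0.
  have : #|nb e S0 :&: (W :\: Z)| <= #|nb e S :&: (W :\: Z)|.
    by rewrite subset_leq_card // setSI // nbS.
  by move: Zlt; clear; lia.
exists Z; split=> // S SWZ S2; rewrite sum_nat_const.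
case: (posnP #|S|) => [->|S0]; first by rewrite mul0n.
have SW : S \subset W by apply: subset_trans SWZ (subsetDl _ _).
have dSZ : [disjoint S & Z].
  by rewrite disjoint_subset; apply/subsetP => x /(subsetP SWZ); rewrite !inE => /andP[].
have addU (S1 : {set V}) : #|nb e (S1 :|: Z) :&: (W :\: (S1 :|: Z))| <=
    #|nb e S1 :&: (W :\: Z)| + #|nb e Z :&: (W :\: Z)|.
  apply: leq_trans (leq_card_setU _ _); rewrite -setIUl -nbU.
  by rewrite subset_leq_card // setIS // setDS // subsetUr.
case: (leqP (#|S| + #|Z|) M) => cSZ.
  have cU : #|S :|: Z| = #|S| + #|Z| by apply/eqP; rewrite leq_card_setU.
  have := addU S; case: (leqP #|nb e (S :|: Z) :&: (W :\: (S :|: Z))| (D * #|S :|: Z|)) => le.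
    have /Zmax : P (S :|: Z) by rewrite /P le cU cSZ subUset SW ZW.
    by rewrite cU; move: S0; clear; lia.
  by move: le Zbad; rewrite cU mulnDr mulnC; clear; lia.
have [S1 S1S cS1] : exists2 S1 : {set V}, S1 \subset S & #|S1| = M - #|Z|.
  by apply: subset_of_card; move: cSZ; clear; lia.
have S1W : S1 \subset W by apply: subset_trans S1S SW.
have cU : #|S1 :|: Z| = M.
  transitivity (#|S1| + #|Z|); last by move: cS1 ZM; clear; lia.
  by apply/eqP; rewrite leq_card_setU (disjointWl S1S dSZ).
have := big (S1 :|: Z); rewrite subUset S1W ZW cU => /(_ isT erefl) big1.
have le1 : #|nb e (S1 :|: Z) :&: W| <= #|nb e (S1 :|: Z) :&: (W :\: (S1 :|: Z))| + M.
  rewrite -{1}cU; apply: leq_trans (leq_card_setU _ _); apply/subset_leq_card/subsetP => x.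
  by rewrite !in_setI in_setU in_setI in_setD => /andP[-> ->]; case: (x \in _ :|: Z).
have le2 : #|nb e S1 :&: (W :\: Z)| <= #|nb e S :&: (W :\: Z)|.
  by rewrite subset_leq_card // setSI // nbS.
have DZ : D * #|Z| <= D * M by rewrite leq_mul2l ltnW ?orbT.
have DS : #|S| * D <= 2 * (D * M) by apply: leq_trans (leq_mul S2 (leqnn D)) _;
  rewrite -mul2n -mulnA [M * D]mulnC.
by move: (addU S1) big1 le1 le2 DZ DS Zbad kD; clear; lia.
Qed.

(** Pick [t - M] vertices [E0], and let [Z] be a largest set of at most [M] vertices with at most
    [#|Z|] neighbours in [E0]. One private neighbour for each vertex of [Z] repairs this, at the
    cost of one unit of demand: a set [S] uses the private neighbours for its part in [Z] and, by
    the maximality of [Z], [E0] for the rest. A few more vertices fill up the size to [t]. *)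
Lemma reservoir M D X Y r t : extendable e M X Y r -> (forall x, r x <= D) ->
  roomy e M D X Y t -> M <= #|X| -> 5 * M <= t -> codense M X Y (2 * M) ->
  (forall x, x \in X -> 0 < r x) ->
  exists E r', [/\ E \subset Y, #|E| = t, extendable e M X (Y :\: E) r',
    (forall x, r' x <= r x <= r' x + 1) &
    forall S, S \subset X -> #|S| <= M -> #|S| <= #|nb e S :&: E|].
Proof.
move=> gY rD rY MX tM coY r0.
have rd Y' (U : {set V}) (k k' : nat) : roomy e M D X Y' k -> U \subset Y' -> k' + #|U| <= k ->
  roomy e M D X (Y' :\: U) k'.
  exact: roomy_diff.
have [|E0 [E0Y cE0 g0]] := @extendable_picks _ e M D X Y r (t - M) gY rD _ MX.
  by apply: (roomy_sub rY (subxx _)); rewrite setDv cards0 addn0 leq_subr.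
pose P Z := [&& Z \subset X, #|Z| <= M & #|nb e Z :&: E0| <= #|Z|].
have P0 : P set0 by rewrite /P sub0set cards0 /= nb0 set0I cards0.
have [Z /and3P[ZX ZM Zbad] Zmax] := @arg_maxnP _ set0 P (fun Z => #|Z|) P0.
have [|x|x|ys [sz uys sub al g1]] := @extendable_stars _ e M D X (Y :\: E0) r (enum Z) g0 rD.
- by apply: (rd _ _ _ _ rY) => //; rewrite cE0 -cardE; move: ZM tM; clear; lia.
- by rewrite mem_enum => /(subsetP ZX).
- rewrite count_uniq_mem ?enum_uniq // mem_enum.
  by case: (boolP (x \in Z)) => // /(subsetP ZX); apply: r0.
set Q := [set y in ys] in g1.
have cQ : #|Q| = #|Z| by rewrite cardsE (card_uniqP uys) sz -cardE.
have QY : Q \subset Y :\: E0 by apply/subsetP => y; rewrite inE; apply: sub.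
set r1 := fun x => _ in g1.
have r1b x : r1 x <= r x <= r1 x + 1.
  by rewrite /r1 count_uniq_mem ?enum_uniq //; case: (x \in _);
    rewrite ?subn0 ?leqnn ?leq_addr //=; clear; lia.
have dE0Q : #|E0 :|: Q| = #|E0| + #|Q|.
  apply/eqP; rewrite leq_card_setU disjoint_sym disjoint_subset.
  by apply/subsetP => y /(subsetP QY); rewrite !inE => /andP[].
have EQY : E0 :|: Q \subset Y by rewrite subUset E0Y (subset_trans QY) ?subsetDl.
rewrite setDDl in g1.
have [||P' [P'Y cP' g2]] := @extendable_picks _ e M D X (Y :\: (E0 :|: Q)) r1 (M - #|Z|) g1 _ _
  MX.
- by move=> x; have /andP[le _] := r1b x; apply: leq_trans le (rD x).
- by apply: (rd _ _ _ _ rY) => //; rewrite dE0Q cE0 cQ; move: ZM tM; clear; lia.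
exists (E0 :|: Q :|: P'), r1; split=> //.
- by rewrite subUset EQY (subset_trans P'Y) ?subsetDl.
- have -> : #|E0 :|: Q :|: P'| = #|E0 :|: Q| + #|P'|.
    apply/eqP; rewrite leq_card_setU disjoint_sym disjoint_subset.
    by apply/subsetP => y /(subsetP P'Y) /setDP[_ yn]; apply: yn.
  by rewrite dE0Q cE0 cQ cP'; move: ZM tM; clear; lia.
- by rewrite -setDDl.
move=> S SX SM.
pose S1 := S :&: Z; pose S2 := S :\: Z.
have cS : #|S| = #|S1| + #|S2| by rewrite cardsID.
have S2X : S2 \subset X by apply: subset_trans (subsetDl _ _) SX.
have cE S' : S' \subset X -> M <= #|S'| -> t - M <= #|nb e S' :&: E0| + 2 * M.
  move=> S'X MS'; rewrite -cE0 -(cardsID (nb e S')) setIC leq_add2l.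
  by apply: (codenseS coY E0Y).
have nU : #|nb e (S2 :|: Z) :&: E0| <= #|nb e S2 :&: E0| + #|nb e Z :&: E0|.
  by rewrite nbU setIUl leq_card_setU.
have US2 : #|nb e S2 :&: E0| <= #|nb e S :&: E0|.
  by rewrite subset_leq_card // setSI // nbS // subsetDl.
have UE : #|nb e S :&: E0| <= #|nb e S :&: (E0 :|: Q :|: P')|.
  by rewrite subset_leq_card // setIS // -setUA subsetUl.
have cU : #|S2 :|: Z| = #|S2| + #|Z|.
  apply/eqP; rewrite leq_card_setU disjoint_subset.
  by apply/subsetP => y; rewrite !inE => /andP[].
have UX : S2 :|: Z \subset X by rewrite subUset S2X.
(* Beyond [M] elements the maximality of [Z] says nothing, but then the union has at least
   [t - 3 * M >= 2 * M] neighbours in [E0], of which [Z] accounts for at most [M]. *)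
case: (ltnP M #|S2 :|: Z|) => MU.
  have := cE _ UX (ltnW MU).
  by move: nU US2 UE ZM Zbad SM tM; clear; lia.
have big2 : #|S2| <= #|nb e S2 :&: E0|.
  case: (posnP #|S2|) => [->//|S20].
  case: (leqP #|nb e (S2 :|: Z) :&: E0| #|S2 :|: Z|) => le; last by move: nU le Zbad;
    rewrite cU; clear; lia.
  have /Zmax : P (S2 :|: Z) by rewrite /P UX MU le.
  by rewrite cU; move: S20; clear; lia.
have Q1 : #|S1| <= #|nb e S1 :&: Q|.
  pose f z := nth z ys (index z (enum Z)).
  have iz z : z \in S1 -> index z (enum Z) < size ys.
    by rewrite inE => /andP[_ zZ]; rewrite sz index_mem mem_enum.
  have fI : {in S1 &, injective f}.
    move=> z z' zS z'S; rewrite /f [nth z' _ _](set_nth_default z) ?iz // => /eqP.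
    rewrite nth_uniq ?iz // => /eqP E.
    move: zS z'S; rewrite !inE => /andP[_ zZ] /andP[_ z'Z].
    by rewrite -(nth_index z (s := enum Z) (x := z)) ?mem_enum // E nth_index ?mem_enum.
  rewrite -(card_in_imset fI); apply/subset_leq_card/subsetP => y /imsetP[z zS ->].
  have zZ : z \in enum Z by move: zS; rewrite mem_enum inE => /andP[].
  rewrite in_setI; apply/andP; split; last by rewrite inE mem_nth ?iz.
  apply/nbP; exists z => //.
  move: al; rewrite all2E => /andP[_ /allP alP]; apply: (alP (z, f z)).
  apply/(nthP (z, z)); exists (index z (enum Z)); first by rewrite size_zip sz minnn -sz iz.
  by rewrite nth_zip // nth_index.
have : #|nb e S :&: E0| + #|nb e S1 :&: Q| <= #|nb e S :&: (E0 :|: Q :|: P')|.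
  have <- : #|(nb e S :&: E0) :|: (nb e S1 :&: Q)| = #|nb e S :&: E0| + #|nb e S1 :&: Q|.
    apply/eqP; rewrite leq_card_setU; apply: (disjointWl (subsetIr _ _)).
    rewrite disjoint_sym; apply: (disjointWl (subsetIr _ _)); rewrite disjoint_subset.
    by apply/subsetP => y /(subsetP QY); rewrite !inE => /andP[].
  apply/subset_leq_card; rewrite subUset; apply/andP; split.
    by rewrite setIS // -setUA subsetUl.
  by apply: setISS; [rewrite nbS // subsetIl | rewrite -setUA setUCA subsetUl].
by rewrite cS; move: Q1 big2 US2; clear; lia.
Qed.

End Reservoir.

(** * Trees as parent functions *)

Lemma sum_count_mem (T : finType) (S : {set T}) (s : seq T) :
  \sum_(x in S) count_mem x s = count (mem S) s.
Proof.
elim: s => [|y s IH] /=; first by rewrite big1.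
rewrite big_split /= IH; congr (_ + _).
case: (boolP (y \in S)) => yS.
  by rewrite (bigD1 y) //= eqxx big1 // => x /andP[_ /negbTE]; rewrite eq_sym => ->.
by rewrite big1 // => x xS; case: eqP => // E; rewrite E xS in yS.
Qed.

(** This is the extension lemma with [M] beyond the number of vertices, where no set is large and
    [roomy] holds trivially. *)
Lemma hall (V : finType) (e : rel V) (J : eqType) (js : seq J) (u : J -> V) (Y : {set V}) :
  uniq js ->
  (forall S : {set V}, {subset S <= map u js} ->
     count (fun j => u j \in S) js <= #|nb e S :&: Y|) ->
  exists g : J -> V, {in js &, injective g} /\
    forall j, j \in js -> g j \in Y /\ e (u j) (g j).
Proof.
move=> ujs H; pose vs := map u js; pose M := #|V|.+1.
have [|x||x|x|ys [sz uys sub al _]] :=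
  @extendable_stars V e M (size vs) [set x in vs] Y (fun x => count_mem x vs) vs.
- move=> S SX _; rewrite sum_count_mem count_map; apply: H => x xS.
  by have := subsetP SX x xS; rewrite inE.
- exact: count_size.
- by move=> S _ cS; have := leq_trans cS (max_card _); rewrite ltnn.
- by rewrite inE.
- by [].
have ij j : j \in js -> index j js < size ys by rewrite sz size_map index_mem.
exists (fun j => nth (u j) ys (index j js)); split.
  move=> i j ii jj /eqP; rewrite [nth (u j) _ _](set_nth_default (u i)) ?ij //.
  rewrite nth_uniq ?ij // => /eqP E.
  by rewrite -(nth_index i ii) E nth_index.
move=> j jj; split; first by apply: sub; rewrite mem_nth ?ij.
move: al; rewrite all2E => /andP[_ /allP alP]; apply: (alP (u j, nth (u j) ys (index j js))).
apply/(nthP (u j, u j)); exists (index j js).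
  by rewrite size_zip -sz minnn ij.
by rewrite nth_zip // (nth_map j) ?index_mem // nth_index.
Qed.

(** * Trees with many leaves *)

Section Trees.
Variables (V : finType) (e : rel V).
Hypothesis e_sym : symmetric e.
Implicit Types (A B E S W X Y Z : {set V}) (r : V -> nat).

Definition tree_in (p : nat -> nat) n W := exists f : nat -> V,
  [/\ {in gtn n &, injective f}, forall i, i < n -> f i \in W &
      forall i, 0 < i < n -> e (f (p i)) (f i)].

Definition is_parent (p : nat -> nat) n := forall i, 0 < i < n -> p i < i.

Definition max_children p n c := forall i, nchild p predT n i <= c.

Lemma nchild_split p K n i :
  nchild p predT n i = nchild p K n i + nchild p (predC K) n i.
Proof.
rewrite /nchild -big_split; apply: eq_bigr => j _ /=.
by case: (K j); case: (_ == _).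
Qed.

Lemma nkept_split K n : nkept K n + nkept (predC K) n = n.-1.
Proof.
rewrite /nkept -big_split /= (eq_bigr (fun=> 1)); last by move=> j _; case: (K j).
by rewrite big_const_nat iter_addn_0 mul1n subn1.
Qed.

Lemma sum_mem_count (P : pred nat) n s : uniq s -> {in s, forall j, 0 < j < n} ->
  \sum_(1 <= j < n) ((j \in s) && P j) = count P s.
Proof.
move=> us sn; rewrite -(big_mkcond (fun=> true)) /= -big_mkcond sum1_count.
rewrite -!size_filter; apply: perm_size; apply: uniq_perm; rewrite ?filter_uniq ?iota_uniq //.
move=> j; rewrite !mem_filter mem_index_iota andbC andbA andbC.
by case: (boolP (j \in s)) => [/sn->|]; rewrite ?andbT ?andbF.
Qed.

(** The leaves in [L] leave enough room for embedding the rest. Hall's condition for attaching them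
    holds for at most [M.*2] vertices because the embedding is still extendable with the demands of
    the missing children. A larger set misses fewer than [a] of the remaining vertices, as [W] is
    joined, and with the trimmed set [Z] there are at least [size L + a.-1] of these. *)
Lemma core_leaves Delta a M n p L W : 0 < M -> 0 < Delta -> 0 < a -> a <= M ->
  joined e a M W -> n.-1 + a <= #|W| -> is_parent p n -> max_children p n Delta ->
  uniq L -> {in L, forall j, 0 < j < n} -> {in L, forall j i, 0 < i < n -> p i != j} ->
  (2 * Delta + 4) * M <= size L -> (3 * Delta + 4) * M <= n -> tree_in p n W.
Proof.
move=> M0 D0 a0 aM jW cW pP pD uL Ln Lp tL nL.
have coW := joined_codense e_sym jW (subxx W).
have nM : n >= 4 * M by apply: leq_trans nL; rewrite leq_mul2r leq_addl orbT.
have DM0 : 0 < Delta * M by rewrite muln_gt0 D0.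
have [|Z [ZW ZM Zbad gX _]] := @trim V e W M Delta (3 * (Delta * M)) M0 D0 (leqnn _).
  move=> A AW cA; have := coW A AW (eq_leq (esym cA)).
  rewrite -(leq_add2l #|nb e A :&: W|) setIC cardsID.
  by move: nL cW aM DM0 M0; rewrite mulnDl -mulnA; clear; lia.
set X := W :\: Z in gX.
have XW : X \subset W by apply: subsetDl.
have cX : #|X| + #|Z| = #|W| by rewrite -(cardsID Z W) (setIidPr ZW) addnC.
have coX Y : Y \subset X -> codense e M X Y (a + M).
  move=> YX S SX; apply: (codenseS coW (subset_trans YX XW)).
  exact: subset_trans SX XW.
pose K := [pred i | i \notin L].
have nkL : nkept (predC K) n = size L.
  rewrite -(count_predT L) -(@sum_mem_count predT n L) //.
  by apply: eq_bigr => j _; rewrite /= negbK andbT.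
have nk : nkept K n + size L = n.-1 by rewrite -nkL nkept_split.
have MX : M <= #|X| by move: cX cW ZM nM; clear; lia.
have roomyX k Y : Y \subset X -> k + (2 * Delta + 2) * M <= #|Y| -> roomy e M Delta X Y k.
  move=> YX le; apply: (codense_roomy (coX Y YX)).
  by move: le aM; rewrite mulnDl -mulnA (mulnC Delta); clear; lia.
have rD (x : V) : (fun=> Delta) x <= Delta by [].
have tL' : 2 * (Delta * M) + 4 * M <= size L by move: tL; rewrite mulnDl -mulnA.
have [|u uX gu] := @extendable_pick V e M Delta X X (fun=> Delta) 0 gX rD _ MX.
  apply: roomyX => //; move: cX cW ZM nk tL'; rewrite mulnDl -mulnA; clear; lia.
have cXu : #|X :\ u| + 1 = #|X| by rewrite (cardsD1 u X) uX addnC.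
have n0 : 0 < n by move: nM M0; clear; lia.
have [||||i||f [Y' [r' [[f0 fI fY fe] [Y'Y cY' gY' _] _ r'c]]]] :=
  @embed V e M Delta p K u X (X :\ u) (fun=> Delta) Delta n gu rD _ (subD1set _ _) MX uX _ n0.
- apply: roomyX; first exact: subD1set.
  by move: cX cW ZM nk tL' cXu; rewrite mulnDl -mulnA; clear; lia.
- by rewrite !inE eqxx.
- exact: pP.
- by [].
- by apply: leq_trans (pD i); rewrite (nchild_split p K) leq_addr.
- by apply: leq_trans (pD 0); rewrite (nchild_split p K) leq_addr.
pose U := Y' :|: Z.
have dYZ : [disjoint Y' & Z].
  rewrite disjoint_subset; apply/subsetP => x /(subsetP Y'Y).
  by rewrite !inE => /and3P[].
have cU : size L + a.-1 <= #|U|.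
  have -> : #|U| = #|Y'| + #|Z| by apply/eqP; rewrite leq_card_setU.
  by move: cY' cXu cX cW nk a0; clear; lia.
have L0 : 0 \notin L by apply/negP => /Ln.
have plE i : (i \in placed K n) = (i < n) && (i \notin L).
  by rewrite inE /=; case: eqP => // ->; rewrite L0.
have plp i : 0 < i < n -> p i \in placed K n.
  move=> in'; rewrite plE (ltn_trans (pP i in')) /=; last by case/andP: in'.
  by apply/negP => /Lp/(_ i in'); rewrite eqxx.
have fX i : i \in placed K n -> f i \in X.
  case: (posnP i) => [-> _|i0 ip]; first by rewrite f0.
  by have /setDP[/setD1P[]] := fY i ip i0.
have fU i : i \in placed K n -> f i \notin U.
  move=> ip; have := fX i ip; rewrite !inE => /andP[/negbTE-> _]; rewrite orbF.
  case: (posnP i) => [i0|i0]; last by have /setDP[] := fY i ip i0.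
  by rewrite i0 f0; apply/negP => /(subsetP Y'Y); rewrite !inE eqxx.
have UW : U \subset W.
  by rewrite subUset ZW andbT (subset_trans Y'Y) // (subset_trans (subD1set _ _)).
have [S sS|g [gI gP]] := @hall V e _ L (fun j => f (p j)) U uL.
  have SX : S \subset X.
    by apply/subsetP => x /sS /mapP[j jL ->]; apply/fX/plp/Ln.
  have cnt : count (fun j => f (p j) \in S) L <= \sum_(x in S) r' x.
    rewrite -(count_map (fun j => f (p j)) (mem S)) -sum_count_mem.
    apply: leq_sum => x xS; have /mapP[j jL xE] := sS x xS.
    have pp := plp j (Ln j jL); have := r'c _ pp; rewrite -xE.
    have := pD (p j); rewrite (nchild_split p K).
    suff -> : nchild p (predC K) n (p j) = count_mem x (map (fun j => f (p j)) L).
      by clear; lia.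
    rewrite count_map -(@sum_mem_count _ n L) //; apply: eq_big_nat => i in'.
    rewrite /= negbK; case: (i \in L) => //=; congr nat_of_bool.
    rewrite xE; apply/eqP/eqP => [->//|]; apply: fI => //; exact: plp.
  case: (leqP #|S| M.*2) => cS.
    apply: leq_trans cnt (leq_trans (gY' S SX cS) _).
    by rewrite subset_leq_card // setIS // subsetUl.
  apply: leq_trans (count_size _ _) _.
  have dB : [disjoint U :\: nb e S & S].
    rewrite disjoint_sym disjoint_subset; apply/subsetP => x /sS /mapP[j jL ->].
    by rewrite -topredE /=; apply/negP => /setDP[+ _]; apply/negP/fU/plp/Ln.
  have bl : blue e (U :\: nb e S) S.
    apply: blue_nonnb => //; rewrite disjoint_subset.
    by apply/subsetP => x; rewrite in_setD => /andP[].
  have MS : M <= #|S| by move: cS; clear; lia.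
  have lt : #|U :\: nb e S| < a.
    rewrite ltnNge; apply/negP => le.
    have := jW _ S (subset_trans (subsetDl _ _) UW) (subset_trans SX XW) le MS.
    by rewrite bl.
  have := cardsID (nb e S) U; rewrite setIC; move: cU lt; clear; lia.
exists (fun i => if i \in L then g i else f i); split.
- move=> i j; rewrite !inE => li lj.
  case: (boolP (i \in L)) => iL; case: (boolP (j \in L)) => jL.
  + exact: gI.
  + by move=> E; have [] := gP i iL; rewrite E (negbTE (fU j _)) // plE lj.
  + by move=> E; have [] := gP j jL; rewrite -E (negbTE (fU i _)) // plE li.
  + by apply: fI; rewrite plE ?li ?lj.
- move=> i li; case: ifP => iL; first by have [/(subsetP UW)] := gP i iL.
  by apply: (subsetP XW); apply: fX; rewrite plE li iL.
- move=> i in'; have := plp i in'; rewrite plE => /andP[lp /negbTE->].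
  case: ifP => iL; first by have [] := gP i iL.
  have [i0 li] := andP in'.
  by apply: fe; rewrite ?plp // plE li iL.
Qed.

End Trees.

Section Flatten.
Variables (J T : eqType) (s : J -> seq T).

Lemma uniq_flatten_map js : uniq js -> {in js, forall j, uniq (s j)} ->
  {in js &, forall j j' x, x \in s j -> x \in s j' -> j = j'} ->
  uniq (flatten (map s js)).
Proof.
elim: js => //= j js IH /andP[jjs ujs] us dis; rewrite cat_uniq us ?mem_head //=.
rewrite IH // ?andbT; last 2 first.
- by move=> j' jj'; apply: us; rewrite inE jj' orbT.
- by move=> j1 j2 h1 h2; apply: dis; rewrite inE ?h1 ?h2 orbT.
apply/hasPn => x /flatten_mapP[j' jj' xs]; apply: contra jjs => xj.
by rewrite (dis j j' _ _ x) // ?mem_head // inE jj' orbT.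
Qed.

Lemma uniq_flatten_mapE js : uniq (flatten (map s js)) ->
  {in js, forall j, uniq (s j)}.
Proof.
elim: js => //= j js IH; rewrite cat_uniq => /and3P[uj _ ujs] j'.
by rewrite inE => /orP[/eqP->//|]; apply: IH.
Qed.

Lemma uniq_flatten_map_eq js : uniq (flatten (map s js)) ->
  {in js &, forall j j' x, x \in s j -> x \in s j' -> j = j'}.
Proof.
elim: js => //= j js IH; rewrite cat_uniq => /and3P[_ /hasPn dj ujs] j1 j2.
rewrite !inE => /orP[/eqP->|h1] /orP[/eqP->|h2] x //; last exact: IH.
  move=> xj xj2; have /dj : x \in flatten (map s js) by apply/flatten_mapP; exists j2.
  by rewrite /= xj.
move=> xj1 xj; have /dj : x \in flatten (map s js) by apply/flatten_mapP; exists j1.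
by rewrite /= xj.
Qed.

Lemma size_flatten_map js c : {in js, forall j, size (s j) = c} ->
  size (flatten (map s js)) = size js * c.
Proof.
elim: js => //= j js IH sz; rewrite size_cat sz ?mem_head // IH ?mulSn // => j' jj'.
by apply: sz; rewrite inE jj' orbT.
Qed.

End Flatten.

Lemma path_parent (T : eqType) (p : T -> T) (R : rel T) x s :
  path (fun i j => p j == i) x s -> path R x s -> {in s, forall j, R (p j) j}.
Proof.
elim: s x => //= y s IH x /andP[/eqP py ps] /andP[Rxy Rs] j.
by rewrite inE => /orP[/eqP->|]; [rewrite py | apply: IH ps Rs j].
Qed.

(** * Replacing bare paths of the tree by routes *)

Section Paths.
Variables (V : finType) (e : rel V).
Hypothesis e_sym : symmetric e.
Implicit Types (A B E S W X Y Z T : {set V}) (r : V -> nat).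

Section Segments.
Variables (p : nat -> nat) (n : nat) (J : finType) (tp bt : J -> nat) (inn : J -> seq nat).
Variable c : nat.

(* [inn w] lists the inner vertices of a path of the tree running from [tp w]
   down to [bt w]; inner vertices have no other neighbours. *)
Definition segments := [/\
  forall w, [/\ tp w < n, size (inn w) = c, uniq (inn w) &
    path (fun i j => p j == i) (tp w) (rcons (inn w) (bt w))],
  forall w, {in rcons (inn w) (bt w), forall j, 0 < j < n},
  forall w j, 0 < j < n -> p j \in inn w -> j \in rcons (inn w) (bt w),
  forall w w' j, j \in inn w -> j \in inn w' -> w = w' &
  (forall w w', tp w \notin inn w' /\ bt w \notin inn w') /\ injective tp /\ injective bt].

Definition inner := flatten [seq inn w | w <- enum J].

Hypothesis seg : segments.

Lemma innerP i : reflect (exists w, i \in inn w) (i \in inner).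
Proof.
apply: (iffP flatten_mapP) => [[w _ iw]|[w iw]]; first by exists w.
by exists w; rewrite ?mem_enum.
Qed.

Lemma inner_uniq : uniq inner.
Proof.
case: seg => h1 _ _ dis _; apply: uniq_flatten_map; rewrite ?enum_uniq //.
- by move=> w _; have [] := h1 w.
- by move=> w w' _ _ x; apply: dis.
Qed.

Lemma inner_size : size inner = #|J| * c.
Proof.
case: seg => h1 _ _ _ _; rewrite /inner (size_flatten_map (c := c)) -?cardE //.
by move=> w _; have [] := h1 w.
Qed.

Lemma inner_lt i : i \in inner -> 0 < i < n.
Proof.
case: seg => _ h _ _ _ /innerP[w iw]; apply: (h w).
by rewrite mem_rcons inE iw orbT.
Qed.

Lemma assemble W T (f : nat -> V) (s : J -> seq V) : T \subset W ->
  {in [pred i | (i < n) && (i \notin inner)] &, injective f} ->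
  (forall i, i < n -> i \notin inner -> f i \in W :\: T) ->
  (forall i, 0 < i < n -> i \notin inner -> p i \notin inner -> e (f (p i)) (f i)) ->
  (forall w, size (s w) = c) ->
  (forall w, path e (f (tp w)) (rcons (s w) (f (bt w)))) ->
  #|T| = #|J| * c -> (forall x, x \in T -> exists w, x \in s w) -> tree_in e p n W.
Proof.
case: (seg) => hseg hlt hout dis [ends _] TW fI fW fe sz ps cT cov.
pose fl := flatten (map s (enum J)).
have sfl : size fl = #|T|.
  by rewrite cT /fl (size_flatten_map (c := c)) -?cardE // => w _; apply: sz.
have Tfl : {subset T <= fl}.
  by move=> x /cov[w xw]; apply/flatten_mapP; exists w; rewrite ?mem_enum.
have Tsub : T \subset fl by apply/subsetP => x /Tfl.
have cfl : #|T| = #|fl|.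
  by apply/eqP; rewrite eqn_leq subset_leq_card //= -sfl card_size.
have ufl : uniq fl by apply/card_uniqP; rewrite -cfl.
have eTf : T =i fl by apply/(subset_cardP cfl).
have flT x : x \in fl -> x \in T by rewrite eTf.
have sT w x : x \in s w -> x \in T.
  by move=> xw; apply: flT; apply/flatten_mapP; exists w; rewrite ?mem_enum.
have us w : uniq (s w) by apply: (uniq_flatten_mapE ufl); rewrite mem_enum.
have ds w w' x : x \in s w -> x \in s w' -> w = w'.
  by move=> h h'; apply: (uniq_flatten_map_eq ufl) h h'; rewrite mem_enum.
pose f' i := if [pick w | i \in inn w] is Some w then nth (f 0) (s w) (index i (inn w)) else f i.
have f'in w i : i \in inn w -> f' i = nth (f 0) (s w) (index i (inn w)).
  move=> iw; rewrite /f'; case: pickP => [w' iw'|/(_ w)]; last by rewrite iw.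
  by rewrite (dis _ _ _ iw iw').
have f'out i : i \notin inner -> f' i = f i.
  by move=> iL; rewrite /f'; case: pickP => // w iw; case/innerP: iL; exists w.
have tpL w : tp w \notin inner by apply/innerP => -[w']; have [/negbTE->] := ends w w'.
have btL w : bt w \notin inner by apply/innerP => -[w']; have [_ /negbTE->] := ends w w'.
have map_inn w : map f' (inn w) = s w.
  have [_ szw uw _] := hseg w.
  apply: (@eq_from_nth _ (f 0)); rewrite size_map szw ?sz // => i ic.
  by rewrite (nth_map 0) ?szw // (f'in w) ?mem_nth ?szw // index_uniq ?szw.
have edge w : {in rcons (inn w) (bt w), forall j, e (f' (p j)) (f' j)}.
  have [_ _ _ pw] := hseg w.
  apply: (path_parent (R := relpre f' e) pw); rewrite -path_map map_rcons map_inn.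
  by rewrite !f'out.
have nthT w i : i \in inn w -> f' i \in s w.
  have [_ szw _ _] := hseg w.
  by move=> iw; rewrite (f'in w) // mem_nth // sz -szw index_mem.
exists f'; split.
- move=> i j; rewrite !inE => li lj.
  case: (boolP (i \in inner)) => [/innerP[w iw]|iL];
  case: (boolP (j \in inner)) => [/innerP[w' jw]|jL].
  + move=> E; have ww : w = w' by apply: (ds _ _ (f' i)); [|rewrite E]; apply: nthT.
    move: E; rewrite -ww in jw *; rewrite (f'in w i) // (f'in w j) // => /eqP.
    have [_ szw _ _] := hseg w; rewrite nth_uniq ?sz -?szw ?index_mem ?us // => /eqP E.
    by rewrite -(nth_index 0 iw) E nth_index.
  + move=> E; have /sT := nthT _ _ iw; rewrite E f'out // => jT.
    by have /setDP[_] := fW j lj jL; rewrite jT.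
  + move=> E; have /sT := nthT _ _ jw; rewrite -E f'out // => iT.
    by have /setDP[_] := fW i li iL; rewrite iT.
  + by rewrite !f'out //; apply: fI; rewrite inE ?li ?lj.
- move=> i li; case: (boolP (i \in inner)) => [/innerP[w iw]|iL].
    by apply: (subsetP TW); apply: sT (nthT _ _ iw).
  by rewrite f'out //; have /setDP[] := fW i li iL.
- move=> i in'; case: (boolP (i \in inner)) => [/innerP[w iw]|iL].
    by apply: (edge w); rewrite mem_rcons inE iw orbT.
  case: (boolP (p i \in inner)) => [/innerP[w pw]|pL]; first exact: (edge w _ (hout _ _ in' pw)).
  by rewrite !f'out //; apply: fe.
Qed.

End Segments.
End Paths.

Lemma card_eq_enum (T J : finType) (E : {set T}) : #|E| = #|J| ->
  exists f : J -> T, [/\ injective f, forall w, f w \in E &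
    forall x, x \in E -> exists w, f w = x].
Proof.
move=> cE; exists (fun w => enum_val (cast_ord (esym cE) (enum_rank w))); split.
- by move=> w w' /enum_val_inj/cast_ord_inj/enum_rank_inj.
- by move=> w; apply: enum_valP.
- move=> x xE; exists (enum_val (cast_ord cE (enum_rank_in xE x))).
  by rewrite enum_valK cast_ordK enum_rankK_in.
Qed.

Lemma count_codom (J : finType) (T : eqType) (u : J -> T) x : injective u ->
  count (fun w => u w == x) (enum J) = (x \in codom u).
Proof. by move=> uI; rewrite count_inj ?enum_uniq ?codomE // => w w' _ _ /uI. Qed.

(** * Trees with many bare paths *)

Section CorePaths.
Variables (V : finType) (e : rel V).
Hypothesis e_sym : symmetric e.
Implicit Types (A B E S W X Y Z T R : {set V}) (r : V -> nat).

(** Hall's condition for small sets is extendability. For a large [S], the set [B] of vertices of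
    [Y] missed by [S] has fewer than [a] elements by joinedness, and by the reservoir property it
    has at least [#|B|] neighbours in [R], none of them in [S]. Since [R] and [Y] have equal size,
    [S] has at least [#|S|] neighbours in [Y]. *)
Lemma reservoir_match (J : finType) (rho : J -> V) a M X Y R r : a <= M ->
  joined e a M X -> extendable e M X Y r -> Y \subset X -> R \subset X ->
  (forall S, S \subset X -> #|S| <= M -> #|S| <= #|nb e S :&: R|) ->
  injective rho -> (forall w, rho w \in R) -> (forall w, 0 < r (rho w)) ->
  [disjoint R & Y] -> #|R| = #|J| -> #|Y| = #|J| ->
  exists g : J -> V, [/\ injective g, forall w, g w \in Y /\ e (rho w) (g w) &
    forall y, y \in Y -> exists w, g w = y].
Proof.
move=> aM jX gY YX RX rsv rhoI rhoR r0 dRY cR cY.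
have [S sS|g [gI gP]] := @hall V e J (enum J) rho Y (enum_uniq _).
  have SR : S \subset R by apply/subsetP => x /sS /mapP[w _ ->].
  have SX : S \subset X by apply: subset_trans RX.
  have cS : count (fun w => rho w \in S) (enum J) <= #|S|.
    rewrite -size_filter -(size_map rho) cardE; apply: uniq_leq_size.
      by rewrite map_inj_uniq // filter_uniq ?enum_uniq.
    by move=> x /mapP[w + ->]; rewrite mem_filter !mem_enum => /andP[].
  apply: leq_trans cS _; case: (leqP #|S| M.*2) => cS.
    apply: leq_trans (gY S SX cS); rewrite -sum1_card; apply: leq_sum => x /sS /mapP[w _ ->].
    exact: r0.
  set B := Y :\: nb e S.
  have BY : B \subset Y by apply: subsetDl.
  have dBS : [disjoint B & S].
    by apply: disjointWl BY _; rewrite disjoint_sym; apply: disjointWl SR _.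
  have bl : blue e B S.
    apply: blue_nonnb => //; rewrite disjoint_subset.
    by apply/subsetP => x; rewrite in_setD => /andP[].
  have MS : M <= #|S| by move: cS; clear; lia.
  have lt : #|B| < a.
    rewrite ltnNge; apply/negP => le.
    by have := jX _ S (subset_trans BY YX) SX le MS; rewrite bl.
  have leB := rsv B (subset_trans BY YX) (leq_trans (ltnW lt) aM).
  have dN : [disjoint nb e B :&: R & S].
    apply: disjointWl (subsetIl _ _) _; rewrite disjoint_sym disjoint_subset.
    apply/subsetP => x xS; rewrite -topredE /=; apply/negP => /nbP[y yB eyx].
    have := subsetP (subsetDr _ _ : B \subset ~: nb e S) y yB.
    by rewrite in_setC; move/negP; apply; apply/nbP; exists x; rewrite // e_sym.
  have : #|nb e B :&: R| + #|S| <= #|R|.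
    have <- : #|(nb e B :&: R) :|: S| = #|nb e B :&: R| + #|S|.
      by apply/eqP; rewrite leq_card_setU.
    by rewrite subset_leq_card // subUset subsetIr.
  by have := cardsID (nb e S) Y; rewrite setIC -/B; move: leB cR cY; clear; lia.
have gI' : injective g by move=> w w'; apply: gI; rewrite mem_enum.
have gP' w : g w \in Y /\ e (rho w) (g w) by apply: gP; rewrite mem_enum.
exists g; split=> // y yY.
have sub : [set g w | w in J] \subset Y by apply/subsetP => _ /imsetP[w _ ->]; case: (gP' w).
have : #|[set g w | w in J]| = #|Y| by rewrite card_imset.
by move/subset_cardP/(_ sub)/(_ y); rewrite yY => /imsetP[w _ ->]; exists w.
Qed.

(** The bare path [w] becomes a link from its upper end to the reservoir vertex [eps w], then
    [eps w], [gE w] and [alp (th w)], a route through the network, and a link to its lower end. The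
    last [t] free vertices are the room for all linkings; when these are finished, they are matched
    into both reservoirs. *)
Lemma core_paths Delta a M n p W d0 q1 q2 h m (tp bt : wires d0 -> nat)
    (inn : wires d0 -> seq nat) :
  0 < M -> 0 < a -> a <= M -> joined e a M W -> #|W| = n.-1 + a ->
  is_parent p n -> max_children p n Delta -> 0 < n ->
  0 < q1 -> 0 < q2 -> ~~ odd m -> q1 + q2 + h.*2 = m.*2.+1 -> M <= 2 ^ h ->
  (M * (Delta + 6)).*2 + slack q1 q2 h + 2 * M < 2 ^ d0 -> 5 * M <= 2 ^ d0 ->
  (3 * (Delta + 6) + 5) * M <= n ->
  segments p n tp bt inn (m.*2.+1 + 3 + net_len m d0 + m.*2.+1) ->
  tree_in e p n W.
Proof.
move=> M0 a0 aM jW cW pP pD n0 q10 q20 mE lm M2 tbig t5 nbig seg.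
(* The demand [Delta + 6] consists of [Delta] for the children, 1 for each of the two reservoirs,
   and 4 for the linkings and the network. *)
set D := Delta + 6 in tbig nbig; set l := m.*2.+1 in lm seg.
set c := l + 3 + _ + l in seg; set t := 2 ^ d0 in tbig t5.
have D0 : 0 < D by rewrite /D addnS.
have DM0 : 0 < D * M by rewrite muln_gt0 D0.
have MD : M * D = D * M by rewrite mulnC.
have nbig' : 3 * (D * M) + 5 * M <= n by rewrite mulnA -mulnDl.
have cJ : #|wires d0| = t by apply: card_wires.
have innL := inner_lt seg; have cinn := inner_size seg; have uinn := inner_uniq seg.
rewrite cJ in cinn.
pose K := [pred i | i \notin inner inn].
have nkI : nkept (predC K) n = t * c.
  rewrite -cinn -(count_predT (inner inn)) -(@sum_mem_count predT n) //.
  by apply: eq_bigr => j _; rewrite /= negbK andbT.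
have nk : nkept K n + t * c = n.-1 by rewrite -nkI nkept_split.
have tc : t * c = t * l + t * 3 + t * net_len m d0 + t * l by rewrite /c !mulnDr.
have coW := joined_codense e_sym jW (subxx W).
have [|Z [ZW ZM Zbad gX _]] := @trim V e W M D (3 * (D * M)) M0 D0 (leqnn _).
  move=> A AW cA; have := coW A AW (eq_leq (esym cA)).
  rewrite -(leq_add2l #|nb e A :&: W|) setIC cardsID cW.
  by move: M0 nbig' aM; clear; lia.
set X := W :\: Z in gX Zbad.
have XW : X \subset W by apply: subsetDl.
have cX : #|X| + #|Z| = #|W| by rewrite -(cardsID Z W) (setIidPr ZW) addnC.
(* With [a] or more vertices, [Z] would be adjacent to all but fewer than [M] vertices of [X],
   whereas it has at most [D * M] neighbours there. Hence [X] keeps at least [n] vertices. *)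
have Zlt : #|Z| < a.
  rewrite ltnNge; apply/negP => le; set B := X :\: nb e Z.
  have bl : blue e Z B.
    apply/(blue_sym e_sym)/blue_nonnb => //; rewrite disjoint_subset.
      by apply/subsetP => x /setDP[/setDP[]].
    by apply/subsetP => x; rewrite in_setD => /andP[].
  have cB : #|B| < M.
    rewrite ltnNge; apply/negP => leB; have := jW Z B ZW _ le leB.
    by rewrite bl (subset_trans (subsetDl _ _)) // => /(_ isT).
  have := cardsID (nb e Z) X; rewrite setIC -/B.
  have : D * #|Z| <= D * M by rewrite leq_mul2l ltnW ?orbT.
  by move: Zbad cB cX cW nbig' ZM; clear; lia.
have coX Y : Y \subset X -> codense e M X Y (2 * M).
  move=> YX S SX MS; apply: leq_trans (codenseS coW (subset_trans YX XW) (subset_trans SX XW)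
    MS) _.
  by rewrite mul2n -addnn leq_add2r.
have MX : M <= #|X| by move: cX cW ZM nbig'; clear; lia.
have roomyX k Y : Y \subset X -> (D * M).*2 + k + 2 * M <= #|Y| -> roomy e M D X Y k.
  by move=> YX le; apply: (codense_roomy (coX Y YX)); rewrite MD.
have jX : joined e a M X.
  by move=> A B AX BX; apply: jW; apply: subset_trans XW.
have jXM : joined e M M X.
  by move=> A B AX BX cA; apply: jX => //; apply: leq_trans cA.
rewrite MD in tbig.
have nX : n <= #|X| by move: cX cW Zlt n0; clear; lia.
(* Exactly [n] vertices are kept, so that forest, reservoirs, links and network leave exactly the
   [t] vertices that the matchings need. *)
have [||Pg [PgX cPg g1]] := @extendable_picks V e M D X X (fun=> D) (#|X| - n) gX _ _ MX.
- by [].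
- by apply: roomyX => //; move: nX nbig'; clear; lia.
set Y1 := X :\: Pg in g1.
have Y1X : Y1 \subset X by apply: subsetDl.
have cY1 : #|Y1| = n by rewrite /Y1 cardsDS // cPg; move: nX; clear; lia.
have tn : t * 3 < n by move: nk tc n0; clear; lia.
have [|||E [r1 [EY1 cE g2 r1b Ersv]]] :=
  @reservoir V e M D X Y1 (fun=> D) t g1 _ _ MX t5 (coX _ Y1X).
- by [].
- by apply: roomyX => //; rewrite cY1; move: tbig tn; clear; lia.
- by [].
set Y2 := Y1 :\: E in g2.
have Y2X : Y2 \subset X by rewrite (subset_trans (subsetDl _ _)).
have cY2 : #|Y2| = n - t by rewrite /Y2 cardsDS // cE cY1.
have r1D x : Delta + 5 <= r1 x <= D.
  by have := r1b x; rewrite /D; clear; lia.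
have [|||A [r2 [AY2 cA g3 r2b Arsv]]] :=
  @reservoir V e M D X Y2 r1 t g2 _ _ MX t5 (coX _ Y2X).
- by move=> x; have /andP[] := r1D x.
- by apply: roomyX => //; rewrite cY2; move: tbig tn; clear; lia.
- by move=> x _; have := r1D x; clear; lia.
set Y3 := Y2 :\: A in g3.
have Y3X : Y3 \subset X by rewrite (subset_trans (subsetDl _ _)).
have cY3 : #|Y3| = n - t - t by rewrite /Y3 cardsDS // cA cY2.
have r2D x : Delta + 4 <= r2 x <= D.
  by have := r2b x; have := r1D x; clear; lia.
have r2D' x : r2 x <= D by have /andP[] := r2D x.
have [|u uY3 g3'] := @extendable_pick V e M D X Y3 r2 0 g3 r2D' _ MX.
  by apply: roomyX => //; rewrite cY3; move: tbig nk tc; clear; lia.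
have cY3u : #|Y3 :\ u| + 1 = #|Y3| by rewrite (cardsD1 u Y3) uY3 addnC.
have [||||i||f [Y4 [r3 [[f0 fI fY fe] [Y4Y cY4 g4 r3r] r3n r3c]]]] :=
  @embed V e M D p K u X (Y3 :\ u) r2 Delta n g3' r2D' _ (subset_trans (subD1set _ _) Y3X) MX
    (subsetP Y3X _ uY3) _ n0.
- apply: roomyX; first exact: subset_trans (subD1set _ _) Y3X.
  by move: cY3 cY3u nk tc tbig tn; clear; lia.
- by rewrite !inE eqxx.
- exact: pP.
- by move=> y _; apply: leq_trans (leq_addr _ _) (proj1 (andP (r2D y))).
- by apply: leq_trans (pD i); rewrite (nchild_split p K) leq_addr.
- have := pD 0; rewrite (nchild_split p K); have /andP[+ _] := r2D u.
  by clear; lia.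
have L0 : 0 \notin inner inn by apply/negP => /innL.
have plE i : (i \in placed K n) = (i < n) && (i \notin inner inn).
  by rewrite inE /=; case: eqP => // ->; rewrite L0.
have Y4Y3 : Y4 \subset Y3 by rewrite (subset_trans Y4Y) ?subD1set.
have Y4X : Y4 \subset X by apply: subset_trans Y3X.
have fY3 i : i \in placed K n -> f i \in Y3.
  case: (posnP i) => [-> _|i0 ip]; first by rewrite f0.
  by have /setDP[/setD1P[]] := fY i ip i0.
have fY4 i : i \in placed K n -> f i \notin Y4.
  case: (posnP i) => [-> _|i0 ip]; last by have /setDP[] := fY i ip i0.
  by rewrite f0; apply/negP => /(subsetP Y4Y); rewrite !inE eqxx.
have cY4' : #|Y4| + t * 2 = t * c by move: cY4 cY3u cY3 nk tn; clear; lia.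
have EX : E \subset X by apply: subset_trans EY1 Y1X.
have AX : A \subset X by apply: subset_trans AY2 Y2X.
have EY3 x : x \in E -> x \notin Y3 by move=> xE; rewrite !inE xE !andbF.
have AY3 x : x \in A -> x \notin Y3 by move=> xA; rewrite !inE xA.
have AE x : x \in A -> x \notin E by move/(subsetP AY2); rewrite !inE => /andP[].
have nY4 x : x \notin Y3 -> x \notin Y4 by apply: contra; apply: subsetP.
have [|eps [epsI epsE epsS]] := @card_eq_enum V (wires d0) E; first by rewrite cJ.
have [|alp [alpI alpA alpS]] := @card_eq_enum V (wires d0) A; first by rewrite cJ.
have [_ _ _ _ [ends [tpI btI]]] := seg.
have plt w : tp w \in placed K n.
  rewrite plE; case: seg => /(_ w)[-> _ _ _] _ _ _ _ /=.
  by apply/(innerP inn) => -[w']; have [/negbTE->] := ends w w'.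
have plb w : bt w \in placed K n.
  rewrite plE; case: seg => _ /(_ w (bt w)) h1 _ _ _; rewrite mem_rcons mem_head in h1.
  have /andP[_ ->] := h1 isT; apply/(innerP inn) => -[w'].
  by have [_ /negbTE->] := ends w w'.
have ftI : injective (f \o tp) by move=> w w' /fI E0; apply/tpI/E0.
have fbI : injective (f \o bt) by move=> w w' /fI E0; apply/btI/E0.
have r3Y3 x : x \notin Y3 -> r3 x = r2 x.
  by move=> xY; apply: r3n => i ip xE; rewrite xE fY3 in xY.
have r3Y4 x : x \in Y4 -> r3 x = r2 x.
  by move=> xY; apply: r3n => i ip xE; have := fY4 i ip; rewrite -xE xY.
have r3f i : i \in placed K n -> 4 <= r3 (f i).
  move=> ip; have := r3c i ip; have /andP[+ _] := r2D (f i).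
  have := pD i; rewrite (nchild_split p K); clear; lia.
have r3D x : r3 x <= D by apply: leq_trans (r3r x) (r2D' x).
have fne i x : i \in placed K n -> x \notin Y3 -> (f i == x) = false.
  by move=> /fY3 fi; apply: contraNF => /eqP<-.
have fne4 i x : i \in placed K n -> x \in Y4 -> x == f i = false.
  by move=> /fY4 fi; apply: contraTF => /eqP->.
have cft x : x \notin Y3 -> x \in codom (f \o tp) = false.
  by move=> xY; apply/negP => /codomP[w xE]; rewrite xE fY3 in xY.
have cfb x : x \notin Y3 -> x \in codom (f \o bt) = false.
  by move=> xY; apply/negP => /codomP[w xE]; rewrite xE fY3 in xY.
have cft4 x : x \in Y4 -> x \in codom (f \o tp) = false.
  by move=> xY; apply/negP => /codomP[w xE]; have := fY4 _ (plt w); rewrite -[f _]xE xY.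
have cfb4 x : x \in Y4 -> x \in codom (f \o bt) = false.
  by move=> xY; apply/negP => /codomP[w xE]; have := fY4 _ (plb w); rewrite -[f _]xE xY.
have ceps x : x \notin E -> x \in codom eps = false.
  by move=> xE; apply/negP => /codomP[w xw]; rewrite xw epsE in xE.
have calp x : x \notin A -> x \in codom alp = false.
  by move=> xA; apply/negP => /codomP[w xw]; rewrite xw alpA in xA.
have Y3E x : x \in Y3 -> x \notin E by rewrite !inE => /and3P[].
have Y3A x : x \in Y3 -> x \notin A by rewrite !inE => /and3P[].
have slk : slack q1 q2 h = q1 + q2 + 2 ^ h.+2 by [].
have szw : size (enum (wires d0)) = t by rewrite -cardE cJ.
have [|w _|x xY|y yY|s1 [U1 [r4 [[sz1 ps1 _ _] U1E [U1Y cU1 g5 r4r] r4c]]]] :=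
  @link_many V e M D e_sym _ (enum (wires d0)) (f \o tp) eps X Y4 r3 q1 q2 h g4 r3D _ Y4X MX jXM
    M2
    (enum_uniq _) _ q10 q20.
- by apply: roomyX => //; rewrite szw lm -slk; move: cY4' tc tbig; clear; lia.
- split; first by apply/setDP; split; [apply/(subsetP Y3X)/fY3 | apply: fY4].
    by apply/setDP; split; [apply/(subsetP EX)/epsE | apply/nY4/EY3].
  by rewrite /= fne ?EY3.
- rewrite !count_codom //; case: (boolP (x \in codom (f \o tp))) => [/codomP[w ->]|_].
    by apply: leq_trans (ltnW (r3f _ (plt w))); case: (_ \in codom _).
  case: (boolP (x \in codom eps)) => // /codomP[w ->].
  by rewrite r3Y3 ?EY3 //; have := r2D (eps w); clear; lia.
- by rewrite r3Y4 //; have := r2D y; clear; lia.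
rewrite szw lm in cU1; rewrite lm in sz1.
have r4c' x : r3 x <= r4 x + ((x \in codom (f \o tp)) + (x \in codom eps)) + (x \in U1).
  by apply: leq_trans (r4c x) _; rewrite !count_codom.
have r4D x : r4 x <= D by apply: leq_trans (r4r x) (r3D x).
set Y5 := Y4 :\: U1 in g5.
have Y5Y4 : Y5 \subset Y4 by apply: subsetDl.
have Y5X : Y5 \subset X by apply: subset_trans Y4X.
have cY5 : #|Y5| = #|Y4| - t * l by rewrite /Y5 cardsDS // cU1.
have nU1 x : x \notin Y4 -> x \in U1 = false by apply: contraNF; apply: subsetP.
have [|w|w|y yY|o [I [r5 [[IY cI g6 r5r] [oI oP] r5c rt]]]] :=
  @benes V e M D e_sym q1 q2 h m q10 q20 mE lm M2 d0 alp X Y5 r4 g5 r4D _ Y5X MX jXM alpI.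
- by apply: roomyX => //; rewrite cY5; move: cY4' tc tbig; clear; lia.
- apply/setDP; split; first exact: (subsetP AX _ (alpA w)).
  by apply: (contra (subsetP Y5Y4 _)); apply/nY4/AY3/alpA.
- have := r4c' (alp w); rewrite cft ?AY3 // ceps ?AE // nU1 ?nY4 ?AY3 //.
  by rewrite r3Y3 ?AY3 //; have := r2D (alp w); clear; lia.
- move: yY; rewrite inE => /andP[yU yY4]; have := r4c' y.
  rewrite cft4 // ceps ?Y3E ?(subsetP Y4Y3) // (negbTE yU) r3Y4 //.
  by have := r2D y; clear; lia.
set Y6 := Y5 :\: I in g6 oP.
have Y6Y5 : Y6 \subset Y5 by apply: subsetDl.
have Y6X : Y6 \subset X by apply: subset_trans Y5X.
have cY6 : #|Y6| = #|Y5| - t * net_len m d0 by rewrite /Y6 cardsDS // cI.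
have IY4 : I \subset Y4 by apply: subset_trans Y5Y4.
have nI x : x \notin Y4 -> x \notin I by apply: contra; apply: subsetP.
have r5D x : r5 x <= D by apply: leq_trans (r5r x) (r4D x).
have oYA w : (o w \in Y4) || (o w \in A).
  have [+ _ _] := oP w; rewrite !inE => /orP[/(subsetP IY4)->//|/codomP[w' ->]].
  by rewrite alpA orbT.
have of_ w i : i \in placed K n -> (o w == f i) = false.
  move=> ip; case/orP: (oYA w) => [oY|oA]; first exact: fne4.
  by rewrite eq_sym fne // AY3.
have ceo w : o w \in codom eps = false.
  apply: ceps; case/orP: (oYA w) => [oY|/AE//]; apply/Y3E/(subsetP Y4Y3 _ oY).
have r4f i : i \in placed K n -> 2 <= r4 (f i).
  move=> ip; have := r4c' (f i); rewrite ceps ?Y3E ?fY3 // nU1 ?fY4 //.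
  by have := r3f i ip; case: (_ \in codom _); clear; lia.
have [|w _|x xY|y yY|s3 [U3 [r6 [[sz3 ps3 _ _] U3E [U3Y cU3 g7 r6r] r6c]]]] :=
  @link_many V e M D e_sym _ (enum (wires d0)) o (f \o bt) X Y6 r5 q1 q2 h g6 r5D _ Y6X MX jXM M2
    (enum_uniq _) _ q10 q20.
- by apply: roomyX => //; rewrite szw lm -slk cY6 cY5; move: cY4' tc tbig; clear; lia.
- have [_ oX _] := oP w; split=> //; last by rewrite /= of_.
  apply/setDP; split; first exact: (subsetP Y3X _ (fY3 _ (plb w))).
  by apply: contra (fY4 _ (plb w)) => /(subsetP Y6Y5); apply: subsetP.
- rewrite !count_codom //; case: (boolP (x \in codom o)) => [/codomP[w ->]|_].
    by have [_ _ /ltnW] := oP w; apply: leq_trans; case: (_ \in codom _).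
  case: (boolP (x \in codom (f \o bt))) => // /codomP[w ->] /=.
  have := r5c _ (nI _ (fY4 _ (plb w))); rewrite calp ?Y3A ?fY3 //.
  by have := r4f _ (plb w); clear; lia.
- move: yY; rewrite inE => /andP[yI yY5]; have yY4 := subsetP Y5Y4 _ yY5.
  have := r5c y yI; rewrite calp ?Y3A ?(subsetP Y4Y3) //.
  move: yY5; rewrite inE => /andP[yU _]; have := r4c' y.
  rewrite cft4 // ceps ?Y3E ?(subsetP Y4Y3) // (negbTE yU) r3Y4 //.
  by have := r2D y; clear; lia.
rewrite szw lm in cU3; rewrite lm in sz3.
set Y7 := Y6 :\: U3 in g7.
have Y7Y6 : Y7 \subset Y6 by apply: subsetDl.
have Y7Y4 : Y7 \subset Y4 by rewrite !(subset_trans (subsetDl _ _)).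
have Y7X : Y7 \subset X by apply: subset_trans Y4X.
have cY7 : #|Y7| = t.
  by rewrite /Y7 cardsDS // cU3 cY6 cY5; move: cY4' tc; clear; lia.
have r6c' x : x \notin Y4 -> r5 x <= r6 x + ((x \in codom o) + (x \in codom (f \o bt))).
  move=> xY; have := r6c x; rewrite !count_codom //.
  have -> : x \in U3 = false by apply: contraNF xY => /(subsetP U3Y)/(subsetP Y6Y5);
    apply: subsetP.
  by rewrite addn0.
have dY4 R : (forall x, x \in R -> x \notin Y3) -> [disjoint R & Y4].
  by move=> RY; rewrite disjoint_subset; apply/subsetP => x /RY/nY4.
have [w||||gE [gEI gEP gES]] := @reservoir_match _ eps a M X Y7 E r6 aM jX g7 Y7X EX Ersv epsI
  epsE.
- have xY := EY3 _ (epsE w); have := r6c' _ (nY4 _ xY); rewrite cfb //.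
  have -> : eps w \in codom o = false.
    by apply/negP => /codomP[w' ew]; have := ceo w'; rewrite -ew codom_f.
  have := r5c _ (nI _ (nY4 _ xY)); rewrite calp; last by apply: contraL (epsE w); apply: AE.
  have := r4c' (eps w); rewrite cft // nU1 ?nY4 // r3Y3 // codom_f.
  by have := r2D (eps w); clear; lia.
- by apply: disjointWr Y7Y4 (dY4 _ EY3).
- by rewrite cJ.
- by rewrite cJ.
have [w||||gA [gAI gAP gAS]] := @reservoir_match _ alp a M X Y7 A r6 aM jX g7 Y7X AX Arsv alpI
  alpA.
- have xY := AY3 _ (alpA w); have := r6c' _ (nY4 _ xY); rewrite cfb //.
  have := r5c _ (nI _ (nY4 _ xY)); rewrite codom_f.
  have := r4c' (alp w); rewrite cft // nU1 ?nY4 // r3Y3 // ceps ?AE //.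
  by have := r2D (alp w); case: (_ \in codom o); clear; lia.
- by apply: disjointWr Y7Y4 (dY4 _ AY3).
- by rewrite cJ.
- by rewrite cJ.
(* The last vertices link the two reservoirs by an uncontrolled permutation [th]; the network is set
   to its inverse, so that the input [th w] leads to the output [o w]. *)
have thP w : exists w', gA w' = gE w by apply: gAS; case: (gEP w).
have [th thE] := fin_all_exists thP.
have thI : injective th by move=> w w' E0; apply: gEI; rewrite -!thE E0.
have [th' thK thK'] := injF_bij thI.
have [s2 [s2P s2c]] := rt th' (can_inj thK').
pose s w := s1 w ++ [:: eps w; gE w; alp (th w)] ++ s2 (th w) ++ s3 w.
have me (w : wires d0) : w \in enum (wires d0) by rewrite mem_enum.
apply: (@assemble V e p n (wires d0) tp bt inn c seg W (Y4 :|: E :|: A) f s).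
- by rewrite !subUset !(fun B h => subset_trans h XW : B \subset W).
- by move=> i j; rewrite !inE => /andP[li iL] /andP[lj jL]; apply: fI; rewrite plE ?li ?lj.
- move=> i li iL; have ip : i \in placed K n by rewrite plE li.
  rewrite in_setD (subsetP XW) ?(subsetP Y3X) ?fY3 // !inE !negb_or fY4 //.
  by have := fY3 i ip; rewrite !inE => /and3P[-> ->].
- move=> i /andP[i0 li] iL pL; apply: fe => //; rewrite plE ?li //.
  by rewrite pL (ltn_trans (pP i _) li) // i0.
- move=> w; have [sz2 _ _] := s2P (th w).
  by rewrite /s !size_cat sz1 // sz2 sz3 //= /c; clear; lia.
- move=> w; have [_ p2 l2] := s2P (th w); rewrite thK in l2.
  have := ps1 w (me w); rewrite rcons_path /= => /andP[p1 e1].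
  have [_ e2] := gEP w; have [_ e3] := gAP (th w); rewrite thE in e3.
  rewrite /s !rcons_cat cat_path p1 /= e1 e2 [e (gE w) _]e_sym e3 cat_path p2 l2.
  exact: (ps3 w (me w)).
- have -> : #|Y4 :|: E :|: A| = #|Y4 :|: E| + #|A|.
    apply/eqP; rewrite leq_card_setU disjoint_sym disjoint_subset; apply/subsetP => x xA.
    by rewrite -topredE /= in_setU negb_or nY4 ?AY3 // AE.
  have -> : #|Y4 :|: E| = #|Y4| + #|E|.
    by apply/eqP; rewrite leq_card_setU disjoint_sym dY4.
  by rewrite cE cA cJ; move: cY4'; clear; lia.
- move=> x; rewrite !in_setU => /orP[/orP[xY4|/epsS[w <-]]|/alpS[w <-]].
  + case: (boolP (x \in U1)) => [|xU1].
      rewrite U1E => /hasP[w _ xw]; exists w; by rewrite !mem_cat xw.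
    case: (boolP (x \in I)) => [/s2c[w xw]|xI].
      by exists (th' w); rewrite !mem_cat thK' xw !orbT.
    case: (boolP (x \in U3)) => [|xU3].
      rewrite U3E => /hasP[w _ xw]; exists w; by rewrite !mem_cat xw !orbT.
    have /gES[w <-] : x \in Y7 by rewrite !in_setD xU3 xI xU1.
    by exists w; rewrite !mem_cat !inE eqxx !orbT.
  + by exists w; rewrite !mem_cat !inE eqxx !orbT.
  + by exists (th' w); rewrite !mem_cat !inE thK' eqxx !orbT.
Qed.

End CorePaths.

(** * Bare paths in trees with few leaves *)

Section BarePaths.
Variables (p : nat -> nat) (n : nat).
Hypotheses (pP : is_parent p n) (n_gt1 : 1 < n).

Notation nc := (nchild p predT n).

Definition unary i := (0 < i < n) && (nc i == 1).

Lemma nchild0P i : nc i = 0 -> forall j, 0 < j < n -> p j != i.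
Proof.
move/eqP; rewrite /nchild sum_nat_seq_eq0 => /allP h j jn.
by have := h j; rewrite mem_index_iota jn /= eqb0 => /(_ isT).
Qed.

Lemma unary_child i : unary i -> exists2 j, 0 < j < n & p j = i.
Proof.
case/andP=> _ /eqP c1; case: (boolP (has (fun j => p j == i) (index_iota 1 n))).
  by move/hasP => [j]; rewrite mem_index_iota => jn /eqP; exists j.
move/hasPn => h; move: c1; rewrite /nchild big1_seq // => j /andP[_ jn].
by rewrite (negbTE (h j jn)).
Qed.

Lemma unary_inj i j j' : unary i -> 0 < j < n -> 0 < j' < n -> p j = i -> p j' = i -> j = j'.
Proof.
case/andP=> _ /eqP c1 jn j'n pj pj'; apply/eqP/negPn/negP => ne; move: c1.
rewrite /nchild (bigD1_seq j) ?mem_index_iota ?iota_uniq //= pj eqxx.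
by rewrite big_mkcond (bigD1_seq j') ?mem_index_iota ?iota_uniq //= eq_sym ne pj' eqxx.
Qed.

Lemma sum_nchild : \sum_(0 <= i < n) nc i = n.-1.
Proof.
rewrite /nchild exchange_big /= (eq_big_nat _ _ (F2 := fun=> 1)).
  by rewrite big_const_nat iter_addn_0 mul1n subn1.
move=> j jn; have lt : p j < n by apply: ltn_trans (pP jn) _; case/andP: jn.
rewrite (bigD1_seq (p j)) ?mem_index_iota ?iota_uniq //= eqxx big1 // => i.
by rewrite eq_sym => /negbTE->.
Qed.

Definition leaves := [seq i <- index_iota 1 n | nc i == 0].

Lemma count_nonunary : count (predC unary) (iota 0 n) <= 2 * size leaves.
Proof.
have nc0 : 0 < nc 0.
  rewrite lt0n; apply/negP => /eqP/nchild0P/(_ 1); rewrite n_gt1 => /(_ isT).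
  by have := pP (i := 1); rewrite n_gt1 => /(_ isT); rewrite ltnS leqn0 => ->.
have szl : size leaves = \sum_(0 <= i < n) (nc i == 0).
  rewrite size_filter -sum1_count big_mkcond /= [RHS]big_ltn ?(ltnW n_gt1) //.
  by rewrite eqn0Ngt nc0 add0n; apply: eq_bigr => i _; case: ifP.
have br : n + \sum_(0 <= i < n) (2 <= nc i) <= n.-1 + size leaves.
  rewrite szl -sum_nchild -{1}[n]muln1 -{1}(subn0 n) -sum_nat_const_nat -!big_split /=.
  by apply: leq_sum => i _; case: (nc i) => [|[|k]].
have bd : count (predC unary) (iota 0 n) <=
    \sum_(0 <= i < n) ((i == 0) + (nc i == 0) + (2 <= nc i)).
  rewrite -sum1_count big_mkcond /= /index_iota subn0.
  rewrite !big_seq; apply: leq_sum => i; rewrite mem_iota add0n /unary => /andP[_ ->].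
  by case: i => // i; rewrite andbT /=; case: (nc _) => [|[|k]].
apply: leq_trans bd _; rewrite !big_split /= -szl.
have -> : \sum_(0 <= i < n) (i == 0) = 1.
  by rewrite big_ltn ?(ltnW n_gt1) // big1_seq // => -[|i] //; rewrite mem_index_iota.
by move: br n_gt1; move: (\sum_(_ <= _ < _) _) (size leaves) => b k; clear; lia.
Qed.

Fixpoint height_rec f i := if f is f'.+1 then if unary i then (height_rec f' (p i)).+1 else 0
  else 0.

Lemma height_recE f f' i : i < f -> i < f' -> height_rec f i = height_rec f' i.
Proof.
elim: f f' i => // f IH [|f'] //= i lf lf'; case: ifP => // /andP[ui _].
by congr _.+1; apply: IH; apply: leq_trans (pP ui) _.
Qed.

(* The number of unary vertices met when climbing from [i] before the first
   vertex that is not unary. *)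
Definition height i := height_rec i.+1 i.

Lemma heightE i : height i = if unary i then (height (p i)).+1 else 0.
Proof.
rewrite {1}/height /=; case: ifP => // /andP[ui _]; congr _.+1.
by apply: height_recE => //; apply: pP.
Qed.

Variable s : nat.
Hypothesis s_gt0 : 0 < s.

(** Every maximal chain of unary vertices is cut, from its top, into blocks of [s] vertices, of
    which these are the lowest ones. An incomplete block at the lower end has none. *)
Definition bottom z := unary z && (s %| height z).

Lemma bottom_iter z a : bottom z -> a < s ->
  unary (iter a p z) /\ height (iter a p z) + a = height z.
Proof.
case/andP=> uz /dvdnP[k hz]; have h0 : s <= height z.
  by move: hz; rewrite heightE uz; case: k => // k ->; rewrite mulSn leq_addr.
elim: a => [|a IH] las; first by rewrite addn0.
have [ua ha] := IH (ltnW las); rewrite iterS.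
have := heightE (iter a p z); rewrite ua => hE.
split; last by rewrite -ha hE addSnnS.
have : 0 < height (p (iter a p z)) by move: ha hE h0 las; clear; lia.
by rewrite heightE; case: ifP.
Qed.

(** The height of the common vertex determines the number of steps modulo [s]. The two climbs then
    agree all the way down, because a unary vertex has only one child. *)
Lemma bottom_inj z z' a b : bottom z -> bottom z' -> a < s -> b < s ->
  iter a p z = iter b p z' -> z = z' /\ a = b.
Proof.
move=> bz bz' las lbs E.
have [_ ha] := bottom_iter bz las; have [_ hb] := bottom_iter bz' lbs.
have ab : a = b.
  case/andP: bz => _ /dvdnP[k hk]; case/andP: bz' => _ /dvdnP[k' hk'].
  move: ha hb; rewrite E hk hk'; move: (height _) las lbs; clear => H las lbs h1 h2.
  have : a + k' * s = b + k * s by lia.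
  move/(congr1 (modn^~ s)); rewrite ![_ + _ * s]addnC !modnMDl !modn_small //.
rewrite -ab in E *; split=> //; clear ha hb ab lbs.
elim: a las E => // a IH las; rewrite !iterS => E.
have [ua _] := bottom_iter bz las; rewrite iterS in ua.
have [/andP[un _] _] := bottom_iter bz (ltnW las).
have [/andP[un' _] _] := bottom_iter bz' (ltnW las).
by apply: IH (ltnW las) (unary_inj ua un un' _ _).
Qed.

(** Descending along only children leads to the lowest vertex of the block, or out of the chain if
    the block is incomplete. *)
Lemma unary_below i : unary i -> exists z a, [/\ a < s, iter a p z = i & bottom z || (z < n) &&
  ~~ unary z].
Proof.
pose d := (s - height i %% s) %% s; move=> ui.
suff : forall d i, unary i -> s %| height i + d -> d < s ->
    exists z a, [/\ a <= d, iter a p z = i & bottom z || (z < n) && ~~ unary z].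
  move/(_ d i ui) => -[||z [a [ad E h]]].
  - rewrite /dvdn modnDmr; have := ltn_pmod (height i) s_gt0.
    by rewrite -modnDml => lt; rewrite subnKC ?modnn // ltnW.
  - by rewrite ltn_mod.
  - by exists z, a; split=> //; apply: leq_ltn_trans ad _; rewrite ltn_mod.
clear d ui i => d; elim: d => [|d IH] i ui; rewrite ?addn0 => sd ld.
  by exists i, 0; rewrite /bottom ui sd.
have [j jn pj] := unary_child ui.
case: (boolP (unary j)) => uj; last first.
  by exists j, 1; rewrite /= pj uj; case/andP: jn => _ ->; rewrite orbT.
have [||z [a [ad E h]]] := IH j uj.
- by rewrite heightE uj pj addSnnS.
- exact: ltnW.
- by exists z, a.+1; rewrite iterS E pj; split.
Qed.

Lemma count_bottoms : n <= 2 * size leaves + s * (count bottom (iota 0 n) + 2 * size leaves).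
Proof.
have cu := count_nonunary.
pose Z := [seq z <- iota 0 n | bottom z || ~~ unary z].
have cZ : size Z <= count bottom (iota 0 n) + count (predC unary) (iota 0 n).
  by rewrite size_filter -count_predUI leq_addr.
have : count unary (iota 0 n) <= s * size Z.
  rewrite -size_filter -(size_iota 0 s) -(size_allpairs (fun a z => iter a p z)).
  apply: uniq_leq_size; first by rewrite filter_uniq ?iota_uniq.
  move=> i; rewrite mem_filter => /andP[/unary_below[z [a [las <- h]]] _].
  apply/allpairsP; exists (a, z); split=> //=; first by rewrite mem_iota.
  rewrite mem_filter mem_iota; case/orP: h => [bz|/andP[-> ->]]; last by rewrite orbT.
  by rewrite bz; case/andP: bz => /andP[/andP[_ ->]].
have := count_predC unary (iota 0 n); rewrite size_iota.
have : s * size Z <= s * (count bottom (iota 0 n) + count (predC unary) (iota 0 n)).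
  by rewrite leq_mul2l cZ orbT.
have : s * (count bottom (iota 0 n) + count (predC unary) (iota 0 n)) <=
       s * (count bottom (iota 0 n) + 2 * size leaves).
  by rewrite leq_mul2l leq_add2l cu orbT.
by move: cu; clear; lia.
Qed.

End BarePaths.

Lemma climb_path (p : nat -> nat) z k :
  path (fun i j => p j == i) (iter k p z) (rev [seq iter a p z | a <- iota 0 k]).
Proof.
elim: k => // k IH; have -> : iota 0 k.+1 = rcons (iota 0 k) k.
  by rewrite -addn1 iotaD cats1.
by rewrite map_rcons rev_rcons /= eqxx.
Qed.

(** With fewer than [#|J|] leaves, [count_bottoms] gives at least [#|J|] blocks of [c + 2] unary
    vertices; a block consists of the two ends of a segment and its [c] inner vertices. *)
Lemma leaves_or_segments (J : finType) p n c : is_parent p n -> 1 < n ->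
  2 * #|J| + (c + 2) * (3 * #|J|) < n ->
  (exists L, [/\ uniq L, {in L, forall j, 0 < j < n},
     {in L, forall j i, 0 < i < n -> p i != j} & #|J| <= size L]) \/
  exists tp bt (inn : J -> seq nat), segments p n tp bt inn c.
Proof.
move=> pP n1 nbig; case: (leqP #|J| (size (leaves p n))) => lJ.
  left; exists (leaves p n); split=> //; first by rewrite filter_uniq ?iota_uniq.
    by move=> j; rewrite mem_filter mem_index_iota => /andP[].
  by move=> j; rewrite mem_filter => /andP[/eqP/nchild0P].
right; pose s := c + 2; have s0 : 0 < s by rewrite /s addn2.
pose bots := filter (bottom p n s) (iota 0 n).
have Jb : #|J| <= size bots.
  rewrite size_filter leqNgt; apply/negP => lt; have := count_bottoms pP n1 s0.
  have : s * (count (bottom p n s) (iota 0 n) + 2 * size (leaves p n)) <= s * (3 * #|J|).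
    by rewrite leq_mul2l; apply/orP; right; move: lt lJ; clear; lia.
  by move: nbig lJ; rewrite -/s; clear; lia.
pose z (w : J) := nth 0 bots (enum_rank w).
have lz (w : J) : enum_rank w < size bots by apply: leq_trans Jb.
have zB w : bottom p n s (z w).
  by have := mem_nth 0 (lz w); rewrite -/(z w) mem_filter => /andP[].
have zI : injective z.
  move=> w w' /eqP; rewrite nth_uniq ?filter_uniq ?iota_uniq ?lz //.
  by move/eqP/val_inj/enum_rank_inj.
pose inn w := rev [seq iter a p (z w) | a <- iota 1 c].
have innE w j : j \in inn w -> exists2 a, 0 < a < s.-1 & j = iter a p (z w).
  rewrite mem_rev => /mapP[a]; rewrite mem_iota => an ->; exists a => //.
  by move: an; rewrite /s; clear; lia.
have s1 : s.-1 < s by rewrite prednK.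
have rE w : rcons (inn w) (z w) = rev [seq iter a p (z w) | a <- iota 0 s.-1].
  by rewrite /s addn2 /= rev_cons.
have rin w j : j \in rcons (inn w) (z w) -> exists2 a, a < s.-1 & j = iter a p (z w).
  by rewrite rE mem_rev => /mapP[a]; rewrite mem_iota => /andP[_ las] ->; exists a.
exists (fun w => iter s.-1 p (z w)), z, inn; split.
- move=> w; split.
  + by have [/andP[/andP[_ ->]]] := bottom_iter pP (zB w) s1.
  + by rewrite size_rev size_map size_iota.
  + rewrite rev_uniq map_inj_in_uniq ?iota_uniq // => a b.
    rewrite !mem_iota => an bn /(bottom_inj pP (zB w) (zB w))[||//];
    by move: an bn; rewrite /s; clear; lia.
  + by rewrite rE; apply: climb_path.
- move=> w j /rin[a las ->].
  by have [/andP[]] := bottom_iter pP (zB w) (ltn_trans las s1).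
- move=> w j jn /innE[a /andP[a0 las] pj].
  have [ua _] := bottom_iter pP (zB w) (ltn_trans las s1).
  have [ub _] := bottom_iter pP (zB w) (ltn_trans (leq_ltn_trans (leq_pred a) las) s1).
  have jE : j = iter a.-1 p (z w).
    apply: (unary_inj ua) => //; first by case/andP: ub.
    by rewrite -iterS prednK.
  rewrite rE mem_rev jE; apply: (map_f (fun a => iter a p (z w))).
  by rewrite mem_iota add0n; apply: leq_ltn_trans (leq_pred a) las.
- move=> w w' j /innE[a /andP[_ las] ->] /innE[b /andP[_ lbs]].
  by case/(bottom_inj pP (zB w) (zB w') (ltn_trans las s1) (ltn_trans lbs s1)) => /zI.
split; last split=> //.
- move=> w w'; split; apply/negP => /innE[b /andP[b0 lbs]].
    case/(bottom_inj pP (zB w) (zB w') s1 (ltn_trans lbs s1)) => _ E.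
    by rewrite E ltnn in lbs.
  case/(bottom_inj pP (zB w) (zB w') (a := 0) s0 (ltn_trans lbs s1)) => _ E.
  by rewrite -E in b0.
- by move=> w w' /(bottom_inj pP (zB w) (zB w') s1 s1)[/zI].
Qed.

(** * The tree in a joined set, both cases together *)

Section Core.
Variables (V : finType) (e : rel V).
Hypothesis e_sym : symmetric e.
Implicit Types (W : {set V}).

(** There will be at most [2 * 2 ^ c * M] wires. The factor [15 + 30 * (c + 1)] bounds the length of
    a segment in units of the cubed logarithm, and the last two terms provide the size that trimming
    requires. *)
Definition core_bound Delta :=
  let c := up_log 2 (2 * (Delta + 6) + 20) in
  2 * 2 ^ c * (2 + 3 * (15 + 30 * (c + 1))) + 3 * (Delta + 6) + 6.

Lemma core Delta a M n p W : 0 < M -> 0 < Delta -> 0 < a -> a <= M ->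
  joined e a M W -> n.-1 + a <= #|W| -> is_parent p n -> max_children p n Delta ->
  core_bound Delta * (M * (up_log 2 M).+1 ^ 3) <= n -> tree_in e p n W.
Proof.
move=> M0 D0 a0 aM jW cW pP pD nbig.
set h := up_log 2 M in nbig; set e0 := up_log 2 (2 * (Delta + 6) + 20) in nbig.
have Mh : M <= 2 ^ h by apply: up_logP.
have hM : 2 ^ h <= 2 * M.
  case: (posnP h) => [->|h1]; first by rewrite expn0 muln_gt0.
  have M1 : 1 < M by rewrite ltnNge; apply/negP;
    rewrite leq_eqVlt ltnS leqn0 (gtn_eqF M0) orbF => /eqP M1; move: h1; rewrite /h M1 up_log1.
  have /andP[lt _] := up_log_bounds (isT : 1 < 2) M1.
  by rewrite -(prednK h1) expnS leq_mul2l ltnW // orbT.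
have hl : h <= 2 * M by apply: leq_trans (ltnW (ltn_expl h (isT : 1 < 2))) hM.
have e0P : 2 * (Delta + 6) + 20 <= 2 ^ e0 by apply: up_logP.
(* [m] has to be even and the links have to have [m.*2.+1] vertices; with [q1 = 1] and
   [q2 = h.*2 + 4] they have [h.*2 + h.*2 + 5], which is this number. *)
pose m := (h.+1).*2; pose d0 := h + e0.
have tE : 2 ^ d0 = 2 ^ h * 2 ^ e0 by rewrite expnD.
have tbig : (2 * (Delta + 6) + 20) * M <= 2 ^ d0 by rewrite tE mulnC leq_mul.
have tsm : 2 ^ d0 <= 2 * 2 ^ e0 * M.
  by rewrite tE mulnAC leq_mul2r hM orbT.
set c := m.*2.+1 + 3 + net_len m d0 + m.*2.+1.
have cb : c + 2 <= (15 + 30 * (e0 + 1)) * h.+1 ^ 3.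
  have H1 : h.+1 <= h.+1 ^ 3 by rewrite -[leqLHS]expn1 leq_pexp2l.
  have H2 : h.+1 ^ 2 <= h.+1 ^ 3 by rewrite leq_pexp2l.
  have sl : switch_len m <= 15 * h.+1 ^ 2.
    rewrite /switch_len /m; move: (h); clear => k.
    by rewrite expnS expn1; nia.
  have nl : net_len m d0 <= 30 * (e0 + 1) * h.+1 ^ 3.
    rewrite /net_len; apply: leq_trans (leq_mul (leqnn d0) (leq_mul (leqnn 2) sl)) _.
    rewrite [h.+1 ^ 3]expnS; move: (h.+1 ^ 2) => H.
    have : d0 <= (e0 + 1) * h.+1 by rewrite /d0; clear; nia.
    by clear; nia.
  rewrite mulnDl /c /m; move: H1 nl; set A := _ ^ 3; set B := _ * A; set N := net_len _ _.
  by clear; lia.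
have H0 : 0 < h.+1 ^ 3 by rewrite expn_gt0.
have MA : M <= M * h.+1 ^ 3 by rewrite leq_pmulr.
pose A := M * h.+1 ^ 3.
have nb1 : 2 * 2 ^ d0 + (c + 2) * (3 * 2 ^ d0) <= 2 * 2 ^ e0 * (2 + 3 * (15 + 30 * (e0 + 1))) * A.
  have : (c + 2) * (3 * 2 ^ d0) <= (15 + 30 * (e0 + 1)) * h.+1 ^ 3 * (3 * (2 * 2 ^ e0 * M)).
    by rewrite leq_mul // leq_mul2l tsm orbT.
  have : 2 * 2 ^ d0 <= 2 * (2 * 2 ^ e0 * A).
    by rewrite leq_mul2l (leq_trans tsm) // leq_mul2l MA orbT.
  by rewrite /A; move: (2 ^ d0) (2 ^ e0) (h.+1 ^ 3) (15 + _) (c + 2) => t E H X Y; clear; nia.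
have nb : 2 * 2 ^ d0 + (c + 2) * (3 * 2 ^ d0) + (3 * (Delta + 6) + 6) * A <= n.
  apply: leq_trans nbig; rewrite -/A.
  have -> : core_bound Delta * A = 2 * 2 ^ e0 * (2 + 3 * (15 + 30 * (e0 + 1))) * A
      + (3 * (Delta + 6) + 6) * A by rewrite -mulnDl addnA.
  by rewrite leq_add2r.
have nM : (3 * (Delta + 6) + 6) * M <= n.
  by apply: leq_trans (leq_trans _ nb); [|exact: leq_addl]; rewrite leq_mul2l MA orbT.
have n1 : 1 < n by apply: leq_trans nM; rewrite mulnDl; move: M0; clear; lia.
have cJ : #|wires d0| = 2 ^ d0 by apply: card_wires.
have [|[L [uL Ln Lp JL]]|[tp [bt [inn seg]]]] := @leaves_or_segments (wires d0) p n c pP n1.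
- rewrite cJ; have : 0 < (3 * (Delta + 6) + 6) * A by rewrite muln_gt0 /A (leq_trans M0 MA) addnS.
  by move: nb; clear; lia.
- apply: (core_leaves e_sym M0 D0 a0 aM jW cW pP pD uL Ln Lp).
    by rewrite -cJ in tbig; apply: leq_trans (leq_trans tbig JL); rewrite leq_mul2r; apply/orP;
      right; clear; lia.
  by apply: leq_trans nM; rewrite leq_mul2r; apply/orP; right; clear; lia.
(* [core_paths] counts vertices exactly, so any surplus is dropped. *)
have [W' W'W cW'] := subset_of_card cW.
have jW' : joined e a M W'.
  by move=> A1 A2 h1 h2; apply: jW; apply: subset_trans W'W.
have [f [fI fW fe]] : tree_in e p n W'; last first.
  by exists f; split=> // i li; apply: (subsetP W'W); apply: fW.
apply: (@core_paths V e e_sym Delta a M n p W' d0 1 (h.*2 + 4) h m tp bt inn) => //.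
- exact: ltnW.
- by rewrite addnS.
- by rewrite /m odd_double.
- by rewrite /m -!muln2; clear; lia.
- rewrite /slack !expnS; move: tbig hM hl M0; rewrite mulnDl -mulnA (mulnC M).
  by move: (_ * M) (2 ^ h) (2 ^ d0) => B H t; clear; lia.
- by apply: leq_trans tbig; rewrite leq_mul2r; apply/orP; right; clear; lia.
- by apply: leq_trans nM; rewrite leq_mul2r; apply/orP; right; clear; lia.
Qed.

End Core.

(** * Spanning trees, cut edges and pairs of expanders *)

Section TreeOrder.
Variables (T : finType) (adj : rel T).
Hypotheses (adj_sym : symmetric adj) (adj_irr : irreflexive adj).
Hypothesis acyclic : forall c : seq T, ucycle adj c -> size c < 3.
Implicit Types (C : {set T}).

Definition within (C : pred T) : rel T := fun x y => [&& adj x y, C x & C y].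

Lemma within_sym C : symmetric (within [in C]).
Proof. by move=> x y; rewrite /within adj_sym; congr (_ && _); rewrite andbC. Qed.

(** By the last condition the parent edges are all the edges inside [C]; the root [y] is prescribed
    because it will be an end of the cut edge. *)
Definition tree_order C (y : T) (s : seq T) (p : nat -> nat) := [/\
  [/\ uniq s, s =i C & nth y s 0 = y], is_parent p (size s),
  forall i, 0 < i < size s -> adj (nth y s (p i)) (nth y s i) &
  forall i j, i < size s -> j < size s -> adj (nth y s i) (nth y s j) ->
    (0 < i /\ p i = j) \/ (0 < j /\ p j = i)].

Lemma path_exit (P : pred T) x s : P x -> ~~ P (last x s) ->
  forall R : rel T, path R x s -> exists a b, [/\ P a, ~~ P b & R a b].
Proof.
move=> + + R; elim: s x => [|z s IH] x /= Px; first by rewrite Px.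
move=> lP /andP[Rxz ps]; case: (boolP (P z)) => Pz; first exact: IH Pz lP ps.
by exists x, z.
Qed.

(** Two different neighbours of [z], connected inside [s], would close a cycle through [z]. *)
Lemma unique_back (s : seq T) x x' z : z \notin s -> x \in s -> x' \in s ->
  connect (within [in s]) x x' -> adj z x -> adj z x' -> x = x'.
Proof.
move=> zs xs x's /connectP[q0 pq0 lq0] zx zx'; apply/eqP/negPn/negP => ne.
case/shortenP: pq0 lq0 => q pq uq _ lq.
have q_s : {subset q <= s}.
  elim: (q) (x) pq => // b q' IH a /= /andP[/and3P[_ _ bs] pq'] c.
  by rewrite inE => /orP[/eqP->//|]; apply: IH pq' c.
have uc : ucycle adj (z :: x :: q).
  apply/andP; split.
    rewrite /= zx rcons_path -lq adj_sym zx' andbT.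
    by apply: sub_path pq => a b /= /and3P[].
  rewrite cons_uniq uq andbT inE negb_or; apply/andP; split.
    by apply: contraNneq zs => ->.
  by apply: contra zs; apply: q_s.
have := acyclic uc; case: (q) lq => [E _|//].
by rewrite E eqxx in ne.
Qed.

(** The order grows by one vertex at a time, along an edge that leaves the current set; by
    [unique_back] the new vertex has no other edge back. *)
Lemma tree_orderP C y : y \in C ->
  (forall z, z \in C -> connect (within [in C]) y z) ->
  exists s p, tree_order C y s p.
Proof.
move=> yC conC.
suff : forall k, 0 < k <= #|C| -> exists s p, [/\ size s = k, uniq s, {subset s <= C} & [/\ nth
  y s 0 = y,
    forall z, z \in s -> connect (within [in s]) y z, is_parent p k,
    forall i, 0 < i < k -> adj (nth y s (p i)) (nth y s i) &
    forall i j, i < k -> j < k -> adj (nth y s i) (nth y s j) ->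
    (0 < i /\ p i = j) \/ (0 < j /\ p j = i)]].
  move=> /(_ #|C|)[]; first by rewrite leqnn andbT; apply/card_gt0P; exists y.
  move=> s [p [sz us sC [n0 _ pP ad bk]]]; exists s, p; split; rewrite ?sz //.
  split=> //; have E : #|s| = #|C| by rewrite (card_uniqP us).
  by apply/(subset_cardP E)/subsetP.
elim=> // -[|k] IH /andP[_ kC].
  exists [:: y], id; split=> // [x|]; first by rewrite inE => /eqP->.
  split=> //.
  - by move=> z; rewrite inE => /eqP->; apply: connect0.
  - by move=> i; rewrite ltnS leqn0 => /andP[/lt0n_neq0/negbTE->].
  - by move=> i; rewrite ltnS leqn0 => /andP[/lt0n_neq0/negbTE->].
  - by move=> i j; rewrite !ltnS !leqn0 => /eqP-> /eqP->; rewrite /= adj_irr.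
have [|s [p [sz us sC [n0 con pP ad bk]]]] := IH; first by rewrite /= ltnW.
have ys : y \in s by rewrite -[X in X \in _]n0 mem_nth ?sz.
have [z0 z0C z0s] : exists2 z0, z0 \in C & z0 \notin s.
  apply/subsetPn; apply: contraL kC => /subset_leq_card.
  by rewrite (card_uniqP us) sz -ltnNge.
have /connectP[q pq lq] := conC z0 z0C.
have [|x [z [xs zs /and3P[xz _ zC]]]] := @path_exit (mem s) y q ys _ _ pq.
  by rewrite -lq.
have sub w : connect (within [in s]) y w -> connect (within [in rcons s z]) y w.
  apply: connect_sub => a b /and3P[ab as_ bs]; apply: connect1.
  by rewrite /within ab !mem_rcons !inE as_ bs !orbT.
have csym := sym_connect_sym (within_sym [set w in s]).
have eqw : within [in [set w in s]] =2 within [in s] by move=> a b; rewrite /within !inE.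
have uq x' : x' \in s -> adj z x' -> x' = x.
  move=> x's zx'; apply/esym; apply: (unique_back zs xs x's) => //; last by rewrite adj_sym.
  by rewrite -(eq_connect eqw) (connect_trans (y := y)) // ?[connect _ x y]csym (eq_connect eqw)
    con.
have nthz : nth y (rcons s z) k.+1 = z by rewrite nth_rcons sz ltnn eqxx.
have nths i : i < k.+1 -> nth y (rcons s z) i = nth y s i by move=> ik; rewrite nth_rcons sz ik.
have xk : index x s < k.+1 by rewrite -sz index_mem.
exists (rcons s z), (fun i => if i == k.+1 then index x s else p i); split.
- by rewrite size_rcons sz.
- by rewrite rcons_uniq zs.
- by move=> w; rewrite mem_rcons inE => /orP[/eqP->|/sC].
split.
- by rewrite nths.
- move=> w; rewrite mem_rcons inE => /orP[/eqP->|/con/sub//].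
  apply: connect_trans (sub _ (con x xs)) (connect1 _).
  by rewrite /within xz !mem_rcons !inE eqxx; move: xs => /= ->; rewrite orbT.
- move=> i /andP[i0]; rewrite ltnS leq_eqVlt; case: eqP => [->|_ /= ik] //.
  by apply: pP; rewrite i0.
- move=> i /andP[i0]; rewrite ltnS leq_eqVlt; case: eqP => [->|_ /= ik].
    by rewrite nthz nths // nth_index.
  by rewrite !nths ?ad ?i0 // (ltn_trans (pP i _) ik) // i0.
- have lts i : i < k.+2 -> i = k.+1 \/ i < k.+1.
    by rewrite ltnS leq_eqVlt => /orP[/eqP|]; [left|right].
  move=> i j /lts[->|ik] /lts[->|jk].
  + by rewrite adj_irr.
  + rewrite nthz nths // => /uq E; left; rewrite eqxx; split=> //.
    by rewrite -E ?mem_nth ?sz // index_uniq ?sz.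
  + rewrite nthz nths // adj_sym => /uq E; right; rewrite eqxx; split=> //.
    by rewrite -E ?mem_nth ?sz // index_uniq ?sz.
  + by rewrite !nths // (ltn_eqF ik) (ltn_eqF jk); apply: bk.
Qed.

Lemma tree_order_children C y s p D : tree_order C y s p ->
  (forall x, #|[set w | adj x w]| <= D) -> max_children p (size s) D.
Proof.
case=> -[us sC n0] pP ad bk degD i; apply: leq_trans (degD (nth y s i)).
rewrite /nchild /= -big_mkcond /= sum1_count -size_filter.
rewrite -(size_map (nth y s)) -(card_uniqP _); last first.
  rewrite map_inj_in_uniq ?filter_uniq ?iota_uniq // => a b.
  rewrite !mem_filter !mem_index_iota => /andP[_ /andP[_ la]] /andP[_ /andP[_ lb]] /eqP.
  by rewrite nth_uniq // => /eqP.
apply/subset_leq_card/subsetP => x /mapP[j].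
by rewrite mem_filter mem_index_iota inE => /andP[/eqP<- jn] ->; apply: ad.
Qed.

Section Copies.
Variables (V : finType) (e : rel V).
Hypothesis e_sym : symmetric e.
Implicit Types (W X : {set V}).

Definition copy_on C W (f : T -> V) := [/\ {in C &, injective f},
  {in C, forall x, f x \in W} & {in C &, forall x y, adj x y -> e (f x) (f y)}].

Lemma tree_order_copy C y s p W (F : nat -> V) : tree_order C y s p ->
  {in gtn (size s) &, injective F} -> (forall i, i < size s -> F i \in W) ->
  (forall i, 0 < i < size s -> e (F (p i)) (F i)) ->
  copy_on C W (fun x => F (index x s)).
Proof.
case=> -[us sC n0] pP ad bk FI FW Fe.
have ix x : x \in C -> index x s < size s by rewrite index_mem sC.
split.
- move=> x x' xC x'C /FI; rewrite !inE !ix // => /(_ isT isT) E.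
  by rewrite -(nth_index y (s := s) (x := x)) ?sC // E nth_index ?sC.
- by move=> x /ix; apply: FW.
- move=> x x' xC x'C xx';
  have [|[i0 E]|[j0 E]] := bk (index x s) (index x' s) (ix _ xC) (ix _ x'C).
  + by rewrite !nth_index ?sC.
  + by rewrite -E e_sym; apply: Fe; rewrite i0 ix.
  + by rewrite -E; apply: Fe; rewrite j0 ix.
Qed.

End Copies.
End TreeOrder.

(** * Descendants and balanced cut edges *)

Section Descendants.
Variables (p : nat -> nat) (n : nat).
Hypothesis pP : is_parent p n.

Fixpoint desc_rec f x j :=
  (j == x) || if f is f'.+1 then (0 < j) && desc_rec f' x (p j) else false.

Definition desc x j := desc_rec j x j.

Lemma desc_recE f f' x j : j <= f -> j <= f' -> j < n -> desc_rec f x j = desc_rec f' x j.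
Proof.
elim: f f' j => [|f IH] [|f'] j //=; rewrite ?leqn0; try by move=> /eqP->.
- by move=> _ /eqP->.
- move=> lf lf' jn; case: (posnP j) => [->//|j0] /=; congr (_ || _).
  have lt : p j < j by rewrite pP ?j0.
  by apply: IH; [rewrite -ltnS (leq_trans lt)|rewrite -ltnS (leq_trans lt)|exact: ltn_trans lt
    jn].
Qed.

Lemma descE x j : j < n -> desc x j = (j == x) || (0 < j) && desc x (p j).
Proof.
move=> jn; rewrite {1}/desc; case: (posnP j) => [->/=|j0]; first by rewrite orbF.
have lt : p j < j by rewrite pP ?j0.
case: j j0 jn lt => // j _ jn lt; rewrite /= /desc; congr (_ || _).
by apply: desc_recE => //; apply: ltn_trans lt jn.
Qed.

Lemma descxx x : desc x x.
Proof. by case: x => [|x]; rewrite /desc //= eqxx. Qed.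

Lemma desc_le x j : j < n -> desc x j -> x <= j.
Proof.
elim/ltn_ind: j => j IH jn; rewrite descE // => /orP[/eqP->//|/andP[j0 d]].
have lt : p j < j by rewrite pP ?j0.
by apply: leq_trans (IH _ lt (ltn_trans lt jn) d) (ltnW lt).
Qed.

Lemma desc0 j : j < n -> desc 0 j.
Proof.
elim/ltn_ind: j => j IH jn; rewrite descE //; case: (posnP j) => //= j0.
have lt : p j < j by rewrite pP ?j0.
by rewrite IH // (ltn_trans lt jn).
Qed.

Lemma desc_child x j : j < n -> desc x j -> j != x ->
  exists y, [/\ 0 < y < n, p y = x & desc y j].
Proof.
elim/ltn_ind: j => j IH jn; rewrite descE // => /orP[->//|/andP[j0 d]] _.
have lt : p j < j by rewrite pP ?j0.
case: (eqVneq (p j) x) => [E|ne]; first by exists j; rewrite j0 jn descxx.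
have [y [yn py dy]] := IH _ lt (ltn_trans lt jn) d ne.
by exists y; split=> //; rewrite descE // j0 dy orbT.
Qed.

Definition weight x := count (desc x) (iota 0 n).

Lemma weight_children x : x < n ->
  weight x <= 1 + \sum_(1 <= y < n) (p y == x) * weight y.
Proof.
move=> xn; have wE z : weight z = \sum_(0 <= j < n) desc z j.
  by rewrite /weight -sum1_count big_mkcond /= /index_iota subn0; apply: eq_bigr => j _;
    case: desc.
have -> : 1 + \sum_(1 <= y < n) (p y == x) * weight y =
    \sum_(0 <= j < n) ((j == x) + \sum_(1 <= y < n) (p y == x) * desc y j).
  rewrite big_split /= exchange_big /=; congr (_ + _).
    rewrite (bigD1_seq x) ?iota_uniq ?mem_index_iota ?xn //= eqxx big1 // => j.
    by move/negbTE->.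
  by apply: eq_bigr => y _; rewrite wE big_distrr.
rewrite wE !big_seq; apply: leq_sum => j; rewrite mem_index_iota => /andP[_ jn].
case: (boolP (desc x j)) => // d; case: (eqVneq j x) => //= ne.
have [y [yn py dy]] := desc_child jn d ne.
rewrite (bigD1_seq y) ?iota_uniq ?mem_index_iota //= py eqxx dy //.
Qed.

(** Take the last vertex with at least [s] descendants, itself included. Its children come later and
    have at most [s.-1] each, so it has at most [1 + D * s.-1]. *)
Lemma cut_vertex D s : 0 < s -> 0 < D -> D * s < n -> max_children p n D ->
  exists2 x, 0 < x < n & s <= weight x <= D * s.
Proof.
move=> s0 D0 Dn pD.
have w0 : weight 0 = n.
  rewrite /weight -[RHS](size_iota 0 n); apply/eqP; rewrite -all_count; apply/allP => j.
  by rewrite mem_iota => /andP[_ jn]; apply: desc0.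
have n0 : 0 < n by apply: leq_ltn_trans Dn.
have sn : s <= n by rewrite ltnW // (leq_ltn_trans _ Dn) // leq_pmull.
have ex : exists x, (x < n) && (s <= weight x) by exists 0; rewrite n0 w0.
have ub x : (x < n) && (s <= weight x) -> x <= n by case/andP => /ltnW.
case: (ex_maxnP ex ub) => x /andP[xn sx] xmax.
have wx : weight x <= D * s.
  apply: leq_trans (weight_children xn) _.
  have : \sum_(1 <= y < n) (p y == x) * weight y <= \sum_(1 <= y < n) (p y == x) * s.-1.
    rewrite !big_seq; apply: leq_sum => y; rewrite mem_index_iota => yn.
    case: eqP => //= py; rewrite !mul1n -ltnS prednK // ltnNge; apply/negP => sy.
    have := xmax y; rewrite sy andbT; case/andP: (yn) => _ -> /(_ isT).
    by have := pP yn; rewrite py ltnNge => /negbTE->.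
  rewrite -big_distrl /= => le.
  have := leq_trans le (leq_mul (pD x) (leqnn s.-1)).
  by move: D0; rewrite -{2}(prednK s0) mulnS; clear; lia.
exists x; last by rewrite sx.
rewrite xn andbT lt0n; apply: contraTneq wx => ->.
by rewrite w0 -ltnNge.
Qed.

End Descendants.

(** * Expanders and copies of the tree *)

Section Embeddings.
Variables (T : finType) (adj : rel T).
Hypotheses (adj_sym : symmetric adj) (adj_irr : irreflexive adj).
Hypothesis acyclic : forall c : seq T, ucycle adj c -> size c < 3.
Hypothesis connected : forall x y, connect adj x y.
Variable Delta : nat.
Hypotheses (Delta_gt0 : 0 < Delta).
Hypothesis max_deg : forall x, #|[set w | adj x w]| <= Delta.
Variables (V : finType) (e : rel V).
Hypothesis e_sym : symmetric e.
Implicit Types (C : {set T}) (A B W X Y : {set V}).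

Definition copy := exists f : T -> V, injective f /\ forall x y, adj x y -> e (f x) (f y).

Lemma copy_setT W f : copy_on adj e setT W f -> copy.
Proof.
case=> fI _ fe; exists f; split=> [x y|x y]; first by apply: fI; rewrite inE.
by apply: fe; rewrite inE.
Qed.

Lemma whole_tree_order y : exists s p, tree_order adj setT y s p.
Proof.
apply: (tree_orderP adj_sym adj_irr acyclic) => [|z _]; first by rewrite inE.
rewrite (eq_connect (e' := adj)) // => a b; by rewrite /within !inE !andbT.
Qed.

Lemma tree_order_size C y s p : tree_order adj C y s p -> size s = #|C|.
Proof. by case=> -[us sC _] _ _ _; rewrite -(card_uniqP us); apply: eq_card. Qed.

Lemma tree_in_copy : T -> exists p, [/\ is_parent p #|T|, max_children p #|T| Delta &
  forall W, tree_in e p #|T| W -> copy].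
Proof.
move=> y; have [s [p ord]] := whole_tree_order y.
have sz : size s = #|T| by rewrite (tree_order_size ord) cardsT.
exists p; rewrite -sz; split.
- by case: ord.
- exact: tree_order_children ord max_deg.
- by move=> W [f [fI fW fe]]; apply: copy_setT (tree_order_copy e_sym ord fI fW fe).
Qed.

(** The surplus of [Delta.+1] over the degree pays for deleting an arbitrary vertex of [X], which
    can then be the image of the root; [k] is the size of the trees that fit. *)
Definition expander M k X :=
  [/\ extendable e M X X (fun=> Delta.+1), roomy e M Delta X X k & M <= #|X|].

Lemma expander_embed C y s p M k X u : tree_order adj C y s p -> #|C| <= k -> y \in C ->
  expander M k X -> u \in X -> exists f, copy_on adj e C X f /\ f y = u.
Proof.
move=> ord Ck yC [gX rX MX] uX.
have sz := tree_order_size ord; have [[us sC n0] pP _ _] := ord.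
have s0 : 0 < size s by rewrite sz; apply/card_gt0P; exists y.
have nk : nkept predT (size s) = (size s).-1.
  by rewrite /nkept big_const_nat iter_addn_0 mul1n subn1.
have pD := tree_order_children ord max_deg.
have gu : extendable e M X (X :\ u) (fun=> Delta).
  move=> S SX S2; have := gX S SX S2; rewrite !sum_nat_const mulnS.
  have : #|nb e S :&: X| <= #|nb e S :&: (X :\ u)| + 1.
    rewrite -(cards1 u); apply: leq_trans (leq_card_setU _ _); apply/subset_leq_card/subsetP => x.
    by rewrite !in_setI !inE => /andP[-> ->]; case: (x == u).
  case: (posnP #|S|) => [->|S0]; first by rewrite mul0n.
  by move: (#|S| * _) S0; clear; lia.
have [|||||f [Y' [r' [[f0 fI fY fe] _ _ _]]]] :=
  @embed V e M Delta p predT u X (X :\ u) (fun=> Delta) Delta (size s) gu (fun=> leqnn _) _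
    (subD1set _ _) MX uX _ s0 pP.
- apply: (roomy_sub rX (subD1set _ _)).
  have -> : #|X :\: (X :\ u)| = 1.
    by rewrite setDDr setDv set0U (setIidPr _) ?cards1 // sub1set.
  by rewrite nk; move: Ck s0; rewrite -sz; clear; lia.
- by rewrite !inE eqxx.
- by [].
- exact: pD.
- exact: pD.
have pl i : i < size s -> i \in placed predT (size s) by rewrite inE orbT andbT.
exists (fun x => f (index x s)); split; last first.
  by case: (s) n0 => [|z s'] //= ->; rewrite eqxx.
apply: (tree_order_copy e_sym ord).
- by move=> i j; rewrite !inE => /pl ip /pl jp; apply: fI.
- move=> i /pl ip; case: (posnP i) => [->|i0]; first by rewrite f0.
  by have /setDP[/setD1P[]] := fY i ip i0.
- move=> i /andP[i0 lt]; apply: fe; rewrite ?pl //.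
  by rewrite (ltn_trans (pP i _) lt) // i0.
Qed.

Lemma expander_trim M k X : 0 < M -> M <= #|X| -> 3 * (Delta.+1 * M) <= k + 2 * (Delta * M) ->
  (forall A, A \subset X -> #|A| = M -> k + (2 * Delta + 1) * M <= #|nb e A :&: X|) ->
  exists2 X' : {set V}, X' \subset X /\ #|X :\: X'| < M & expander M k X'.
Proof.
move=> M0 MX kb big.
have [|Z [ZX ZM _ gX rX]] := @trim V e X M Delta.+1 (k + 2 * (Delta * M)) M0 isT kb.
  by move=> A AX cA; have := big A AX cA; rewrite mulnDl -mulnA; clear; lia.
have [A AX cA] := subset_of_card MX.
have cX : 2 * M <= #|X|.
  have := big A AX cA; have : #|nb e A :&: X| <= #|X| by rewrite subset_leq_card // subsetIr.
  by move: kb; clear; nia.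
exists (X :\: Z); first by rewrite subsetDl setDDr setDv set0U (setIidPr ZX).
split=> //; last by rewrite cardsDS //; move: cX ZM; clear; lia.
move=> S SX MS; rewrite -mul2n (mulnC M) addnC; apply: rX => //.
exact: subset_trans SX (subsetDl _ _).
Qed.

Lemma expander_joined M k X : 0 < M -> joined e M M X -> 3 * (Delta.+1 * M) <= k ->
  k + (2 * Delta + 3) * M <= #|X| ->
  exists2 X' : {set V}, X' \subset X /\ #|X :\: X'| < M & expander M k X'.
Proof.
move=> M0 jX kb cX; apply: expander_trim => //.
- by move: cX; rewrite mulnDl; clear; lia.
- by apply: leq_trans kb (leq_addr _ _).
move=> A AX cA; have := joined_codense e_sym jX (subxx X) AX (eq_leq (esym cA)).
rewrite -(leq_add2l #|nb e A :&: X|) setIC cardsID.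
by move: cX; rewrite !mulnDl; clear; lia.
Qed.

Lemma expander_copy M X : 0 < M -> M <= #|X| -> 3 * (Delta.+1 * M) <= #|T| ->
  (forall A, A \subset X -> #|A| = M -> #|T| + (2 * Delta + 1) * M <= #|nb e A :&: X|) ->
  copy.
Proof.
move=> M0 MX Tb big; have T0 : 0 < #|T|.
  by apply: leq_trans Tb; rewrite !muln_gt0 /= M0.
have /card_gt0P[y _] := T0; have [s [p ord]] := whole_tree_order y.
have [X' _ xX'] := expander_trim M0 MX (leq_trans Tb (leq_addr _ _)) big.
have /card_gt0P[u uX] : 0 < #|X'| by case: xX' => _ _; apply: leq_trans.
have [|f [fc _]] := expander_embed ord _ (in_setT y) xX' uX; first by rewrite cardsT.
exact: copy_setT fc.
Qed.

Lemma copy_of_joined M X : 0 < M -> joined e M M X -> 3 * (Delta.+1 * M) <= #|T| ->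
  #|T| + (2 * Delta + 3) * M <= #|X| -> copy.
Proof.
move=> M0 jX Tb cX; apply: (@expander_copy M X) => //.
  by move: cX; rewrite mulnDl; clear; lia.
move=> A AX cA; have := joined_codense e_sym jX (subxx X) AX (eq_leq (esym cA)).
rewrite -(leq_add2l #|nb e A :&: X|) setIC cardsID.
by move: cX; rewrite !mulnDl; clear; lia.
Qed.

(* Cut the tree at an edge into a small and a large part, each embedded on its
   own side of the edge [u1 u2]. *)
Lemma split_copy s M1 M2 k1 k2 X1 X2 u1 u2 : 0 < s -> Delta * s < #|T| ->
  expander M1 k1 X1 -> expander M2 k2 X2 -> #|T| <= k1 + s -> Delta * s <= k2 ->
  [disjoint X1 & X2] -> u1 \in X1 -> u2 \in X2 -> e u1 u2 -> copy.
Proof.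
move=> s0 DT x1 x2 Tk1 Dk2 dX u1X u2X u12.
have /card_gt0P[y _] : 0 < #|T| by apply: leq_ltn_trans DT.
have [l [p ord]] := whole_tree_order y.
have sz := tree_order_size ord; rewrite cardsT in sz.
have pD := tree_order_children ord max_deg.
have [[ul lT l0] pP ad bk] := ord.
have [|x /andP[x0 xn] /andP[sx xD]] := cut_vertex pP s0 Delta_gt0 _ pD; first by rewrite sz.
have ix z : index z l < size l by rewrite index_mem lT inE.
have ni z : nth y l (index z l) = z by rewrite nth_index // lT inE.
have ii i : i < size l -> index (nth y l i) l = i by move=> li; rewrite index_uniq.
pose C2 := [set z | desc p x (index z l)]; pose C1 := ~: C2.
have cC2 : #|C2| = weight p (size l) x.
  rewrite /weight -size_filter -(size_map (nth y l)) -(card_uniqP _); last first.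
    rewrite map_inj_in_uniq ?filter_uniq ?iota_uniq // => i j.
    rewrite !mem_filter !mem_iota => /and3P[_ _ li] /and3P[_ _ lj] E.
    by rewrite -(ii i li) E ii.
  apply: eq_card => z; rewrite inE; apply/idP/mapP => [d|[j]].
    by exists (index z l); rewrite ?ni // mem_filter d mem_iota ix.
  by rewrite mem_filter mem_iota => /and3P[d _ lj] ->; rewrite ii.
have cC1 : #|C1| + #|C2| = #|T| by rewrite addnC cardsC.
have C2E j : j < size l -> (nth y l j \in C2) = desc p x j by move=> lj; rewrite inE ii.
have C1E j : j < size l -> (nth y l j \in C1) = ~~ desc p x j by move=> lj; rewrite inE C2E.
have px : p x < x by rewrite pP ?x0.
have pxn : p x < size l by apply: ltn_trans px xn.
have con2 j : j < size l -> desc p x j -> connect (within adj [in C2]) (nth y l x) (nth y l j).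
  elim/ltn_ind: j => j IH lj d; move: (d); rewrite (descE pP) // => /orP[/eqP->|/andP[j0 d']].
    exact: connect0.
  have lt : p j < j by rewrite pP ?j0.
  apply: connect_trans (IH _ lt (ltn_trans lt lj) d') (connect1 _).
  by rewrite /within ad ?j0 // !C2E ?d ?d' // (ltn_trans lt lj).
have con1 j : j < size l -> ~~ desc p x j -> connect (within adj [in C1]) (nth y l 0) (nth y l j).
  elim/ltn_ind: j => j IH lj d; case: (posnP j) => [->|j0]; first exact: connect0.
  have lt : p j < j by rewrite pP ?j0.
  have d' : ~~ desc p x (p j).
    by apply: contra d => d; rewrite (descE pP) // j0 d orbT.
  apply: connect_trans (IH _ lt (ltn_trans lt lj) d') (connect1 _).
  by rewrite /within ad ?j0 // !C1E ?d ?d' // (ltn_trans lt lj).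
have nd_px : ~~ desc p x (p x).
  by apply/negP => /(desc_le pP pxn); rewrite leqNgt px.
have xC2 : nth y l x \in C2 by rewrite C2E ?descxx.
have pxC1 : nth y l (p x) \in C1 by rewrite C1E.
have csym := sym_connect_sym (within_sym adj_sym C1).
have [|l2 [p2 ord2]] := tree_orderP adj_sym adj_irr acyclic xC2.
  by move=> z zC; rewrite -(ni z); apply: con2; rewrite // -C2E // ni.
have [|l1 [p1 ord1]] := tree_orderP adj_sym adj_irr acyclic pxC1.
  move=> z zC; apply: (connect_trans (y := nth y l 0)); first by rewrite csym con1.
  by rewrite -(ni z); apply: con1; rewrite // -C1E // ni.
have [|f1 [[f1I f1X f1e] f1x]] := expander_embed ord1 _ pxC1 x1 u1X.
  by move: cC1 cC2 sx Tk1; clear; lia.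
have [|f2 [[f2I f2X f2e] f2x]] := expander_embed ord2 _ xC2 x2 u2X.
  by rewrite cC2; apply: leq_trans Dk2.
have nC z : (z \in C1) = ~~ (z \in C2) by rewrite inE.
have f12 z z' : z \in C1 -> z' \in C2 -> f1 z != f2 z'.
  move=> zC z'C; apply: contraTneq (f1X z zC) => ->.
  by rewrite (disjointFl dX) ?f2X.
(* The only edge between the two parts is the parent edge of the cut vertex [x], and its ends are
   mapped to [u1] and [u2]. *)
have cross z z' : z \in C1 -> z' \in C2 -> adj z z' -> e (f1 z) (f2 z').
  move=> zC z'C; rewrite -{1}(ni z) -{1}(ni z') => /(bk _ _ (ix z) (ix z')).
  have dz : ~~ desc p x (index z l) by rewrite -C1E // ni.
  have dz' : desc p x (index z' l) by rewrite -C2E // ni.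
  case=> [[i0 E]|[j0 E]].
    by case/negP: dz; rewrite (descE pP) // i0 E dz' orbT.
  have E' : index z' l = x.
    by move: dz'; rewrite (descE pP) // E (negbTE dz) andbF orbF => /eqP.
  by rewrite -(ni z) -(ni z') E' -E E' f1x f2x.
exists (fun z => if z \in C1 then f1 z else f2 z); split.
  move=> z z'; case: (boolP (z \in C1)) => zC; case: (boolP (z' \in C1)) => z'C.
  - exact: f1I.
  - by move/eqP; rewrite (negbTE (f12 _ _ zC _)) //; rewrite nC negbK in z'C.
  - by move/esym/eqP; rewrite (negbTE (f12 _ _ z'C _)) //; rewrite nC negbK in zC.
  - by rewrite !nC !negbK in zC z'C; apply: f2I.
move=> z z' zz'; case: (boolP (z \in C1)) => zC; case: (boolP (z' \in C1)) => z'C.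
- exact: f1e.
- by apply: cross => //; rewrite nC negbK in z'C.
- by rewrite e_sym; apply: cross => //; [rewrite nC negbK in zC | rewrite adj_sym].
- by rewrite !nC !negbK in zC z'C; apply: f2e.
Qed.

End Embeddings.

(** * Colourings without a red tree *)

Lemma card_bigcup_disj (V : finType) (F : nat -> {set V}) j :
  (forall i i', i < i' < j -> [disjoint F i & F i']) ->
  #|\bigcup_(i < j) F i| = \sum_(i < j) #|F i|.
Proof.
elim: j => [|j IH] dF; first by rewrite !big_ord0 cards0.
rewrite !big_ord_recr /= -IH; last first.
  by move=> i i' /andP[ii' ij]; apply: dF; rewrite ii' ltnW.
apply/eqP; rewrite leq_card_setU; apply/pred0P => x; apply/negP => /andP[/=].
move/bigcupP => [i _ xi] xj; have := dF i j; rewrite ltn_ord ltnSn => /(_ isT).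
by move/pred0P/(_ x); rewrite /= xi xj.
Qed.

Lemma disjoint_setDU (V : finType) (X A B : {set V}) :
  [disjoint X :\: (A :|: B) & A] /\ [disjoint X :\: (A :|: B) & B].
Proof.
split; apply/pred0P => x /=; rewrite !inE negb_or.
  by case: (x \in A); rewrite ?andbF.
by case: (x \in B); rewrite ?andbF.
Qed.

Section Blue.
Variables (V : finType) (e : rel V).
Hypothesis e_sym : symmetric e.
Implicit Types (A B W X Y Z : {set V}).

Definition blueK k M X := exists P : nat -> {set V},
  (forall i, i < k -> P i \subset X /\ M <= #|P i|) /\
  (forall i i', i < i' < k -> blue e (P i) (P i')).

Lemma blueK_add k M X Y A : blueK k M Y -> Y \subset X -> A \subset X ->
  M <= #|A| -> blue e A Y -> blueK k.+1 M X.
Proof.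
move=> [P [PX Pb]] YX AX MA bA; exists (fun i => if i < k then P i else A); split.
  move=> i _; case: ifP => // ik; have [h1 h2] := PX i ik.
  by split=> //; apply: subset_trans YX.
move=> i i' /andP[ii' i'k]; have ik : i < k by apply: leq_trans ii' _.
rewrite ik; case: ifP => i'k'; first by apply: Pb; rewrite ii'.
by apply: (blueS (blue_sym e_sym bA)) => //; have [] := PX i ik.
Qed.

Lemma joined_or_blue a b X : joined e a b X \/ exists A B,
  [/\ A \subset X, B \subset X, a <= #|A|, b <= #|B| & blue e A B].
Proof.
case: (boolP [exists A : {set V}, exists B : {set V},
  [&& A \subset X, B \subset X, a <= #|A|, b <= #|B| & blue e A B]]).
  by case/existsP => A /existsP[B /and5P[]]; right; exists A, B.
move/existsPn => h; left => A B AX BX cA cB; apply/negP => bl.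
by have /existsPn/(_ B) := h A; rewrite AX BX cA cB bl.
Qed.

Lemma joined_sub a b X X' : joined e a b X -> X' \subset X -> joined e a b X'.
Proof. by move=> jX sX A B AX BX; apply: jX; [apply: subset_trans sX|apply: subset_trans sX]. Qed.

Lemma blueK2_joined M X : ~ blueK 2 M X -> joined e M M X.
Proof.
move=> nK; case: (joined_or_blue M M X) => // -[A [B [AX BX cA cB bl]]]; case: nK.
exists (fun i => if i == 0 then A else B); split=> [[|i]|[|i] [|i']] //=.
by case: i' => [|i']; rewrite ?andbF.
Qed.

(** If [X] is not joined at the scale [M1], it contains a blue pair of sets of this size, and inside
    one of them the number of possible blue parts has dropped by one. The ratio [K] of consecutive
    scales makes the joined set [K] times as large as its own scale. *)
Lemma ramsey_joined j K M X : 0 < K -> ~ blueK j.+2 M X -> K ^ j.+1 * M <= #|X| ->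
  exists M1 X', [/\ M <= M1, X' \subset X, joined e M1 M1 X' & K * M1 <= #|X'|].
Proof.
move=> K0; elim: j X => [|j IH] X nK cX.
  by exists M, X; split=> //; apply: blueK2_joined.
pose M1 := K ^ j.+1 * M; have MM1 : M <= M1 by rewrite leq_pmull // expn_gt0 K0.
case: (joined_or_blue M1 M1 X) => [jX|[A [B [AX BX cA cB bl]]]].
  by exists M1, X; split=> //; rewrite mulnA -expnS.
have [|//|M2 [X' [h1 h2 h3 h4]]] := IH A.
  move=> kA; apply: nK; apply: (blueK_add kA AX BX); first exact: leq_trans MM1 cB.
  exact: blue_sym.
by exists M2, X'; split=> //; apply: subset_trans AX.
Qed.

End Blue.

(** * Disjoint joined sets of about [n] vertices *)

Section Structure.
Variables (T : finType) (adj : rel T).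
Hypotheses (adj_sym : symmetric adj) (adj_irr : irreflexive adj).
Hypothesis acyclic : forall c : seq T, ucycle adj c -> size c < 3.
Hypothesis connected : forall x y, connect adj x y.
Variable Delta : nat.
Hypotheses (Delta_gt0 : 0 < Delta).
Hypothesis max_deg : forall x, #|[set w | adj x w]| <= Delta.
Variables (V : finType) (e : rel V).
Hypothesis e_sym : symmetric e.
Hypothesis nocopy : ~ copy adj e.
Implicit Types (C : {set T}) (A B W X Y Z : {set V}).

Notation expander := (expander Delta e).
Notation n := #|T|.

Lemma poor_set M X : 0 < M -> M <= #|X| -> 3 * (Delta.+1 * M) <= n ->
  exists A, [/\ A \subset X, #|A| = M & #|nb e A :&: X| < n + (2 * Delta + 1) * M].
Proof.
move=> M0 MX big; case: (boolP [exists A : {set V}, [&& A \subset X, #|A| == M &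
    #|nb e A :&: X| < n + (2 * Delta + 1) * M]]).
  by case/existsP => A /and3P[h1 /eqP h2 h3]; exists A.
move/existsPn => h; case: nocopy.
apply: (expander_copy adj_sym adj_irr acyclic connected max_deg e_sym M0 MX big) => A AX cA.
by have := h A; rewrite AX cA eqxx /= -leqNgt.
Qed.

Lemma joined_small M X : 0 < M -> joined e M M X -> 3 * (Delta.+1 * M) <= n ->
  #|X| < n + (2 * Delta + 3) * M.
Proof.
move=> M0 jX big; rewrite ltnNge; apply/negP => le; apply: nocopy.
exact: (copy_of_joined adj_sym adj_irr acyclic connected max_deg e_sym M0 jX big le).
Qed.

(** A poor set [A] and its neighbours are fewer than [n + (2 * Delta + 2) * M] vertices. The rest is
    blue to [A] and admits one blue part fewer; when no blue pair is possible any more, it is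
    joined. *)
Lemma chain_core j M X c0 : 0 < M -> ~ blueK e j.+2 M X -> j.+1 * n <= #|X| + c0 * M ->
  (c0 + j.+1 * (2 * Delta + 2) + 3 * Delta.+1 + 1) * M <= n ->
  exists B, [/\ B \subset X, joined e M M B & n <= #|B| + (c0 + j * (2 * Delta + 2)) * M].
Proof.
move=> M0; elim: j X c0 => [|j IH] X c0 nK cX nbig.
  by exists X; split=> //; [apply: blueK2_joined | rewrite mul1n in cX; rewrite mul0n addn0].
have n3 : 3 * (Delta.+1 * M) <= n.
  by apply: leq_trans nbig; rewrite mulnA leq_mul2r; apply/orP; right; clear; lia.
have nc : (c0 + 2) * M <= n.
  by apply: leq_trans nbig; rewrite leq_mul2r; apply/orP; right; clear; lia.
have MX : M <= #|X|.
  by move: cX nc; rewrite mulnDl 2!mulSn; clear; lia.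
have [A [AX cA lt]] := poor_set M0 MX n3.
pose X1 := X :\: (A :|: nb e A).
have X1X : X1 \subset X by apply: subsetDl.
have bA : blue e A X1.
  by have [d1 d2] := disjoint_setDU X A (nb e A); apply/(blue_sym e_sym)/blue_nonnb.
have cX1 : #|X| <= #|X1| + (n + (2 * Delta + 2) * M).
  have h1 := cardsID (A :|: nb e A) X; rewrite -/X1 in h1.
  have : #|X :&: (A :|: nb e A)| <= #|A| + #|nb e A :&: X|.
    rewrite setIUr [X :&: nb e A]setIC; apply: leq_trans (leq_card_setU _ _) _.
    by rewrite leq_add2r subset_leq_card // subsetIr.
  by move: h1 lt; rewrite cA !mulnDl; clear; lia.
have [|||B [BX1 jB cB]] := IH X1 (c0 + (2 * Delta + 2)).
- move=> k1; apply: nK; apply: (blueK_add e_sym k1 X1X AX) => //.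
  by rewrite cA.
- by move: cX cX1; rewrite mulSn !mulnDl; clear; lia.
- by apply: leq_trans nbig; rewrite leq_mul2r; apply/orP; right; clear; lia.
exists B; split=> //; first exact: subset_trans BX1 X1X.
by apply: leq_trans cB _; rewrite leq_add2l leq_mul2r; apply/orP; right; clear; lia.
Qed.

(** Everything is in units of [M]. [c0] is the deficit from a multiple of [n]; splitting off one
    core raises it by [2 * Delta + 3], the possible excess of the core over [n], and by [K ^ j], a
    bound on its outer neighbours. *)
Fixpoint cores_bound j c0 := if j is j'.+1 then
  let K := Delta.+1 * (c0 + j * (2 * Delta + 2) + 6 * Delta + 10) in
  cores_bound j' (c0 + 2 * Delta + 3 + K ^ j) + K + 1 else 0.

(** The core [B'] has few outer neighbours [Y]. Otherwise [ramsey_joined] finds in [Y] an expander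
    for the small part of the tree, and a red edge leads from it to [B'], which can hold the large
    part. What remains without [B'] and [Y] is blue to [B'], so the induction applies with one blue
    part fewer. *)
Lemma cores j M X c0 : 0 < M -> ~ blueK e j.+2 M X -> j.+1 * n <= #|X| + c0 * M ->
  cores_bound j.+1 c0 * M <= n -> exists B : nat -> {set V},
  [/\ forall i, i < j.+1 -> B i \subset X,
      forall i, i < j.+1 -> joined e M M (B i) /\ n <= #|B i| + cores_bound j.+1 c0 * M &
      forall i i', i < i' < j.+1 -> [disjoint B i & B i']].
Proof.
move=> M0; elim: j X c0 => [|j IH] X c0 nK cX; set c1 := cores_bound _ c0 => nbig.
  exists (fun=> X); split=> // [i _|i i']; last first.
    by case/andP=> ii; rewrite ltnS leqn0 => /eqP i0; rewrite i0 in ii.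
  split; first exact: blueK2_joined.
  rewrite mul1n in cX; apply: leq_trans cX _; rewrite leq_add2l leq_mul2r; apply/orP; right.
  by rewrite /c1 /=; clear; nia.
pose c2 := c0 + j.+2 * (2 * Delta + 2).
pose K := Delta.+1 * (c2 + 6 * Delta + 10).
pose c0' := c0 + 2 * Delta + 3 + K ^ j.+2.
have c1E : c1 = cores_bound j.+1 c0' + K + 1 by [].
have KM : K * M <= n.
  by apply: leq_trans nbig; rewrite leq_mul2r c1E; apply/orP; right; clear; lia.
have K0 : 0 < K by rewrite muln_gt0 addn_gt0 orbT.
have KE : K = Delta * (c2 + 6 * Delta + 10) + (c2 + 6 * Delta + 10) by rewrite /K mulSn addnC.
have n3 : 3 * (Delta.+1 * M) <= n.
  by apply: leq_trans KM; rewrite mulnA leq_mul2r KE; apply/orP; right; clear; lia.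
have [|B [BX jB cB]] := chain_core M0 nK cX.
- by apply: leq_trans KM; rewrite leq_mul2r KE /c2; apply/orP; right; clear; lia.
have cB2 : n <= #|B| + c2 * M.
  apply: leq_trans cB _; rewrite leq_add2l leq_mul2r /c2 leq_add2l leq_mul2r.
  by rewrite leqW // !orbT.
(* [B] may lack [c2 * M] vertices and [expander_joined] uses up [(2 * Delta + 3) * M], so [B'] holds
   trees of [n - s] vertices and the part cut off must have at least [s]. *)
pose s := (c2 + 2 * Delta + 3) * M.
have sn : Delta * s < n.
  apply: leq_trans KM; rewrite KE /s mulnA -addn1; apply: leq_trans (leq_add (leqnn _) M0) _.
  by rewrite -mulSnr leq_mul2r; apply/orP; right; clear; nia.
have sn' : s + 3 * (Delta.+1 * M) <= n.
  apply: leq_trans KM; rewrite /s mulnA -mulnDl leq_mul2r KE; apply/orP; right; clear; lia.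
have [||B' [B'B cBB'] xB'] := expander_joined (Delta := Delta) e_sym (k := n - s) M0 jB.
- by move: sn'; clear; lia.
- by move: cB2 sn'; rewrite /s !mulnDl; clear; lia.
have B'X : B' \subset X by apply: subset_trans BX.
have jB' : joined e M M B' by apply: joined_sub jB B'B.
have MB' : M <= #|B'| by case: xB'.
have cB'n : #|B'| < n + (2 * Delta + 3) * M by apply: joined_small.
have cB' : n <= #|B'| + (c2 + 1) * M.
  by move: cB2 cBB'; rewrite cardsDS // mulnDl; clear; lia.
pose Y := (X :\: B') :&: nb e B'.
have YX : Y \subset X by apply: subset_trans (subsetIl _ _) (subsetDl _ _).
have cY : #|Y| < K ^ j.+2 * M.
  rewrite ltnNge; apply/negP => le.
  have nKY : ~ blueK e j.+3 M Y.
    case=> P [PY Pb]; apply: nK; exists P; split=> // i ij.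
    by have [h1 h2] := PY i ij; split=> //; apply: subset_trans YX.
  have [M1 [Y' [MM1 Y'Y jY' cY']]] := ramsey_joined e_sym K0 nKY le.
  have M10 : 0 < M1 by apply: leq_trans MM1.
  pose k2 := Delta * s + 3 * (Delta.+1 * M1).
  have [||Y'' [Y''Y' _] xY''] := expander_joined (Delta := Delta) e_sym (k := k2) M10 jY'.
  - exact: leq_addl.
  - apply: leq_trans cY'; rewrite /k2 /s.
    have : Delta * ((c2 + 2 * Delta + 3) * M) <= Delta * (c2 + 2 * Delta + 3) * M1.
      by rewrite mulnA leq_mul2l MM1 orbT.
    by rewrite KE; clear; nia.
  have /card_gt0P[u uY''] : 0 < #|Y''| by case: xY'' => _ _; apply: leq_trans.
  have uY := subsetP Y'Y _ (subsetP Y''Y' _ uY'').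
  move: (uY); rewrite in_setI => /andP[/setDP[_ uB'] /nbP[v vB' evu]].
  apply: nocopy; apply: (split_copy adj_sym adj_irr acyclic connected Delta_gt0 max_deg e_sym
    (s := s) (M1 := M) (M2 := M1) (k1 := n - s) (k2 := k2) (X1 := B') (X2 := Y'') (u1 := v) (u2
      := u)) => //.
  - by rewrite muln_gt0 M0 addnS.
  - by move: sn'; clear; lia.
  - exact: leq_addr.
  - rewrite disjoint_sym disjoint_subset; apply/subsetP => x /(subsetP Y''Y')/(subsetP Y'Y).
    by rewrite in_setI => /andP[/setDP[]].
pose X2 := X :\: (B' :|: nb e B').
have X2X : X2 \subset X by apply: subsetDl.
have bB : blue e B' X2.
  by have [d1 d2] := disjoint_setDU X B' (nb e B'); apply/(blue_sym e_sym)/blue_nonnb.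
have cX2 : #|X| <= #|X2| + #|B'| + #|Y|.
  have h1 := cardsID (B' :|: nb e B') X; rewrite -/X2 in h1.
  have : #|X :&: (B' :|: nb e B')| <= #|B'| + #|Y|.
    apply: leq_trans (leq_card_setU _ _); apply/subset_leq_card/subsetP => x.
    by rewrite !(in_setI, in_setU, in_setD); case: (x \in B') => //= /andP[-> ->].
  by move: h1; clear; lia.
have [|||Bs [BsX Bsj Bsd]] := IH X2 c0'.
- by move=> k2; apply: nK; apply: (blueK_add e_sym k2 X2X B'X).
- move: cX cX2 cY cB'n; rewrite mulSn /c0' !mulnDl; clear; lia.
- by apply: leq_trans nbig; rewrite leq_mul2r c1E -addnA leq_addr orbT.
exists (fun i => if i < j.+1 then Bs i else B'); split.
- move=> i _; case: ifP => // ij; exact: subset_trans (BsX i ij) X2X.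
- move=> i _; case: ifP => [ij|_].
    have [h1 h2] := Bsj i ij; split=> //; apply: leq_trans h2 _.
    by rewrite leq_add2l leq_mul2r c1E -[X in _ <= X]addnA leq_addr orbT.
  split=> //; apply: leq_trans cB' _; rewrite leq_add2l leq_mul2r c1E KE.
  by apply/orP; right; clear; lia.
- move=> i i' /andP[ii' i'j]; have ij : i < j.+1 by apply: leq_trans ii' _.
  rewrite ij; case: ifP => i'j'; first by apply: Bsd; rewrite ii'.
  by apply: disjointWl (BsX i ij) _; have [] := disjoint_setDU X B' (nb e B').
Qed.

End Structure.

Lemma nat_choice (A : Type) (a0 : A) m (Q : nat -> A -> Prop) :
  (forall i, i < m -> exists x, Q i x) -> exists f, forall i, i < m -> Q i (f i).
Proof.
elim: m => [|m IH] H; first by exists (fun=> a0).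
have [i im|f fQ] := IH; first by apply: H; apply: ltnW.
have [x xQ] := H m (ltnSn m); exists (fun i => if i == m then x else f i) => i.
by rewrite ltnS leq_eqVlt; case: eqP => [-> //|_ /= /fQ].
Qed.

Lemma card_bigcup_le (I V : finType) (A : {set I}) (F : I -> {set V}) c :
  (forall i, i \in A -> #|F i| <= c) -> #|\bigcup_(i in A) F i| <= #|A| * c.
Proof.
move=> Fc; rewrite -sum_nat_const; elim/big_ind2: _; rewrite ?cards0 //.
move=> X x Y y h1 h2; apply: leq_trans (leq_card_setU _ _) _; exact: leq_add.
Qed.

(** * Attaching the remaining vertices and collecting blue parts *)

Section Assembly.
Variables (T : finType) (adj : rel T).
Hypotheses (adj_sym : symmetric adj) (adj_irr : irreflexive adj).
Hypothesis acyclic : forall c : seq T, ucycle adj c -> size c < 3.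
Hypothesis connected : forall x y, connect adj x y.
Variable Delta : nat.
Hypotheses (Delta_gt0 : 0 < Delta).
Hypothesis max_deg : forall x, #|[set w | adj x w]| <= Delta.
Variables (V : finType) (e : rel V).
Hypothesis e_sym : symmetric e.
Implicit Types (A B S W X Y Z : {set V}).

Notation expander := (expander Delta e).
Notation n := #|T|.

(** The expansion is doubled and [M] is raised by one so that the set can absorb one more vertex and
    still be an expander. *)
Lemma robust_core M B : 0 < M -> joined e M M B -> (12 * Delta + 16) * M <= #|B| ->
  exists B', [/\ B' \subset B, #|B| <= #|B'| + M, joined e M M B' &
    extendable e M.+1 B' B' (fun=> Delta.+1.*2)].
Proof.
move=> M0 jB cB.
have [//|//||A AB cA|Z [ZB ZM _ gB _]] :=
  @trim V e B M.+1 Delta.+1.*2 (3 * (Delta.+1.*2 * M.+1)); first exact: leqnn.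
  have := joined_codense e_sym jB (subxx B) AB; rewrite cA => /(_ (leqnSn _)).
  rewrite -(leq_add2l #|nb e A :&: B|) setIC cardsID.
  by move: cB M0; rewrite -mul2n; clear; nia.
exists (B :\: Z); split=> //; first exact: subsetDl.
  by rewrite cardsDS //; move: ZM; clear; lia.
by apply: joined_sub jB (subsetDl _ _).
Qed.

(** A set that contains [v] and something else keeps at least half of its elements when [v] is
    dropped, and these expand by twice the factor; [v] alone has enough neighbours by assumption. *)
Lemma robust_expander M k B v : 0 < M -> joined e M M B ->
  extendable e M.+1 B B (fun=> Delta.+1.*2) -> Delta < #|nb e [set v] :&: B| ->
  k + (4 * Delta + 2) * M <= #|B| -> expander M.+1 k (v |: B).
Proof.
move=> M0 jB gB dv cB; have coB := joined_codense e_sym jB (subxx B).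
have vB S : S \subset v |: B -> S :\ v \subset B by rewrite subDset.
have cSv S : #|S| <= #|S :\ v| + 1 by rewrite (cardsD1 v S); case: (v \in S); clear; lia.
have nbD S : #|nb e (S :\ v) :&: B| <= #|nb e S :&: (v |: B)|.
  by apply/subset_leq_card/setISS; [apply/nbS/subD1set | apply: subsetUr].
split.
- move=> S SX S2; rewrite sum_nat_const.
  case: (posnP #|S :\ v|) => S0.
    case: (boolP (v \in S)) => vS; last first.
      by rewrite (cardsD1 v S) (negbTE vS) S0.
    have -> : S = [set v] by rewrite -(setD1K vS) (cards0_eq S0) setU0.
    rewrite cards1 mul1n; apply: leq_trans dv _.
    by rewrite subset_leq_card // setIS // subsetUr.
  apply: leq_trans (nbD S); apply: leq_trans (gB _ (vB _ SX) _); last first.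
    by apply: leq_trans S2; rewrite subset_leq_card // subD1set.
  by rewrite sum_nat_const -addnn; have := cSv S; move: S0; clear; nia.
- move=> S SX MS; apply: leq_trans (nbD S).
  have MS' : M <= #|S :\ v| by have := cSv S; move: MS; clear; lia.
  have := coB _ (vB _ SX) MS'; rewrite -(leq_add2l #|nb e (S :\ v) :&: B|) setIC cardsID.
  by move: cB M0; rewrite -mul2n; clear; nia.
- rewrite cardsU1; have : #|nb e [set v] :&: B| <= #|B| by rewrite subset_leq_card // subsetIr.
  by move: cB dv Delta_gt0 M0; clear; nia.
Qed.

(** The initial deficit is [j.+1], because [n.-1 * j.+1] falls short of [n * j.+1] by that much. *)
Definition cross_bound j := cores_bound Delta j.+1 j.+1.
Definition part_factor j := 3 * Delta + cross_bound j + 6.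
Definition size_factor j :=
  Delta.+1 * (cross_bound j + 4 * Delta + 3) + 12 * Delta + 17 + cross_bound j.

(** The sets [U i] in which excesses are counted partition all vertices. A vertex with more than
    [Delta] neighbours in a core is attached to that core, and the fewer than [M] vertices attached
    to none are put into [U 0]; their red neighbours are avoided when the other parts are chosen. *)
Lemma multipartite j M a : 0 < a -> a <= M -> n.-1 * j.+1 + a <= #|V| ->
  size_factor j * M <= n ->
  core_bound Delta * (part_factor j * M * (up_log 2 (part_factor j * M)).+1 ^ 3) <= n ->
  copy adj e \/ exists P : nat -> {set V}, [/\ a <= #|P 0|,
    forall i, 0 < i < j.+2 -> M <= #|P i| &
    forall i i', i < i' < j.+2 -> blue e (P i) (P i')].
Proof.
move=> a0 aM cV nbig ncore; case: (boolP [exists f : {ffun T -> V}, injectiveb f &&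
    [forall x, forall y, adj x y ==> e (f x) (f y)]]) => [/existsP[f /andP[/injectiveP fI
      /forallP fe]]|nf].
  by left; exists f; split=> // x y xy; have /forallP/(_ y) := fe x; rewrite xy.
right; have nocopy : ~ copy adj e.
  case=> f [fI fe]; case/negP: nf; apply/existsP; exists [ffun x => f x].
  apply/andP; split; first by apply/injectiveP => x y; rewrite !ffunE => /fI.
  by apply/forallP => x; apply/forallP => y; apply/implyP => xy; rewrite !ffunE fe.
have M0 : 0 < M by apply: leq_trans a0 aM.
case: (boolP [exists P : {ffun 'I_j.+2 -> {set V}}, [forall i, M <= #|P i|] &&
    [forall i : 'I_j.+2, forall i' : 'I_j.+2, (i < i') ==> blue e (P i) (P i')]]) => [|nK].
  case/existsP => P /andP[/forallP PM /forallP Pb]; exists (fun i => P (inord i)); split.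
  - exact: leq_trans aM (PM _).
  - by move=> i _; apply: PM.
  - move=> i i' /andP[ii' i'j]; have /forallP/(_ (inord i')) := Pb (inord i).
    by rewrite !inordK ?ii' // (ltn_trans ii').
have nK' : ~ blueK e j.+2 M setT.
  case=> P [PX Pb]; case/negP: nK; apply/existsP; exists [ffun i : 'I_j.+2 => P i].
  apply/andP; split; first by apply/forallP => i; rewrite ffunE; case: (PX i (ltn_ord i)).
  apply/forallP => i; apply/forallP => i'; apply/implyP => ii'.
  by rewrite !ffunE; apply: Pb; rewrite ii' ltn_ord.
set c1 := cross_bound j in nbig ncore.
have nb1 : Delta.+1 * (c1 + 4 * Delta + 3) * M + (12 * Delta + 17) * M + c1 * M <= n.
  by rewrite -!mulnDl; move: nbig; rewrite /size_factor -!addnA.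
have n0 : 0 < n by apply: leq_trans nb1; rewrite addnS /= !mulnDl; move: M0; clear; lia.
have n3 : 3 * (Delta.+1 * M) <= n by move: nb1; rewrite !mulnDl -mulnA mulSn; clear; nia.
have [||B [_ Bj Bd]] := cores adj_sym adj_irr acyclic connected Delta_gt0 max_deg e_sym nocopy
    (c0 := j.+1) M0 nK'.
- rewrite cardsT; move: cV M0; rewrite -{2}(prednK n0) mulnS mulnC; clear; nia.
- by rewrite -/(cross_bound j) -/c1; move: nb1; clear; lia.
pose jj i := i < j.+1.
have [|D DP] := @nat_choice _ set0 j.+1 (fun i B' => [/\ B' \subset B i,
    n <= #|B'| + (c1 + 1) * M, joined e M M B' & extendable e M.+1 B' B' (fun=> Delta.+1.*2)]).
  move=> i ij; have [jB cB] := Bj i ij; rewrite -/(cross_bound j) -/c1 in cB.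
  have [|B' [h1 h2 h3 h4]] := robust_core M0 jB.
    by move: nb1 cB; rewrite !mulnDl; clear; lia.
  by exists B'; split=> //; move: cB h2; rewrite mulnDl; clear; lia.
have Ddis i i' : jj i -> jj i' -> i != i' -> [disjoint D i & D i'].
  move=> ij i'j ne; have [s1 _ _ _] := DP i ij; have [s2 _ _ _] := DP i' i'j.
  apply: disjointWl s1 _; apply: disjointWr s2 _.
  case: (ltngtP i i') ne => // lt _; first by apply: Bd; rewrite lt.
  by rewrite disjoint_sym; apply: Bd; rewrite lt.
pose k := n - (c1 + 4 * Delta + 3) * M.
pose s := (c1 + 4 * Delta + 3) * M.
have sn : Delta * s + s < n.
  rewrite /s addnC -mulSn mulnA; move: nb1 M0; rewrite mulnDl; clear; lia.
(* An attached vertex forms an expander with its core and can be an end of the cut edge; as there is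
   no red tree, it is blue to all other cores. *)
pose att i := [set v | Delta < #|nb e [set v] :&: D i|].
have Datt i : jj i -> D i \subset att i.
  move=> ij; have [_ _ _ gD] := DP i ij; apply/subsetP => v vD; rewrite inE.
  have := gD [set v]; rewrite sub1set vD cards1 big_set1 => /(_ isT isT).
  by apply: leq_trans; rewrite -addnn leq_addr.
have ex i v : jj i -> v \in att i -> expander M.+1 k (v |: D i).
  move=> ij; rewrite inE => dv; have [_ cD jD gD] := DP i ij.
  apply: robust_expander => //; rewrite /k; move: cD nb1 sn; rewrite /s !mulnDl; clear; lia.
have noedge0 i i' u v : jj i -> jj i' -> i != i' -> v \in att i -> v \notin D i' -> u \in D i'
  -> ~~ e v u.
  move=> ij i'j ne va vD uD; apply/negP => evu; apply: nocopy.
  apply: (split_copy adj_sym adj_irr acyclic connected Delta_gt0 max_deg e_sym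
    (s := s) (k1 := k) (k2 := k) (u1 := v) (u2 := u) _ _ (ex i v ij va) (ex i' u i'j (subsetP
      (Datt _ i'j) _ uD))) => //.
  - by rewrite muln_gt0 M0 addnS.
  - by move: sn; clear; lia.
  - by rewrite /k -/s; move: sn; clear; lia.
  - by rewrite /k -/s; move: sn; clear; lia.
  - have -> : u |: D i' = D i' by apply/setUidPr; rewrite sub1set.
    apply/pred0P => x /=; rewrite in_setU1; case: eqP => [->|_] /=; first exact: negbTE.
    by have /pred0P/(_ x) := Ddis _ _ ij i'j ne.
  - by rewrite setU11.
  - by rewrite setU11.
have attE i v : v \in att i -> exists2 w, w \in D i & e v w.
  rewrite inE => dv; have /card_gt0P[w] := leq_ltn_trans (leq0n _) dv.
  by rewrite in_setI => /andP[/nbP[v' /set1P-> evw] wD]; exists w.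
have attD i i' v : jj i -> jj i' -> i != i' -> v \in att i -> v \notin D i'.
  move=> ij i'j ne va; apply/negP => vD; have [w wD evw] := attE i v va.
  have vD' : v \notin D i by rewrite (disjointFl (Ddis _ _ ij i'j ne)).
  have ne' : i' != i by rewrite eq_sym.
  by have := noedge0 i' i w v i'j ij ne' (subsetP (Datt _ i'j) _ vD) vD' wD; rewrite evw.
have battD i i' : jj i -> jj i' -> i != i' -> blue e (att i) (D i').
  move=> ij i'j ne; apply/blueP => v u va uD; have vD := attD i i' v ij i'j ne va.
  split; first by apply: contraNneq vD => ->.
  exact: (noedge0 i i').
have att_dis i i' : jj i -> jj i' -> i != i' -> [disjoint att i & att i'].
  move=> ij i'j ne; apply/pred0P => v /=; apply/negP => /andP[va /attE[w wD evw]].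
  by have /blueP/(_ v w va wD)[_] := battD i i' ij i'j ne; rewrite evw.
have cD i : jj i -> n <= #|D i| + (c1 + 1) * M by move=> /DP[].
have MD i : jj i -> M <= #|D i|.
  by move=> /cD; move: nb1; rewrite !mulnDl; clear; lia.
pose Z := ~: \bigcup_(i < j.+1) att i.
have Zatt i z : jj i -> z \in Z -> z \notin att i.
  by move=> ij; rewrite in_setC; apply: contra => za; apply/bigcupP; exists (Ordinal ij).
have nbZ i S : jj i -> S \subset Z -> #|nb e S :&: D i| <= #|S| * Delta.
  move=> ij SZ; apply: leq_trans (_ : #|\bigcup_(z in S) (nb e [set z] :&: D i)| <= _).
    apply/subset_leq_card/subsetP => x; rewrite in_setI => /andP[/nbP[z zS ezx] xD].
    apply/bigcupP; exists z => //; rewrite in_setI xD andbT; apply/nbP; exists z => //.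
    exact: set11.
  apply: card_bigcup_le => z /(subsetP SZ)/(Zatt i z ij).
  by rewrite inE -leqNgt.
have ZD i z : jj i -> z \in Z -> z \notin D i.
  by move=> ij /(Zatt i z ij); apply: contra; apply/subsetP/Datt.
have blZ i S : jj i -> S \subset Z -> blue e (D i :\: nb e S) S.
  move=> ij SZ; apply: blue_nonnb => //; last first.
    by apply/pred0P => x /=; rewrite in_setD andbC; case: (x \in nb e S); rewrite ?andbF.
  apply/pred0P => x /=; apply/negP => /andP[/setDP[xD _] /(subsetP SZ)/(ZD i x ij)].
  by rewrite xD.
have big_blue (P : nat -> {set V}) : (forall i, i < j.+2 -> M <= #|P i|) ->
    (forall i i', i < i' < j.+2 -> blue e (P i) (P i')) -> False.
  by move=> PM Pb; apply: nK'; exists P; split=> // i ij; rewrite subsetT PM.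
(* [M] unattached vertices have at most [Delta * M] neighbours in each core, so with the rest of the
   [j.+1] cores they would be the [j.+2] parts of a blue multipartite graph. *)
have cZ : #|Z| < M.
  rewrite ltnNge; apply/negP => /subset_of_card[Z' Z'Z cZ'].
  apply: (big_blue (fun i => if i < j.+1 then D i :\: nb e Z' else Z')).
    move=> i _; case: ifP => ij; last by rewrite cZ'.
    have := cardsID (nb e Z') (D i); rewrite setIC; have := nbZ i Z' ij Z'Z; have := cD i ij.
    by move: nb1; rewrite cZ' !mulnDl; clear; lia.
  move=> i i' /andP[ii' i'j]; have ij : i < j.+1 by apply: leq_trans ii' _.
  rewrite ij; case: ifP => i'j'; last exact: blZ.
  apply: (blueS (battD i i' ij i'j' _)); first by rewrite ltn_eqF.
    exact: subset_trans (subsetDl _ _) (Datt i ij).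
  exact: subsetDl.
(* A blue pair inside [att i] would take the place of [D i] among the [j.+1] cores and give [j.+2]
   blue parts. *)
have jatt i : jj i -> joined e M M (att i).
  move=> ij; case: (joined_or_blue e M M (att i)) => // -[A1 [A2 [A1a A2a cA1 cA2 bl]]].
  have bA A l : A \subset att i -> jj l -> l != i -> blue e A (D l).
    move=> Aa lj li; apply: (blueS (battD i l ij lj _)) => //.
    by rewrite eq_sym.
  have bD l l' : jj l -> jj l' -> l != l' -> blue e (D l) (D l').
    by move=> lj l'j ne; apply: (blueS (battD l l' lj l'j ne)) => //; apply: Datt.
  case: (big_blue (fun l => if l == i then A1 else if l < j.+1 then D l else A2)).
    by move=> l _; case: ifP => // _; case: ifP => // lj; apply: MD.
  move=> l l' /andP[ll' l'j]; have lj : l < j.+1 by apply: leq_trans ll' _.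
  case: (eqVneq l i) => [E|li]; case: (eqVneq l' i) => [E'|l'i].
  - by rewrite E E' ltnn in ll'.
  - by case: ifP => // l'j'; apply: bA.
  - by rewrite lj; apply/(blue_sym e_sym)/bA.
  - rewrite lj; case: ifP => l'j'; last by apply/(blue_sym e_sym)/bA.
    by apply: bD => //; rewrite ltn_eqF.
have catt i : jj i -> #|att i| < n + (2 * Delta + 3) * M.
  move=> ij; apply: (joined_small adj_sym adj_irr acyclic connected max_deg e_sym nocopy) => //.
  exact: jatt.
pose U i := if i == 0 then att 0 :|: Z else att i.
have cU i : jj i -> #|U i| <= n + (2 * Delta + 4) * M.
  move=> ij; have := catt i ij; rewrite /U; case: eqP => [->|_].
    have : #|att 0 :|: Z| <= #|att 0| + #|Z| by rewrite leq_card_setU.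
    by move: cZ; rewrite !mulnDl; clear; lia.
  by rewrite !mulnDl; clear; lia.
have Udis i i' : i < i' < j.+1 -> [disjoint U i & U i'].
  move=> /andP[ii' i'j]; have ij : i < j.+1 by apply: ltn_trans ii' i'j.
  have i'0 : i' != 0 by rewrite -lt0n (leq_ltn_trans _ ii').
  rewrite /U (negbTE i'0); have dd := att_dis i i' ij i'j (negbT (ltn_eqF ii')).
  case: eqP => [i0|//]; rewrite i0 in dd.
  apply/pred0P => x /=; apply/negP => /andP[/setUP[xa xa'|xZ]].
    by have /pred0P/(_ x) := dd; rewrite /= xa xa'.
  by move: (Zatt i' x i'j xZ) => /negbTE->.
have sumU : \sum_(i < j.+1) #|U i| = #|V|.
  rewrite -(card_bigcup_disj Udis) -cardsT; apply: eq_card => x; rewrite [RHS]inE.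
  case: (boolP (x \in Z)) => [xZ|].
    by apply/bigcupP; exists ord0; rewrite // /U /= inE xZ orbT.
  rewrite in_setC negbK => /bigcupP[i _ xi]; apply/bigcupP; exists i => //.
  by rewrite /U; case: eqP => // i0; rewrite inE -i0 xi.
pose D2 i := D i :\: nb e Z.
have cD2 i : jj i -> n <= #|D2 i| + (c1 + 1 + Delta) * M.
  move=> ij; have := cardsID (nb e Z) (D i); rewrite setIC -/(D2 i).
  have := nbZ i Z ij (subxx _); have := cD i ij; move: cZ; rewrite !mulnDl.
  by clear; nia.
have D2U i : jj i -> D2 i \subset U i.
  move=> ij; apply: subset_trans (subsetDl _ _) _; apply: subset_trans (Datt i ij) _.
  by rewrite /U; case: eqP => [->|_] //; apply: subsetUl.
have bUD i l : jj i -> jj l -> i != l -> blue e (U i) (D2 l).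
  move=> ij lj ne; have ba := battD i l ij lj ne.
  have bl := blue_sym e_sym (blZ l Z lj (subxx _)).
  apply/blueP => x y xU yD; have yDl := subsetP (subsetDl _ _) _ yD.
  move: xU; rewrite /U; case: eqP => [i0|_]; last by move=> xa; have /blueP := ba; apply.
  rewrite i0 in ba; case/setUP => xx; first by have /blueP := ba; apply.
  by have /blueP := bl; apply.
(* [U i] has at most [(3 * Delta + c1 + 5) * M] vertices outside [D2 i], so any [M2] of its vertices
   include at least [M] vertices of [D2 i]. *)
set pf := part_factor j in ncore; set M2 := pf * M in ncore.
have pfE : pf = 3 * Delta + c1 + 6 by [].
have MM2 : M <= M2 by rewrite /M2 leq_pmull // pfE addnS.
have M20 : 0 < M2 by apply: leq_trans MM2.
have [y _] := card_gt0P n0.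
have [p [pP pD pcopy]] := tree_in_copy adj_sym adj_irr acyclic connected max_deg e_sym y.
have [|XY XYP] := @nat_choice _ (set0, set0) j.+1 (fun i (AB : {set V} * {set V}) =>
    [/\ AB.1 \subset U i, AB.2 \subset U i, minn M (#|U i| - n.-1) <= #|AB.1|,
        M2 <= #|AB.2| & blue e AB.1 AB.2]).
  move=> i ij; set b := minn _ _; case: (posnP b) => b0.
    exists (set0, U i); split; rewrite ?sub0set //=.
    - by rewrite b0.
    - apply: leq_trans (subset_leq_card (D2U i ij)); have := cD2 i ij.
      by move: nb1; rewrite /M2 pfE !mulnDl; clear -Delta_gt0 M0; nia.
    - by apply/blueP => x z; rewrite inE.
  case: (joined_or_blue e b M2 (U i)) => [jU|[A [A' [h1 h2 h3 h4 h5]]]]; last by exists (A, A').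
  case: nocopy; apply: (pcopy (U i)).
  apply: (core e_sym M20 Delta_gt0 b0 _ jU _ pP pD ncore).
    by apply: leq_trans MM2; rewrite /b geq_minl.
  by move: b0; rewrite /b; clear; lia.
pose Xs i := (XY i).1; pose Ys i := (XY i).2.
exists (fun i => if i is i'.+1 then Ys i' :&: D2 i' else \bigcup_(l < j.+1) Xs l).
have Xdis i i' : i < i' < j.+1 -> [disjoint Xs i & Xs i'].
  move=> /andP[ii' i'j]; have ij : i < j.+1 by apply: ltn_trans ii' i'j.
  have [s1 _ _ _ _] := XYP i ij; have [s2 _ _ _ _] := XYP i' i'j.
  by apply: disjointWl s1 _; apply: disjointWr s2 _; apply: Udis; rewrite ii'.
split.
- rewrite (card_bigcup_disj Xdis).
  have le : \sum_(i < j.+1) minn M (#|U i| - n.-1) <= \sum_(i < j.+1) #|Xs i|.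
    by apply: leq_sum => i _; have [_ _ h _ _] := XYP i (ltn_ord i).
  (* The excesses are truncated at [M]. If one of them is truncated it alone is at least [a];
     otherwise they sum to at least [#|V| - n.-1 * j.+1]. *)
  apply: leq_trans le; case: (boolP [exists i : 'I_j.+1, M <= #|U i| - n.-1]).
    case/existsP => i Mi; rewrite (bigD1 i) //= (minn_idPl Mi).
    exact: leq_trans aM (leq_addr _ _).
  move/existsPn => lt.
  have : \sum_(i < j.+1) #|U i| <= \sum_(i < j.+1) (minn M (#|U i| - n.-1) + n.-1).
    apply: leq_sum => i _; have := lt i; rewrite -ltnNge => lti.
    by rewrite (minn_idPr (ltnW lti)); clear; lia.
  rewrite sumU big_split /= sum_nat_const card_ord [j.+1 * _]mulnC.
  by move: cV; move: (n.-1 * j.+1) #|V| => x z; clear; lia.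
- move=> [//|i] /=; rewrite ltnS => ij; have [_ YU _ cY _] := XYP i ij.
  have := cardsID (D2 i) (Ys i).
  have : #|Ys i :\: D2 i| <= #|U i :\: D2 i| by rewrite subset_leq_card // setSD.
  rewrite [#|U i :\: _|]cardsDS ?D2U //.
  have := cU i ij; have := cD2 i ij; move: cY; rewrite -/(Ys i) /M2 pfE !mulnDl; clear; lia.
- move=> [|i] [|i'] //= ii'.
    have i'j : jj i' by move: ii'; rewrite /jj; clear; lia.
    have [_ YU _ _ _] := XYP i' i'j.
    apply/blueP => x z /bigcupP[l _ xl] /setIP[zY zD].
    have [XU _ _ _ bl] := XYP l (ltn_ord l).
    case: (eqVneq (val l) i') => [E|ne].
      by move: xl bl; rewrite /= E => xl /blueP; apply.
    by have /blueP := bUD l i' (ltn_ord l) i'j ne; apply=> //; apply: (subsetP XU).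
  have [{}ii' ij i'j] : [/\ i < i', jj i & jj i'].
    by move: ii'; rewrite /jj; clear => ?; split; lia.
  have [_ YU _ _ _] := XYP i ij.
  apply: (blueS (bUD i i' ij i'j (negbT (ltn_eqF ii')))).
    by apply: subset_trans (subsetIl _ _) YU.
  exact: subsetIr.
Qed.

End Assembly.

(** * Complete multipartite graphs *)

Section Greedy.
Variables (V : finType) (e : rel V).
Hypotheses (e_sym : symmetric e) (e_irr : irreflexive e).
Implicit Types W : {set V}.

(** The parent is among the at most [n.-1] vertices already placed but is not its own neighbour, so
    a degree of [n.-1] leaves a free neighbour. *)
Lemma greedy_tree p n W : W != set0 -> is_parent p n ->
  (forall v, v \in W -> n.-1 <= #|nb e [set v] :&: W|) -> tree_in e p n W.
Proof.
case/set0Pn => w wW pP deg.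
suff H t : t <= n -> tree_in e p t W by apply: H.
elim: t => [|t IH] tn; first by exists (fun=> w); split=> // -[].
have [f [fI fW fe]] := IH (ltnW tn).
pose U := [set f (val i) | i : 'I_t].
have fU i : i < t -> f i \in U by move=> it; apply/imsetP; exists (Ordinal it).
have cU : #|U| <= t by rewrite -[X in _ <= X]card_ord leq_imset_card.
have [z [zW zU fz]] : exists z, [/\ z \in W, z \notin U & 0 < t -> e (f (p t)) z].
  have [t0|t0] := posnP t.
    by exists w; split; rewrite ?t0 //; apply/imsetP => -[i]; have := ltn_ord i; rewrite {2}t0.
  have pt : p t < t by apply: pP; rewrite t0.
  pose v := f (p t); have vW : v \in W by apply: fW.
  have vU : v \in U by apply: fU.
  have : 0 < #|nb e [set v] :&: W :\: U|.
    have /subset_leq_card : nb e [set v] :&: W :&: U \subset U :\ v.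
      apply/subsetP => x; rewrite in_setI in_setI in_setD1.
      case/andP => /andP[/nbP[_ /set1P-> evx] _] ->; rewrite andbT.
      by apply: contraTneq evx => ->; rewrite e_irr.
    have := cardsID U (nb e [set v] :&: W); have := deg v vW.
    by rewrite (cardsD1 v) vU in cU; move: cU tn; clear; lia.
  case/card_gt0P => z; rewrite in_setD in_setI => /and3P[zU /nbP[_ /set1P-> evz] zW].
  by exists z.
have zf i : i < t -> f i != z by move=> it; apply: contraNneq zU => <-; apply: fU.
exists (fun i => if i == t then z else f i); split.
- move=> i j; rewrite !unfold_in /= !ltnS.
  case: (eqVneq i t) => [->|it] ilt; case: (eqVneq j t) => [->|jt] jlt //.
  + by move=> E; have := zf j; rewrite ltn_neqAle jt jlt -E eqxx => /(_ isT).
  + by move=> E; have := zf i; rewrite ltn_neqAle it ilt E eqxx => /(_ isT).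
  + by apply: fI; rewrite unfold_in /= ltn_neqAle ?it ?jt.
- by move=> i; case: eqVneq => // it; rewrite ltnS leq_eqVlt (negbTE it) => /fW.
- move=> i /andP[i0]; rewrite ltnS leq_eqVlt; case: (eqVneq i t) => [Ei|it] /= ilt.
    have t0 : 0 < t by rewrite -Ei.
    by rewrite Ei ltn_eqF ?fz // pP // t0.
  have pi : p i < i by apply: pP; rewrite i0 (ltn_trans ilt).
  by rewrite ltn_eqF ?fe ?i0 // (ltn_trans pi).
Qed.

(** A vertex of red degree less than [n.-1] is removed together with its neighbours, at most [n.-1]
    vertices in all, and is blue to the rest; if there is none, the tree embeds greedily. *)
Lemma chvatal p n k W : is_parent p n -> n.-1 * k < #|W| ->
  tree_in e p n W \/ blueK e k.+1 1 W.
Proof.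
move=> pP; elim: k W => [|k IH] W; rewrite ?muln0 => cW.
  by right; exists (fun=> W); split=> [i _|i i' /andP[h1 h2]]; last by case: i' h1 h2.
case: (boolP [exists v in W, #|nb e [set v] :&: W| < n.-1]) => [/exists_inP[v vW dv]|].
  pose W' := W :\: (v |: nb e [set v]).
  have W'W : W' \subset W by apply: subsetDl.
  have cW' : n.-1 * k < #|W'|.
    have := cardsID (v |: nb e [set v]) W; rewrite -/W' setIC setIUl.
    have -> : [set v] :&: W = [set v] by apply/setIidPl; rewrite sub1set.
    have := (leq_card_setU [set v] (nb e [set v] :&: W)).1; rewrite cards1.
    by move: cW dv; rewrite mulnS; clear; lia.
  have [[f [fI fW fe]]|bK] := IH W' cW'; [left | right].
    by exists f; split=> // i /fW; apply: subsetP.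
  apply: (blueK_add e_sym bK W'W (A := [set v])); rewrite ?sub1set ?cards1 //.
  apply/blueP => x y /set1P-> /setDP[_]; rewrite in_setU1 negb_or eq_sym => /andP[-> yv].
  by split=> //; apply: contra yv => evy; apply/nbP; exists v; rewrite ?set11.
move/exists_inPn => deg; left; apply: greedy_tree => //.
  by rewrite -card_gt0 (leq_ltn_trans _ cW).
by move=> v /deg; rewrite -leqNgt.
Qed.

End Greedy.

Lemma bigminn_le (I : finType) (Q : pred I) (F : I -> nat) d i :
  Q i -> \big[minn/d]_(l | Q l) F l <= F i.
Proof.
rewrite -big_filter => Qi; have : i \in [seq l <- index_enum I | Q l].
  by rewrite mem_filter Qi mem_index_enum.
elim: [seq _ <- _ | _] => // x s IH; rewrite big_cons inE => /predU1P[->|/IH].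
  exact: geq_minl.
by apply: leq_trans; apply: geq_minr.
Qed.

Lemma bigminn_ge (I : finType) (Q : pred I) (F : I -> nat) d b :
  b <= d -> (forall i, Q i -> b <= F i) -> b <= \big[minn/d]_(l | Q l) F l.
Proof.
by move=> bd bF; elim/big_ind: _ => // x y bx yb; rewrite leq_min bx.
Qed.

Section Multipartite.
Variables (k : nat) (m : k.-tuple nat).
Hypothesis m_gt0 : forall i, 0 < tnth m i.
Notation H := (complete_multipartite m).

Definition part_vertex i (u : 'I_(tnth m i)) : H := Tagged _ u.

Definition corner i : H := part_vertex (Ordinal (m_gt0 i)).

Lemma corner_inj n (g : H -> 'I_n) : (forall x y : H, adj x y -> g x != g y) ->
  injective (g \o corner).
Proof.
move=> gP i j /= /eqP; apply: contraTeq => ij; exact: (gP (corner i) (corner j)).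
Qed.

(** The corners form a clique and use each of the [k] colours once. A vertex is adjacent to all
    corners but that of its own part, so it has the colour of that one. *)
Lemma colour_class (g : H -> 'I_k) : (forall x y : H, adj x y -> g x != g y) ->
  forall c, exists i, forall u : 'I_(tnth m i), g (part_vertex u) = c.
Proof.
move=> gP c; have gI := corner_inj gP.
have /codomP[i ->] := inj_card_onto gI (leqnn _) c; exists i => u.
have /codomP[l El] := inj_card_onto gI (leqnn _) (g (part_vertex u)).
rewrite El; case: (eqVneq i l) => [->//|il].
by have /eqP := gP (part_vertex u) (corner l) il.
Qed.

Lemma tag_proper : proper_colouring [ffun x : H => tag x].
Proof.
by apply/forallP => x; apply/forallP => y; apply/implyP; rewrite !ffunE.
Qed.

Lemma chromatic_multipartite : chromatic_number H = k.
Proof.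
rewrite /chromatic_number; case: ex_minnP => n /existsP[f /forallP fP] n_min.
apply/eqP; rewrite eqn_leq n_min /=; last first.
  by apply/existsP; exists [ffun x : H => tag x]; apply: tag_proper.
have fP' x y : adj x y -> f x != f y by move=> xy; have /forallP/(_ y) := fP x; rewrite xy.
by have := leq_card _ (corner_inj fP'); rewrite !card_ord.
Qed.

Lemma card_part i : #|[set x : H | tag x == i]| = tnth m i.
Proof.
rewrite -[RHS]card_ord -(card_imset predT (f := @part_vertex i)).
  apply: eq_card => x; rewrite inE; apply/eqP/imsetP => [<-|[u _ ->] //].
  by exists (tagged x) => //; case: x.
by move=> u v /eqP; rewrite eq_Tagged => /eqP.
Qed.

Lemma sigma_multipartite b (i0 : 'I_k) : tnth m i0 = b ->
  (forall i, b <= tnth m i) -> sigma H = b.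
Proof.
move=> mi0 bm; rewrite /sigma; move: (chromatic_number H) chromatic_multipartite.
move=> _ ->; have bH : b <= #|H| by rewrite -mi0 -card_part max_card.
apply/eqP; rewrite eqn_leq; apply/andP; split.
  apply: leq_trans (bigminn_le _ _ tag_proper) _.
  apply: leq_trans (bigminn_le _ _ (i := i0) isT) _.
  rewrite -mi0 -card_part subset_leq_card //.
  by apply/subsetP => x; rewrite !inE ffunE.
apply: bigminn_ge => // f /forallP fP; apply: bigminn_ge => // c _.
have [|i ic] := @colour_class f _ c.
  by move=> x y xy; have /forallP/(_ y) := fP x; rewrite xy.
apply: leq_trans (bm i) _; rewrite -card_part subset_leq_card //.
apply/subsetP => -[l u]; rewrite !inE /= => /eqP E; subst l.
by rewrite -(ic u).
Qed.

Lemma blue_multipartite (V : finType) (e : rel V) (P : nat -> {set V}) :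
  (forall i : 'I_k, tnth m i <= #|P i|) ->
  (forall i i', i < i' < k -> blue e (P i) (P i')) -> symmetric e ->
  exists2 f : H -> V, injective f & forall x y : H, adj x y -> f x != f y /\ ~~ e (f x) (f y).
Proof.
move=> mP bP e_sym; pose f (x : H) := enum_val (widen_ord (mP (tag x)) (tagged x)).
have fP x : f x \in P (tag x) by apply: enum_valP.
have fb x y : adj x y -> f x != f y /\ ~~ e (f x) (f y).
  rewrite /adj /= /multipartite_adj => ne; case: (ltngtP (tag x) (tag y)) => lt.
  - have := bP (tag x) (tag y); rewrite lt ltn_ord => /(_ isT)/blueP; exact.
  - rewrite eq_sym e_sym.
    have := bP (tag y) (tag x); rewrite lt ltn_ord => /(_ isT)/blueP; exact.
  - by rewrite (ord_inj lt) eqxx in ne.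
exists f => // x y fxy; case: (eqVneq (tag x) (tag y)) => [E|ne]; last first.
  by have [/eqP] := fb x y ne.
case: x y fxy E => [i u] [i' v] + /= E; subst i'; rewrite /f /= => /enum_val_inj.
by move=> [/ord_inj->].
Qed.

End Multipartite.

(** * The two bounds on the Ramsey number *)

Lemma ramsey_lower (T : sgraph) k (m : k.-tuple nat) b N : connected_graph T ->
  (forall i, b <= tnth m i) -> 0 < b <= #|T| -> 0 < k ->
  ramsey_arrow N T (complete_multipartite m) -> #|T|.-1 * k.-1 + b <= N.
Proof.
move=> [T0 Tc] bm /andP[b0 bT] k0 arr; rewrite leqNgt; apply/negP => Nlt.
set q := #|T|.-1 in Nlt.
pose c (S : {set 'I_N}) := [forall x in S, forall y in S, x %/ q == y %/ q].
have cE x y : c [set x; y] = (x %/ q == y %/ q).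
  apply/forall_inP/eqP => [h|h z /set2P[]->]; last 2 first.
  - by apply/forall_inP => z' /set2P[]->; rewrite // h.
  - by apply/forall_inP => z' /set2P[]->; rewrite // h.
  by have /forall_inP/(_ y (set22 x y))/eqP := h x (set21 x y).
(* If [q = 0] then [N < b <= #|T| <= 1], so there is no vertex at all. *)
have q0 (x : 'I_N) : 0 < q.
  rewrite lt0n; apply/eqP => qE; rewrite qE mul0n in Nlt.
  by move: Nlt (ltn_ord x) bT qE; rewrite /q; clear; lia.
have [[f fI fc]|[f fI fc]] := arr c.
- have fE x y : f x %/ q = f y %/ q.
    have /connectP[s + ->] := Tc x y; elim: s x => //= z s IH x /andP[xz /IH <-].
    by apply/eqP; rewrite -cE fc.
  have /card_gt0P[x0 _] := T0; have qx := q0 (f x0).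
  pose g x := Ordinal (ltn_pmod (f x) qx).
  have gI : injective g.
    move=> x y [E]; apply/fI/val_inj; rewrite /= (divn_eq (f x) q) (divn_eq (f y) q).
    by rewrite E (fE x y).
  have := leq_card g gI; rewrite card_ord /q; move: T0; clear; lia.
have m0 i : 0 < tnth m i by apply: leq_trans b0 (bm i).
have fk x : f x %/ q < k.
  rewrite ltn_divLR ?(q0 (f x)) // (leq_trans (ltn_ord _)) // -(prednK k0) mulSn mulnC.
  by move: Nlt bT; rewrite /q; clear; lia.
have kk : k.-1 < k by rewrite prednK.
(* Block numbers properly colour a blue copy with [k] colours, so one whole part lies in the last
   block, which has fewer than [b] vertices. *)
have [|i iP] := @colour_class _ _ m0 (fun x => Ordinal (fk x)) _ (Ordinal kk).
  by move=> x y xy; rewrite -val_eqE /= -cE fc.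
have fi (u : 'I_(tnth m i)) : q * k.-1 <= f (part_vertex u).
  have E : f (part_vertex u) %/ q = k.-1 := congr1 val (iP u).
  by rewrite -E mulnC leq_trunc_div.
have lt (u : 'I_(tnth m i)) : f (part_vertex u) - q * k.-1 < b.-1.
  by have := fi u; have := ltn_ord (f (part_vertex u)); move: Nlt; clear; lia.
pose g u := Ordinal (lt u).
have gI : injective g.
  move=> u v [E]; have /fI : f (part_vertex u) = f (part_vertex v).
    by apply/val_inj; rewrite /= -(subnKC (fi u)) E subnKC.
  by move/eqP; rewrite eq_Tagged => /eqP.
have := leq_card g gI; rewrite !card_ord; have := bm i; move: b0; clear; lia.
Qed.

Definition link_rel N (c : {set 'I_N} -> bool) : rel 'I_N :=
  fun x y => (x != y) && c [set x; y].

(** With [j.+1] parts there are [j] joined sets, hence the index [j.-1]. The size bounds are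
    conditional on [1 < M], since for [M = 1] the logarithm vanishes and gives no bound on
    [#|T|]. *)
Lemma ramsey_upper (T : sgraph) Delta j (m : j.+1.-tuple nat) M : is_tree T ->
  max_degree T <= Delta -> 0 < Delta -> 0 < tnth m ord0 ->
  (forall i, tnth m ord0 <= tnth m i <= M) ->
  (1 < M -> size_factor Delta j.-1 * M <= #|T| /\
    core_bound Delta * (part_factor Delta j.-1 * M *
      (up_log 2 (part_factor Delta j.-1 * M)).+1 ^ 3) <= #|T|) ->
  ramsey_arrow (#|T|.-1 * j + tnth m ord0) T (complete_multipartite m).
Proof.
move=> [[T0 Tc] Ta] deg D0 a0 mP big c; pose e := link_rel c.
have e_sym : symmetric e by move=> x y; rewrite /e /link_rel eq_sym setUC.
have e_irr : irreflexive e by move=> x; rewrite /e /link_rel eqxx.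
have max_deg x : #|[set w : T | adj x w]| <= Delta.
  by apply: leq_trans deg; apply: (@leq_bigmax _ (fun v : T => #|[set w : T | adj v w]|)).
have [y _] := card_gt0P T0.
suff [[f [fI fe]]|[P [P0 PM Pb]]] : copy (@adj T) e \/ exists P : nat -> {set 'I_(#|T|.-1 * j +
  tnth m ord0)},
    [/\ tnth m ord0 <= #|P 0|, forall i, 0 < i < j.+1 -> M <= #|P i| &
        forall i i', i < i' < j.+1 -> blue e (P i) (P i')].
- by left; exists f => // x z /fe/andP[].
- have mPc (i : 'I_j.+1) : tnth m i <= #|P i|.
    case: (posnP i) => i0; first by rewrite i0 (_ : i = ord0) //; apply: val_inj.
    by have /andP[_ iM] := mP i; rewrite (leq_trans iM) // PM // i0 ltn_ord.
  have [f fI fb] := blue_multipartite mPc Pb e_sym.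
  right; exists f => // x z /fb[ne]; rewrite /e /link_rel ne /=.
  by case: (c _).
have sym := @adj_sym T; have irr := @adj_irrefl T.
case: j m a0 mP big c @e e_sym e_irr => [|j] m a0 mP big c e e_sym e_irr.
  right; exists (fun=> setT); split.
  - by rewrite cardsT card_ord muln0.
  - by case.
  - by move=> [|i] [|i'] // /andP[_].
have /andP[a1 aM] := mP ord0.
have M0 : 0 < M by apply: leq_trans aM.
case: (ltngtP M 1) => [|M1|M1]; first by rewrite ltnS leqNgt M0.
  have [h1 h2] := big M1.
  apply: (multipartite sym irr Ta Tc D0 max_deg e_sym a0 aM) => //.
  by rewrite card_ord.
have aE : tnth m ord0 = 1 by apply/eqP; rewrite eqn_leq a0 -M1 aM.
have [p [pP _ pcopy]] := tree_in_copy sym irr Ta Tc max_deg e_sym y.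
have [|tW|[P [PX Pb]]] := @chvatal _ e e_sym e_irr p #|T| j.+1 setT pP.
- by rewrite cardsT card_ord aE addn1.
- by left; apply: (pcopy setT).
- right; exists P; split=> // [|i /andP[_ ij]]; last by rewrite M1; case: (PX i).
  by apply: leq_trans (_ : 1 <= _); [rewrite aE | case: (PX 0)].
Qed.

(** * Logarithms and the constant *)

Lemma up_log_cube q M : 0 < q -> 1 < M ->
  M * (up_log 2 (q * M)).+1 ^ 3 <= (up_log 2 q + 3) ^ 3 * (M * trunc_log 2 M ^ 4).
Proof.
move=> q0 M1; set t := trunc_log 2 M; set u := up_log 2 q.
have t0 : 0 < t by rewrite trunc_log_max.
have ul : up_log 2 (q * M) <= u + t.+1.
  by rewrite up_log_min // expnD leq_mul ?up_logP // ltnW // trunc_log_ltn.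
rewrite mulnCA leq_mul2l; apply/orP; right.
(* As [t >= 1], it absorbs the constants: [u + t + 2 <= (u + 3) * t]. *)
apply: leq_trans (_ : ((u + 3) * t) ^ 3 <= _).
  by rewrite leq_exp2r //; move: ul t0; clear; nia.
by rewrite expnMn leq_mul2l leq_pexp2l ?orbT.
Qed.

Definition ramsey_factor Delta j :=
  size_factor Delta j + core_bound Delta * (part_factor Delta j * (up_log 2 (part_factor Delta
    j) + 3) ^ 3).

Lemma ramsey_factorP Delta j M n : 1 < M -> ramsey_factor Delta j * (M * trunc_log 2 M ^ 4) <= n
  ->
  size_factor Delta j * M <= n /\
  core_bound Delta * (part_factor Delta j * M *
    (up_log 2 (part_factor Delta j * M)).+1 ^ 3) <= n.
Proof.
move=> M1; rewrite /ramsey_factor;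
  have q0 : 0 < part_factor Delta j by rewrite /part_factor addnS.
have := up_log_cube q0 M1; move: (part_factor _ _) q0 => q q0; set L := (_ + 3) ^ 3;
  set t := trunc_log 2 M.
have t0 : 0 < t ^ 4 by rewrite expn_gt0 trunc_log_max.
rewrite mulnDl => h le; split.
  by apply: leq_trans (leq_trans (leq_addr _ _) le); rewrite leq_mul2l leq_pmulr ?orbT.
apply: leq_trans (leq_trans (leq_addl _ _) le).
by rewrite -[q * M * _]mulnA -[leqRHS]mulnA leq_mul2l -[q * L * _]mulnA leq_mul2l h !orbT.
Qed.

Import Order.TTheory GRing.Theory Num.Theory.
Local Open Scope ring_scope.

(** The constant comes from [ln 2 >= 1/2], which follows from [expR (- 1/2) >= 1 - 1/2]. *)
Lemma trunc_log_ln (R : realType) (M : nat) : (0 < M)%N ->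
  (trunc_log 2 M)%:R / 2 <= ln M%:R :> R.
Proof.
move=> M0; have ln2 : 2^-1 <= ln 2 :> R.
  have e2 : expR (- 2^-1) >= 2^-1 :> R.
    by apply: le_trans (expR_ge1Dx _); rewrite [X in X - _](splitr 1) mul1r addrK.
  rewrite -ler_expR lnK ?posrE //; rewrite expRN in e2.
  by rewrite -lef_pV2 ?posrE ?expR_gt0.
apply: le_trans (_ : ln 2 *+ trunc_log 2 M <= _).
  by rewrite -[leRHS]mulr_natl ler_wpM2l.
rewrite -lnXn // ler_ln ?posrE ?exprn_gt0 ?ltr0n //.
by rewrite -natrX ler_nat trunc_logP.
Qed.

Lemma ramsey_factor_ln (R : realType) (K M n : nat) : (0 < M)%N ->
  (K * 16)%:R * M%:R * ln M%:R ^+ 4 <= n%:R :> R -> (K * (M * trunc_log 2 M ^ 4) <= n)%N.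
Proof.
move=> M0 le; rewrite -(ler_nat R); apply: le_trans le.
rewrite 2!(natrM _ K) (natrM _ M) -!mulrA ler_wpM2l // [leRHS]mulrCA ler_wpM2l //.
(* 16 is the fourth power of the factor 2 lost in [trunc_log_ln]. *)
apply: le_trans (_ : 16 * ((trunc_log 2 M)%:R / 2) ^+ 4 <= _).
  by rewrite exprMn exprVn natrX -(natrX _ 2 4) mulrCA mulfV ?mulr1 ?pnatr_eq0.
by rewrite ler_wpM2l // lerXn2r ?nnegrE ?divr_ge0 // (le_trans _ (trunc_log_ln R M0)) ?divr_ge0.
Qed.

Theorem theorem2p1 (R : realType) (Delta k : nat)
  (Delta_gt0 : (0 < Delta)%N) (k_gt0 : (0 < k)%N) :
  exists C : R,
    forall (T : sgraph) (m : k.-tuple nat),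
      is_tree T ->
      (max_degree T <= Delta)%N ->
      all (fun i => 0 < i)%N m ->
      sorted leq m ->
      C * (last 0%N m)%:R * ln (last 0%N m)%:R ^+ 4 <= #|T|%:R ->
      good T (complete_multipartite m) /\
      is_ramsey_number T (complete_multipartite m)
        ((#|T| - 1) * (k - 1) + head 0 m)%N.
Proof.
case: k k_gt0 => // j _;
  exists (ramsey_factor Delta j.-1 * 16)%:R => T m treeT degT m_pos m_sorted.
set M := last 0%N m; rewrite !subn1 => le.
have m_gt0 i : (0 < tnth m i)%N by have /all_tnthP := m_pos; apply.
have headE : head 0%N m = tnth m ord0 by rewrite (tnth_nth 0%N) nth0.
have mono (i i' : 'I_j.+1) : (i <= i')%N -> (tnth m i <= tnth m i')%N.
  move=> ii'; rewrite !(tnth_nth 0%N).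
  by apply: (sorted_leq_nth leq_trans leqnn 0%N m_sorted); rewrite ?inE ?size_tuple.
have lastE : M = tnth m ord_max by rewrite (tnth_nth 0%N) /M -nth_last size_tuple.
have mP i : (tnth m ord0 <= tnth m i <= M)%N by rewrite lastE !mono // -ltnS.
have M_gt0 : (0 < M)%N by rewrite lastE.
have {}le := ramsey_factor_ln M_gt0 le.
have big : (1 < M -> size_factor Delta j.-1 * M <= #|T| /\
    core_bound Delta * (part_factor Delta j.-1 * M *
      (up_log 2 (part_factor Delta j.-1 * M)).+1 ^ 3) <= #|T|)%N.
  by move=> M1; apply: ramsey_factorP.
(* The lower bound needs the smallest part to be no larger than [T]. For [M > 1] this follows from
   the size bound; for [M = 1] it holds because [T] is nonempty. *)
have headT : (tnth m ord0 <= #|T|)%N.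
  have /andP[m0M _] := mP ord_max; rewrite -lastE in m0M.
  case: (ltnP 1 M) => [M1|M1]; last first.
    by case: treeT => -[T0 _] _; apply: leq_trans T0; apply: leq_trans M1.
  have [h _] := big M1; apply: leq_trans h; apply: (leq_trans m0M).
  by rewrite leq_pmull // /size_factor; lia.
have ram : is_ramsey_number T (complete_multipartite m) (#|T|.-1 * j + head 0%N m).
  rewrite headE; split; first exact: (ramsey_upper treeT degT Delta_gt0 _ mP big).
  move=> N; case: treeT => T_conn _.
  apply: (@ramsey_lower T j.+1 m) => //; first by move=> i; have /andP[] := mP i.
  by rewrite m_gt0.
split=> //; split; first by case: treeT.
rewrite chromatic_multipartite // !subn1 (@sigma_multipartite _ _ m_gt0 _ ord0 erefl) -?headE //.
by move=> i; rewrite headE; have /andP[] := mP i.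
Qed.
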